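(* Let $K\subset\mathbf{C}$ be an analytic Jordan arc and let $z_0\in K$ be a point that is not an endpoint of $K$. Denote the two unit normals to $K$ at $z_0$ by $n_1(z_0)$ and $n_2(z_0)=-n_1(z_0)$. Then there is a sequence of real numbers $\varepsilon_n$, depending only on $K$ and $z_0$, with $\varepsilon_n\to 0$ as $n\to\infty$, such that for every $n$ and every polynomial $P_n$ (with complex coefficients) of degree $n$, $$|P_n'(z_0)|\le (1+\varepsilon_n)\, n\,\|P_n\|_K\cdot\max\left(\frac{\partial}{\partial n_1(z_0)}g_{\mathbf{C}_\infty\setminus K}(z_0,\infty),\ \frac{\partial}{\partial n_2(z_0)}g_{\mathbf{C}_\infty\setminus K}(z_0,\infty)\right).$$
   Context: $\mathbf{C}_\infty=\mathbf{C}\cup\{\infty\}$ is the extended complex plane; $\|\cdot\|_K$ is the supremum norm over $K$. An analytic Jordan arc is the image of a compact interval under an injective real-analytic map into $\mathbf{C}$ (analytic up to and including the endpoints) with nowhere vanishing derivative. For a domain $D\subset\mathbf{C}_\infty$ and $b\in D$, $g_D(z,b)$ denotes Green's function of $D$ with pole at $b$, extended by $0$ to the boundary. For a boundary point $z_0$ and a unit normal $n_j(z_0)$ (regarded as a complex number of modulus 1), the one-sided normal derivative is $$\frac{\partial}{\partial n_j(z_0)}g_D(z_0,b)=\lim_{t\to0+}\frac{g_D(z_0+t\,n_j(z_0),b)}{t}.$$ *)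

(* Defs.v *)
From HB Require Import structures.
From mathcomp Require Import all_boot all_order all_algebra.
From mathcomp Require Import complex.
From mathcomp Require Import all_classical all_reals all_analysis.

Set Implicit Arguments.
Unset Strict Implicit.
Unset Printing Implicit Defensive.

Import Order.TTheory GRing.Theory Num.Theory.
Import numFieldNormedType.Exports.

Local Open Scope classical_set_scope.
Local Open Scope ring_scope.
Local Open Scope complex_scope.

(* The real and imaginary parts complex.Re, complex.Im are R-valued.  The norm
   `|z| of R[i] is R[i]-valued; [modulus] is its real version.  The topology of
   the plane is that of R[i]^o, i.e. the one given by this norm. *)
Definition modulus (R : realType) (z : R[i]) : R := complex.Re `|z|.

Definition real_analytic_at (R : realType) (f : R -> R) (t0 : R) : Prop :=
  exists (c : R^nat) (r : R), 0 < r /\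
    forall t, `|t - t0| < r -> pseries c (t - t0) @ \oo --> f t.

Definition curve_derive (R : realType) (gamma : R -> R[i]) (t : R) : R[i] :=
  derive1 (@complex.Re R \o gamma) t +i* derive1 (@complex.Im R \o gamma) t.

(* Only the values of gamma near [a, b] matter: analyticity at a and at b is
   two-sided, i.e. gamma is analytic on an open interval containing [a, b]. *)
Definition analytic_arc_param (R : realType) (K : set R[i])
    (a b : R) (gamma : R -> R[i]) : Prop :=
  [/\ a < b,
      forall t, t \in `[a, b] ->
        real_analytic_at (@complex.Re R \o gamma) t /\
        real_analytic_at (@complex.Im R \o gamma) t,
      forall t, t \in `[a, b] -> curve_derive gamma t != 0,
      {in `[a, b] &, injective gamma} &
      K = gamma @` `[a, b] ].

Definition analytic_jordan_arc (R : realType) (K : set R[i]) : Prop :=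
  exists a b gamma, analytic_arc_param K a b gamma.

Definition arc_endpoint (R : realType) (K : set R[i]) (z : R[i]) : Prop :=
  exists a b gamma,
    analytic_arc_param K a b gamma /\ (z = gamma a \/ z = gamma b).

(* The last condition is orthogonality of nu and the tangent vector, for the
   Euclidean inner product Re (u * v^* ) of the plane. *)
Definition unit_normal (R : realType) (K : set R[i]) (z nu : R[i]) : Prop :=
  modulus nu = 1 /\
  exists a b gamma t,
    [/\ analytic_arc_param K a b gamma, t \in `[a, b], z = gamma t &
        complex.Re (nu * (curve_derive gamma t)^*) = 0].

Definition partial_x (R : realType) (u : R[i] -> R) (z : R[i]) : R :=
  derive1 (fun s : R => u (s +i* complex.Im z)) (complex.Re z).

Definition partial_y (R : realType) (u : R[i] -> R) (z : R[i]) : R :=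
  derive1 (fun s : R => u (complex.Re z +i* s)) (complex.Im z).

Definition has_partials (R : realType) (u : R[i] -> R) (z : R[i]) : Prop :=
  derivable (fun s : R => u (s +i* complex.Im z)) (complex.Re z) 1 /\
  derivable (fun s : R => u (complex.Re z +i* s)) (complex.Im z) 1.

(* U is meant to be open: u is C^2 on U with vanishing Laplacian. *)
Definition harmonic_on (R : realType) (U : set R[i]) (u : R[i] -> R) : Prop :=
  forall z : R[i]^o, U z ->
    [/\ continuous_at z u /\ has_partials u z,
        continuous_at z (partial_x u) /\ has_partials (partial_x u) z,
        continuous_at z (partial_y u) /\ has_partials (partial_y u) z,
        [/\ continuous_at z (partial_x (partial_x u)),
            continuous_at z (partial_y (partial_x u)),
            continuous_at z (partial_x (partial_y u)) &
            continuous_at z (partial_y (partial_y u))] &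
        partial_x (partial_x u) z + partial_y (partial_y u) z = 0].

(* g is Green's function, with pole at infinity, of the complement of the
   compact set K in the Riemann sphere: it is harmonic off K and infinity,
   has the logarithmic singularity log |z| + O(1) at infinity, tends to 0 at
   the boundary and is extended by 0 to K.  These conditions determine g. *)
Definition is_green_infty (R : realType) (K : set R[i]) (g : R[i] -> R)
    : Prop :=
  [/\ harmonic_on (~` K) g,
      exists M r : R, forall z,
        r < modulus z -> `|g z - ln (modulus z)| <= M,
      forall zeta, K zeta ->
        g @ within (~` K) (nbhs (zeta : R[i]^o)) --> (0 : R) &
      forall zeta, K zeta -> g zeta = 0].

(* The increment g z0 is omitted because g vanishes on the boundary. *)
Definition normal_derivative (R : realType) (g : R[i] -> R) (z0 nu : R[i])
    : R :=
  lim ((g (z0 + t%:C * nu) / t) @[t --> (0 : R)^'+]).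

Definition supnorm (R : realType) (K : set R[i]) (f : R[i] -> R[i]) : R :=
  sup [set modulus (f z) | z in K].

(* Main.v *)
Require Import Defs.
From mathcomp Require Import all_boot all_order all_algebra.
From mathcomp Require Import complex.
From mathcomp Require Import all_classical all_reals all_analysis.
From mathcomp Require Import ring lra.

Import Order.TTheory GRing.Theory Num.Theory.
Import numFieldNormedType.Exports.

Set Implicit Arguments.
Unset Strict Implicit.
Unset Printing Implicit Defensive.

Local Open Scope classical_set_scope.
Local Open Scope ring_scope.
Local Open Scope complex_scope.

(* The proof uses nothing but the maximum principle, in the form that a function
   whose four-point Laplacian is asymptotically nonnegative has no strict interior
   maximum.

   Let Gam be a chart, i.e. the analytic extension of a parametrization of K near
   z0.  Green's function pulled back by Gam is harmonic off the real axis and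
   vanishes on it; applying a barrier to its reflections in vertical lines bounds
   its tangential differences, and then g (Gam (x + i y)) = al * y + O((|x| + y) y)
   on one side, and likewise with be on the other side.  Both normal derivatives
   cannot vanish: otherwise, by Hopf's lemma and the strong minimum principle along
   the arc, g would vanish near K and be harmonic in the whole plane.

   By the Bernstein-Walsh inequality F = P o Gam / ||P|| satisfies
   |F (x + i y)| <= exp (n (m + O(dl)) |y|) for |x|, |y| <= dl, m = max al be.
   Let G be the real part of a rotation of F on the real axis, extended
   analytically.  Green's function of the complement of [-1, 1] evaluated at G is
   subharmonic, vanishes on the real axis and is at most n (m + O(dl)) y + ln 4, so it is
   at most (n (m + O(dl)) + 2 ln 4 / dl) y on the imaginary axis.  Letting y tend to 0
   bounds |F' (0)| by the same slope, and dl of order n ^ (-1/2) gives the theorem with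
   eps n = O(n ^ (-1/2)). *)

(** Analytic functions enter only through second order expansions with cubic remainder ([taylor2]).
    That is all the four-point Laplacian can see, since it is tested against [h ^+ 2], so every
    harmonic or subharmonic composition comes from an explicit cancellation over the steps h, -h,
    ih, -ih.

    The sharp constant comes from comparing with Green's function of a segment: a Cauchy estimate
    based on the exponential bound for F would lose a constant factor, whereas ln J, J =
    [joukowski_modulus], vanishes on [-1, 1], which contains the values of G on the axis, and bounds
    |Im G| by sinh (ln J), that is by ln J up to second order. The price is the additive ln 4, from
    J <= 2 |G| + 2 <= 4 exp (sigma y); the linear barrier turns it into the extra slope 2 ln 4 / dl.

    The sequence [eps] has to be fixed before Green's function is given. This is why uniqueness of
    Green's function is proved: [eps] is built from one such function and then serves for all. It is
    a relative error, obtained on dividing by m; this is where the positivity of one normal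
    derivative is spent. *)

Lemma le_of_eq (R : realType) (x y : R) : x = y -> x <= y.
Proof. by move=> ->. Qed.

(** * The maximum principle *)

Lemma disc_le (R : realType) (x y r : R) :
  0 <= r -> x ^+ 2 + y ^+ 2 <= r ^+ 2 -> `|x| <= r /\ `|y| <= r.
Proof.
move=> r0 h; have h1 := sqr_ge0 x; have h2 := sqr_ge0 y.
by split; rewrite ler_norml; apply/andP; split; nra.
Qed.

Lemma disc_lt (R : realType) (x y r : R) :
  0 < r -> x ^+ 2 + y ^+ 2 < r ^+ 2 -> (- r < x < r) /\ (- r < y < r).
Proof.
move=> r0 h; have h1 := sqr_ge0 x; have h2 := sqr_ge0 y.
by split; apply/andP; split; nra.
Qed.

Variant cont2 (R : realType) (u : R -> R -> R) (x y : R) : Prop :=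
  Cont2 of (fun p : R * R => u p.1 p.2) @ nbhs (x, y) --> u x y.

Definition lap4 (R : realType) (u : R -> R -> R) (x y h : R) : R :=
  u (x + h) y + u (x - h) y + u x (y + h) + u x (y - h) - 4 * u x y.

(** For a C^2 function [lap4 u x y h / h ^+ 2] tends to the Laplacian, so this is the condition that
    the Laplacian is nonnegative at the point. In this form it makes sense for functions such as ln
    (max 1 |P|) and passes to functions touched from below. *)
Definition subharm (R : realType) (u : R -> R -> R) (x y : R) : Prop :=
  forall e : R, 0 < e -> exists2 d, 0 < d &
    forall h : R, 0 < h -> h < d -> - (e * h ^+ 2) <= lap4 u x y h.

Definition harm (R : realType) (u : R -> R -> R) (x y : R) : Prop :=
  forall e : R, 0 < e -> exists2 d, 0 < d &
    forall h : R, 0 < h -> h < d -> `|lap4 u x y h| <= e * h ^+ 2.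

Lemma cont2P (R : realType) (u : R -> R -> R) (x y : R) :
  cont2 u x y <-> forall e : R, 0 < e -> exists2 d, 0 < d &
    forall x' y', `|x' - x| < d -> `|y' - y| < d -> `|u x' y' - u x y| < e.
Proof.
split=> [[/cvgrPdist_lt cu] e e0|cu].
  have /nbhs_ballP[d /= d0 hd] := cu e e0.
  exists d => // x' y' xx yy; rewrite distrC; apply: (hd (x', y')).
  by split; rewrite /ball /= distrC.
constructor; apply/cvgrPdist_lt => e e0; have [d d0 hd] := cu e e0.
apply/nbhs_ballP; exists d => //= -[x' y'] [/= xx yy].
by rewrite distrC; apply: hd; rewrite distrC.
Qed.

Lemma cont2_cst (R : realType) (c x y : R) : cont2 (fun _ _ => c) x y.
Proof. by constructor; exact: cvg_cst. Qed.

Lemma cont2_fst (R : realType) (x y : R) : cont2 (fun x _ => x) x y.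
Proof. by constructor; exact: cvg_fst. Qed.

Lemma cont2_snd (R : realType) (x y : R) : cont2 (fun _ y => y) x y.
Proof. by constructor; exact: cvg_snd. Qed.

Lemma cont2D (R : realType) (u v : R -> R -> R) (x y : R) :
  cont2 u x y -> cont2 v x y -> cont2 (fun x y => u x y + v x y) x y.
Proof. by move=> [cu] [cv]; constructor; exact: cvgD. Qed.

Lemma cont2N (R : realType) (u : R -> R -> R) (x y : R) :
  cont2 u x y -> cont2 (fun x y => - u x y) x y.
Proof. by move=> [cu]; constructor; exact: cvgN. Qed.

Lemma cont2B (R : realType) (u v : R -> R -> R) (x y : R) :
  cont2 u x y -> cont2 v x y -> cont2 (fun x y => u x y - v x y) x y.
Proof. by move=> [cu] [cv]; constructor; exact: cvgB. Qed.

Lemma cont2M (R : realType) (u v : R -> R -> R) (x y : R) :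
  cont2 u x y -> cont2 v x y -> cont2 (fun x y => u x y * v x y) x y.
Proof. by move=> [cu] [cv]; constructor; exact: cvgM. Qed.

Lemma cont2X (R : realType) (u : R -> R -> R) (n : nat) (x y : R) :
  cont2 u x y -> cont2 (fun x y => u x y ^+ n) x y.
Proof.
move=> cu; elim: n => [|n IH]; first exact: cont2_cst.
have -> : (fun x y => u x y ^+ n.+1) = (fun x y => u x y * u x y ^+ n).
  by apply/funext => a; apply/funext => b; rewrite exprS.
exact: cont2M.
Qed.

Lemma cont2_comp (R : realType) (u : R -> R -> R) (phi : R -> R) (x y : R) :
  cont2 u x y -> {for u x y, continuous phi} ->
  cont2 (fun x y => phi (u x y)) x y.
Proof. by move=> [cu] cphi; constructor; apply: (cvg_comp _ _ cu); exact: cphi. Qed.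

Ltac solve_cont2 :=
  repeat first [ assumption | apply: cont2_cst | apply: cont2_fst
               | apply: cont2_snd | apply: cont2X | apply: cont2D
               | apply: cont2N | apply: cont2M ].

Lemma cont2_comp2 (R : realType) (u f g : R -> R -> R) (x y : R) :
  cont2 u (f x y) (g x y) -> cont2 f x y -> cont2 g x y ->
  cont2 (fun x y => u (f x y) (g x y)) x y.
Proof.
move=> /cont2P cu /cont2P cf /cont2P cg; apply/cont2P => e /cu[d d0 hd].
have [d1 d10 h1] := cf _ d0; have [d2 d20 h2] := cg _ d0.
exists (Num.min d1 d2); first by rewrite lt_min d10.
move=> x' y'; rewrite !lt_min => /andP[? ?] /andP[? ?].
by apply: hd; [exact: h1|exact: h2].
Qed.

Lemma cont2_near (R : realType) (u : R -> R -> R) (x y c : R) :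
  cont2 u x y -> u x y < c ->
  exists2 d, 0 < d & forall x' y', `|x' - x| < d -> `|y' - y| < d -> u x' y' < c.
Proof.
move=> /cont2P cu uc; have [|d d0 hd] := cu (c - u x y); first by rewrite subr_gt0.
exists d => // x' y' xx yy; have := hd _ _ xx yy.
by move=> /(le_lt_trans (ler_norm _)); rewrite ltrD2r.
Qed.

Lemma box_max (R : realType) (u : R -> R -> R) (a b c d : R) :
  a <= b -> c <= d ->
  (forall x y : R, a <= x -> x <= b -> c <= y -> y <= d -> cont2 u x y) ->
  exists x y, [/\ a <= x <= b, c <= y <= d &
    forall x' y', a <= x' -> x' <= b -> c <= y' -> y' <= d -> u x' y' <= u x y].
Proof.
move=> ab cd cu.
have cA : compact (`[a, b] `*` `[c, d] : set (R * R)).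
  by apply: compact_setX; exact: segment_compact.
have A0 : (`[a, b] `*` `[c, d] : set (R * R)) !=set0.
  by exists (a, c); split; rewrite /= in_itv /= lexx.
have cf : {within `[a, b] `*` `[c, d], continuous (fun p : R * R => u p.1 p.2)}.
  apply: continuous_in_subspaceT => -[x y] /set_mem[] /=.
  by rewrite !in_itv /= => /andP[? ?] /andP[? ?]; by case: (cu x y).
have [[x y] /set_mem[] /= xab ycd m] := compact_EVT_max A0 cA cf.
move: xab ycd; rewrite !in_itv /= => xab ycd.
exists x, y; split=> // x' y' ? ? ? ?; apply: (m (x', y')).
by apply/mem_set; split; rewrite /= in_itv /=; apply/andP.
Qed.

Lemma subharmD (R : realType) (u v : R -> R -> R) (x y : R) :
  subharm u x y -> subharm v x y -> subharm (fun x y => u x y + v x y) x y.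
Proof.
move=> su sv e e0; have e20 : 0 < e / 2 by rewrite divr_gt0.
have [d1 d10 h1] := su _ e20; have [d2 d20 h2] := sv _ e20.
exists (Num.min d1 d2); first by rewrite lt_min d10.
move=> h h0; rewrite lt_min => /andP[hd1 hd2].
by have := h1 _ h0 hd1; have := h2 _ h0 hd2; rewrite /lap4; lra.
Qed.

Lemma subharmZ (R : realType) (u : R -> R -> R) (c x y : R) :
  0 <= c -> subharm u x y -> subharm (fun x y => c * u x y) x y.
Proof.
move=> c0 su e e0.
have c10 : 0 < c + 1 by lra.
have [d d0 hd] := su _ (divr_gt0 e0 c10); exists d => // h h0 hlt.
rewrite (_ : lap4 _ _ _ _ = c * lap4 u x y h); last by rewrite /lap4; ring.
apply: le_trans (ler_wpM2l c0 (hd _ h0 hlt)).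
rewrite mulrN lerN2 mulrA; apply: ler_wpM2r; first exact: sqr_ge0.
by rewrite mulrA ler_pdivrMr//; nra.
Qed.

(** Replacing v by u leaves the centre value alone and can only increase the four neighbouring
    values. Maxima and other non-smooth functions are handled through such a minorant touching at
    the point. *)
Lemma subharm_ge (R : realType) (u v : R -> R -> R) (x y : R) :
  subharm v x y -> v x y = u x y ->
  (exists2 d, 0 < d &
     forall x' y', `|x' - x| < d -> `|y' - y| < d -> v x' y' <= u x' y') ->
  subharm u x y.
Proof.
move=> sv vu [d d0 vleu] e e0; have [d1 d10 h1] := sv _ e0.
exists (Num.min d d1); first by rewrite lt_min d0.
move=> h h0; rewrite lt_min => /andP[hd hd1].
apply: (le_trans (h1 _ h0 hd1)); rewrite /lap4 vu lerD2r.
have H1 : `|h| < d by rewrite gtr0_norm.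
have H2 : `|- h| < d by rewrite normrN gtr0_norm.
by rewrite !lerD// vleu// ?subrr ?normr0// addrC addKr.
Qed.

Lemma subharm_min (R : realType) (u : R -> R -> R) (x y : R) :
  (forall x' y', u x y <= u x' y') -> subharm u x y.
Proof.
move=> umin; apply: (@subharm_ge _ _ (fun _ _ => u x y)) => //; last by exists 1.
by move=> e e0; exists 1 => // h h0 _; rewrite /lap4; nra.
Qed.

Lemma harm_sub (R : realType) (u : R -> R -> R) (x y : R) :
  harm u x y -> subharm u x y.
Proof.
move=> hu e /hu[d d0 hd]; exists d => // h h0 hlt.
by have := hd _ h0 hlt; rewrite ler_norml => /andP[].
Qed.

Lemma harmD (R : realType) (u v : R -> R -> R) (x y : R) :
  harm u x y -> harm v x y -> harm (fun x y => u x y + v x y) x y.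
Proof.
move=> su sv e e0; have e20 : 0 < e / 2 by rewrite divr_gt0.
have [d1 d10 h1] := su _ e20; have [d2 d20 h2] := sv _ e20.
exists (Num.min d1 d2); first by rewrite lt_min d10.
move=> h h0; rewrite lt_min => /andP[hd1 hd2].
rewrite (_ : lap4 _ _ _ _ = lap4 u x y h + lap4 v x y h); last by rewrite /lap4; ring.
apply: (le_trans (ler_normD _ _)).
by have := h1 _ h0 hd1; have := h2 _ h0 hd2; lra.
Qed.

Lemma harmZ (R : realType) (u : R -> R -> R) (c x y : R) :
  harm u x y -> harm (fun x y => c * u x y) x y.
Proof.
move=> su e e0.
have c10 : 0 < `|c| + 1 by rewrite ltr_wpDl.
have [d d0 hd] := su _ (divr_gt0 e0 c10); exists d => // h h0 hlt.
rewrite (_ : lap4 _ _ _ _ = c * lap4 u x y h); last by rewrite /lap4; ring.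
rewrite normrM; apply: le_trans (ler_wpM2l (normr_ge0 c) (hd _ h0 hlt)) _.
rewrite mulrA; apply: ler_wpM2r; first exact: sqr_ge0.
by rewrite mulrA ler_pdivrMr//; have := normr_ge0 c; nra.
Qed.

Lemma harmN (R : realType) (u : R -> R -> R) (x y : R) :
  harm u x y -> harm (fun x y => - u x y) x y.
Proof.
move=> /(@harmZ _ _ (-1)); congr harm.
by apply/funext => a; apply/funext => b; rewrite mulN1r.
Qed.

Lemma harmB (R : realType) (u v : R -> R -> R) (x y : R) :
  harm u x y -> harm v x y -> harm (fun x y => u x y - v x y) x y.
Proof. by move=> hu hv; apply: harmD => //; exact: harmN. Qed.

Lemma eq_harm (R : realType) (u v : R -> R -> R) (x y x' y' : R) :
  (forall h : R, lap4 v x y h = lap4 u x' y' h) -> harm u x' y' -> harm v x y.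
Proof. by move=> e hu c /hu[d d0 hd]; exists d => // h h0 /(hd _ h0); rewrite e. Qed.

(* If the maximum were positive, it would stay positive and interior after
   adding a small multiple of [x ^+ 2], contradicting subharmonicity. *)
Lemma max_principle (R : realType) (u : R -> R -> R) (a b c d : R) :
  (forall x y : R, a <= x -> x <= b -> c <= y -> y <= d -> cont2 u x y) ->
  (forall x y : R, a <= x -> x <= b -> c <= y -> y <= d -> 0 < u x y ->
     [/\ a < x < b, c < y < d & subharm u x y]) ->
  forall x y : R, a <= x -> x <= b -> c <= y -> y <= d -> u x y <= 0.
Proof.
move=> cu su x0 y0 ax xb cy yd; rewrite leNgt; apply/negP => u0.
pose S := `|a| + `|b| + 1.
have S0 : 0 < S by rewrite /S ltr_wpDl// addr_ge0.
(* On the box the perturbation [e * x ^+ 2] is at most a quarter of [u x0 y0], so u is still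
   positive where u + e x^2 is largest. *)
pose e := u x0 y0 / (4 * S ^+ 2).
have S20 : 0 < S ^+ 2 by rewrite exprn_gt0.
have e0 : 0 < e by rewrite divr_gt0// mulr_gt0.
have eS : e * S ^+ 2 = u x0 y0 / 4 by rewrite /e; field; exact: lt0r_neq0.
pose v x y := u x y + e * x ^+ 2.
have [|x [y [/andP[ax1 xb1] /andP[cy1 yd1] mx]]] := @box_max _ v _ _ _ _ (le_trans ax xb) (le_trans cy yd).
  move=> x y *; rewrite /v; solve_cont2; exact: cu.
have xS t : a <= t -> t <= b -> t ^+ 2 <= S ^+ 2.
  move=> at1 tb1; have S1 : t <= S.
    by rewrite /S; have := ler_norm b; have := normr_ge0 a; lra.
  have S2 : - t <= S.
    by rewrite /S; have := ler_norm (- a); rewrite normrN; have := normr_ge0 b; lra.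
  have : 0 <= (S - t) * (S + t) by apply: mulr_ge0; lra.
  lra.
have uxy : 0 < u x y.
  have := mx _ _ ax xb cy yd; rewrite /v => H.
  have : e * x ^+ 2 <= e * S ^+ 2 by rewrite ler_pM2l// xS.
  have : 0 <= e * x0 ^+ 2 by rewrite mulr_ge0 ?sqr_ge0// ltW.
  by rewrite eS; lra.
have [/andP[ax2 xb2] /andP[cy2 yd2] sxy] := su _ _ ax1 xb1 cy1 yd1 uxy.
(* The perturbation adds 2 e h^2 to the four-point Laplacian, while u loses at most e h^2: the sum
   is positive, which is impossible at a maximum. *)
have [r r0 hr] := sxy _ e0.
pose h := Num.min (r / 2) (Num.min (Num.min (x - a) (b - x)) (Num.min (y - c) (d - y))).
have h0 : 0 < h by rewrite /h !lt_min !subr_gt0 divr_gt0//= ax2 xb2 cy2.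
have [h1 h2 h3 h4 h5] : [/\ h <= r / 2, h <= x - a, h <= b - x, h <= y - c & h <= d - y].
  by split; rewrite /h !ge_min lexx ?orbT.
have hlt : h < r by clear -h1 r0; lra.
have := hr _ h0 hlt.
have m1 := mx (x + h) y; have m2 := mx (x - h) y.
have m3 := mx x (y + h); have m4 := mx x (y - h).
have {}m1 : v (x + h) y <= v x y by apply: m1; clear -h0 h2 h3 h4 h5 cy1 yd1; lra.
have {}m2 : v (x - h) y <= v x y by apply: m2; clear -h0 h2 h3 h4 h5 cy1 yd1; lra.
have {}m3 : v x (y + h) <= v x y by apply: m3; clear -h0 h2 h3 h4 h5 ax1 xb1; lra.
have {}m4 : v x (y - h) <= v x y by apply: m4; clear -h0 h2 h3 h4 h5 ax1 xb1; lra.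
have eh : 0 < e * h ^+ 2 by rewrite mulr_gt0// exprn_gt0.
rewrite /lap4; move: m1 m2 m3 m4 eh; rewrite /v; clear; lra.
Qed.

(** * Boundary behaviour of harmonic functions *)

Lemma subharm_lap0 (R : realType) (u : R -> R -> R) (x y : R) :
  (forall h : R, lap4 u x y h = 0) -> subharm u x y.
Proof.
by move=> l0 e e0; exists 1 => // h h0 _; rewrite l0 oppr_le0 mulr_ge0 ?sqr_ge0 ?ltW.
Qed.

(** The barrier b = (x - x0)^2 + y (2 r - y) is harmonic, nonnegative for 0 <= y <= r, and at least
    r^2 on the top and on every lateral side at distance r or more from x0. Hence B / r^2 times b
    dominates v on the boundary, and on x = x0 it is at most 2 B y / r. The alternative for each
    lateral side leaves room for boxes cut off closer to x0, where v is already nonpositive. *)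
Lemma linear_bound (R : realType) (v : R -> R -> R) (x0 x1 x2 r B : R) :
  0 < r -> 0 <= B -> x1 <= x0 -> x0 <= x2 ->
  (forall x y : R, x1 <= x -> x <= x2 -> 0 <= y -> y <= r -> cont2 v x y) ->
  (forall x y : R, x1 < x -> x < x2 -> 0 < y -> y < r -> subharm v x y) ->
  (forall x y : R, x1 <= x -> x <= x2 -> 0 <= y -> y <= r -> v x y <= B) ->
  (forall x : R, x1 <= x -> x <= x2 -> v x 0 <= 0) ->
  (forall y : R, 0 <= y -> y <= r -> v x1 y <= 0 \/ r <= x0 - x1) ->
  (forall y : R, 0 <= y -> y <= r -> v x2 y <= 0 \/ r <= x2 - x0) ->
  forall y : R, 0 <= y -> y <= r -> v x0 y <= 2 * B * y / r.
Proof.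
move=> r0 B0 x10 x02 cv sv vB bot lft rgt y y0 yr.
pose k := B / r ^+ 2.
have kB : k * r ^+ 2 = B by rewrite /k; field; exact: lt0r_neq0.
have k0 : 0 <= k by rewrite divr_ge0 ?sqr_ge0.
pose b x y := (x - x0) ^+ 2 - y ^+ 2 + 2 * r * y.
have b0 x z : 0 <= z -> z <= r -> (x - x0) ^+ 2 <= b x z.
  by move=> z0 zr; rewrite /b; clear -z0 zr r0; nra.
have bpos x z : 0 <= z -> z <= r -> 0 <= b x z.
  by move=> z0 zr; apply: le_trans (b0 x z z0 zr); exact: sqr_ge0.
have bB x z : r ^+ 2 <= b x z -> B <= k * b x z.
  by move=> h; rewrite -kB; apply: ler_wpM2l.
pose w x y := v x y + - k * b x y.
have cw x z : x1 <= x -> x <= x2 -> 0 <= z -> z <= r -> cont2 w x z.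
  by move=> *; rewrite /w /b; solve_cont2; exact: cv.
have {}vB x z : x1 <= x -> x <= x2 -> 0 <= z -> z <= r -> r ^+ 2 <= b x z -> w x z <= 0.
  move=> h1 h2 h3 h4 /bB; have := vB _ _ h1 h2 h3 h4; rewrite /w; lra.
have wpos x z : x1 <= x -> x <= x2 -> 0 <= z -> z <= r -> 0 < w x z ->
     [/\ x1 < x < x2, 0 < z < r & subharm w x z].
  move=> h1 h2 h3 h4 w0.
  have vw : v x z <= 0 -> False.
    by move=> v0; have := mulr_ge0 k0 (bpos x z h3 h4); move: w0; rewrite /w; lra.
  have wb : r ^+ 2 <= b x z -> False.
    by move=> hb; have := vB _ _ h1 h2 h3 h4 hb; move: w0; lra.
  have z0 : z != 0 by apply/eqP => z0; subst z; exact: (vw (bot _ h1 h2)).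
  have zr : z != r.
    apply/eqP => zr; subst z; apply: wb; rewrite /b; have := sqr_ge0 (x - x0); lra.
  have xx1 : x != x1.
    apply/eqP => xx; subst x; have [//|h] := lft _ h3 h4; apply: wb.
    by apply: le_trans (b0 _ _ h3 h4); clear -h r0; nra.
  have xx2 : x != x2.
    apply/eqP => xx; subst x; have [//|h] := rgt _ h3 h4; apply: wb.
    by apply: le_trans (b0 _ _ h3 h4); clear -h r0; nra.
  have lt1 : x1 < x < x2 by rewrite !lt_neqAle h1 h2 eq_sym xx1 xx2.
  have lt2 : 0 < z < r by rewrite !lt_neqAle h3 h4 eq_sym z0 zr.
  split=> //; move: lt1 lt2 => /andP[? ?] /andP[? ?].
  apply: subharmD; first exact: sv.
  by apply: subharm_lap0 => h; rewrite /lap4 /b; ring.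
have := max_principle cw wpos x10 x02 y0 yr.
rewrite /w /b subrr expr0n /= add0r => H.
have -> : 2 * B * y / r = k * (2 * r * y) by rewrite /k; field; exact: lt0r_neq0.
have : 0 <= k * y ^+ 2 by rewrite mulr_ge0// sqr_ge0.
move: H; clear; lra.
Qed.

Definition harm_halfbox (R : realType) (u : R -> R -> R) (X : R) : Prop :=
  [/\ forall x y : R, `|x| <= X -> 0 <= y -> y <= X -> cont2 u x y,
      forall x y : R, `|x| <= X -> 0 < y -> y <= X -> harm u x y &
      forall x : R, `|x| <= X -> u x 0 = 0].

Lemma harm_halfboxN (R : realType) (u : R -> R -> R) (X : R) :
  harm_halfbox u X -> harm_halfbox (fun x y => - u x y) X.
Proof.
move=> [cu hu u0]; split=> [x y h1 h2 h3|x y h1 h2 h3|x h1].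
- by apply: cont2N; exact: cu.
- by apply: harmN; exact: hu.
- by rewrite u0// oppr0.
Qed.

Lemma linear_bound_halfbox (R : realType) (u : R -> R -> R) (X x0 r B : R) :
  harm_halfbox u X -> 0 < r -> `|x0| + r <= X ->
  (forall x y : R, `|x - x0| <= r -> 0 <= y -> y <= r -> `|u x y| <= B) ->
  forall y : R, 0 <= y -> y <= r -> `|u x0 y| <= 2 * B * y / r.
Proof.
move=> hb r0 x0r uB y y0 yr.
have B0 : 0 <= B.
  by apply: le_trans (uB x0 0 _ _ _) => //; rewrite ?subrr ?normr0// ltW.
have inr (x : R) : x0 - r <= x -> x <= x0 + r -> `|x - x0| <= r.
  by move=> ? ?; rewrite ler_norml; apply/andP; split; lra.
have inX (x : R) : x0 - r <= x -> x <= x0 + r -> `|x| <= X.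
  move=> h1 h2; apply: le_trans x0r; rewrite -{1}(subrK x0 x) addrC.
  by apply: le_trans (ler_normD _ _) _; rewrite lerD2l inr.
have rX : r <= X by apply: le_trans x0r; rewrite lerDr.
have one (v : R -> R -> R) : harm_halfbox v X ->
    (forall x z : R, `|x - x0| <= r -> 0 <= z -> z <= r -> `|v x z| <= B) ->
    v x0 y <= 2 * B * y / r.
  move=> [cv hv v0] vB; apply: (@linear_bound _ v x0 (x0 - r) (x0 + r)) => //.
  - by lra.
  - by lra.
  - by move=> x z *; apply: cv; rewrite ?inX//; lra.
  - by move=> x z *; apply: harm_sub; apply: hv; rewrite ?inX//; lra.
  - move=> x z h1 h2 h3 h4; have := vB x z (inr _ h1 h2) h3 h4.
    by rewrite ler_norml => /andP[].
  - by move=> x h1 h2; rewrite v0 ?inX.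
  - by move=> *; right; lra.
  - by move=> *; right; lra.
rewrite ler_norml (one _ hb uB) andbT lerNl.
by apply: (one _ (harm_halfboxN hb)) => x z *; rewrite normrN uB.
Qed.

(* Reflecting [u] in the vertical line through [x0] gives a harmonic function
   of [(s, y)] that vanishes on [s = 0] as well. *)
Lemma reflection_bound (R : realType) (u : R -> R -> R) (r B x0 s y : R) :
  0 < r -> harm_halfbox u (4 * r) ->
  (forall x y : R, `|x| <= 4 * r -> 0 <= y -> y <= 4 * r -> `|u x y| <= B) ->
  `|x0| <= 2 * r -> 0 <= s -> s <= r -> 0 <= y -> y <= 3 * r ->
  u (x0 + s) y - u (x0 - s) y <= 4 * B * s / r.
Proof.
move=> r0 [cu hu u0] uB x0r s0 sr y0 yr.
have B0 : 0 <= B.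
  by apply: le_trans (uB 0 0 _ _ _) => //; rewrite ?normr0//; lra.
(* The coordinates are exchanged: the first argument is the old height, the second the distance to
   the line of reflection, which plays the role of the bottom side. *)
pose v t z := u (x0 + z) t - u (x0 - z) t.
have inX (z : R) : 0 <= z -> z <= r -> `|x0 + z| <= 4 * r /\ `|x0 - z| <= 4 * r.
  by move: x0r; rewrite !ler_norml => /andP[? ?] ? ?; split; apply/andP; split; lra.
have -> : 4 * B * s / r = 2 * (2 * B) * s / r by lra.
(* When y < r the box is cut at height 0, where u and hence v vanish; this is the first alternative
   for a lateral side in [linear_bound]. *)
pose y1 := Num.max 0 (y - r).
have y10 : 0 <= y1 by rewrite le_max lexx.
have y1y : y1 <= y by rewrite ge_max y0 /=; lra.
apply: (@linear_bound _ v y y1 (y + r) r (2 * B)) => //.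
- by lra.
- by lra.
- move=> t z h1 h2 z0 zr; have [hp hm] := inX z z0 zr.
  have t0 : 0 <= t by apply: le_trans y10 h1.
  have t4 : t <= 4 * r by lra.
  by apply: cont2B; apply: cont2_comp2; solve_cont2; apply: cu.
- move=> t z h1 h2 z0 zr; have [hp hm] := inX z (ltW z0) (ltW zr).
  have t0 : 0 < t by apply: le_lt_trans y10 h1.
  have t4 : t <= 4 * r by lra.
  apply: harm_sub; apply: harmB.
    by apply: (@eq_harm _ u _ _ _ (x0 + z) t) (hu _ _ hp t0 t4) => h; rewrite /lap4 !addrA; ring.
  apply: (@eq_harm _ u _ _ _ (x0 - z) t) (hu _ _ hm t0 t4) => h.
  by rewrite /lap4 !opprD !opprK !addrA; ring.
- move=> t z h1 h2 z0 zr; have [hp hm] := inX z z0 zr.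
  have t0 : 0 <= t by apply: le_trans y10 h1.
  have t4 : t <= 4 * r by lra.
  have := uB _ _ hp t0 t4; have := uB _ _ hm t0 t4.
  by rewrite !ler_norml => /andP[? ?] /andP[? ?]; rewrite /v; lra.
- by move=> t _ _; rewrite /v addr0 subr0 subrr.
- move=> z z0 zr; have [hp hm] := inX z z0 zr.
  rewrite /y1; case: (leP (y - r) 0) => h; last by right; lra.
  by left; rewrite /v !u0 ?subrr.
- by move=> *; right; lra.
Qed.

(** The symmetric difference V (x, y) = u (x + s, y) - u (x - s, y) is harmonic, vanishes on the
    axis and is O(s) by [reflection_bound]; [linear_bound_halfbox] applied to V then gains the
    factor y. *)
Lemma tangential_lipschitz (R : realType) (u : R -> R -> R) (r B x1 x2 y : R) :
  0 < r -> harm_halfbox u (4 * r) ->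
  (forall x y : R, `|x| <= 4 * r -> 0 <= y -> y <= 4 * r -> `|u x y| <= B) ->
  `|x1| <= r -> `|x2| <= r -> 0 <= y -> y <= r ->
  `|u x2 y - u x1 y| <= 4 * B * `|x2 - x1| * y / r ^+ 2.
Proof.
move=> r0 hb uB; wlog x12 : x1 x2 / x1 <= x2.
  move=> H h1 h2 h3 h4; case: (leP x1 x2) => [x12|/ltW x12]; first exact: H.
  by rewrite distrC (distrC x2); exact: H.
move=> h1 h2 y0 yr.
pose x0 := (x1 + x2) / 2; pose s := (x2 - x1) / 2.
have s0 : 0 <= s by rewrite /s; lra.
have sr : s <= r.
  by move: h1 h2; rewrite /s !ler_norml => /andP[? ?] /andP[? ?]; lra.
have x0r : `|x0| <= r.
  by move: h1 h2; rewrite /x0 !ler_norml => /andP[? ?] /andP[? ?]; apply/andP; split; lra.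
have e1 : x1 = x0 - s by rewrite /x0 /s; lra.
have e2 : x2 = x0 + s by rewrite /x0 /s; lra.
have -> : `|x2 - x1| = 2 * s by rewrite ger0_norm ?subr_ge0// /s; lra.
rewrite e1 e2.
pose V x y := u (x + s) y - u (x - s) y.
have [cu hu u0] := hb.
have inX (x : R) : `|x| <= 2 * r -> `|x + s| <= 4 * r /\ `|x - s| <= 4 * r.
  by rewrite !ler_norml => /andP[? ?]; split; apply/andP; split; lra.
have hV : harm_halfbox V (2 * r).
  split.
  - move=> x z hx z0 zr; have [hp hm] := inX x hx.
    by apply: cont2B; apply: cont2_comp2; solve_cont2; apply: cu => //; lra.
  - move=> x z hx z0 zr; have [hp hm] := inX x hx; have z4 : z <= 4 * r by lra.
    apply: harmB.
      apply: (@eq_harm _ u _ _ _ (x + s) z) (hu _ _ hp z0 z4) => h.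
      by rewrite /lap4 (addrAC x s h) (addrAC x s (- h)).
    apply: (@eq_harm _ u _ _ _ (x - s) z) (hu _ _ hm z0 z4) => h.
    by rewrite /lap4 (addrAC x (- s) h) (addrAC x (- s) (- h)).
  - by move=> x hx; have [hp hm] := inX x hx; rewrite /V !u0 ?subrr.
have VB (x z : R) : `|x - x0| <= r -> 0 <= z -> z <= r -> `|V x z| <= 4 * B * s / r.
  move=> hx z0 zr.
  have xx : `|x| <= 2 * r.
    rewrite -{1}(subrK x0 x); apply: le_trans (ler_normD _ _) _.
    by rewrite mulr_natl mulr2n lerD.
  have z3 : z <= 3 * r by lra.
  rewrite ler_norml; apply/andP; split; last exact: reflection_bound.
  have hb' := harm_halfboxN hb.
  have := @reflection_bound R _ r B x s z r0 hb' _ xx s0 sr z0 z3.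
  rewrite /V => H; rewrite lerNl opprB -[leLHS]opprK opprB.
  have {}H : - u (x + s) z - - u (x - s) z <= 4 * B * s / r.
    by apply: H => *; rewrite normrN; exact: uB.
  by rewrite opprB; move: H; rewrite opprK addrC.
have xr : `|x0| + r <= 2 * r by lra.
have := linear_bound_halfbox hV r0 xr VB y0 yr; rewrite /V.
have -> // : 2 * (4 * B * s / r) * y / r = 4 * B * (2 * s) * y / r ^+ 2.
by field; exact: lt0r_neq0.
Qed.

Lemma max_principle1 (R : realType) (f : R -> R) (b : R) :
  (forall x y : R, 0 <= y -> y <= b -> cont2 (fun _ y => f y) x y) ->
  f 0 <= 0 -> f b <= 0 ->
  (forall y : R, 0 < y -> y < b -> forall e : R, 0 < e -> exists2 d, 0 < d &
     forall h : R, 0 < h -> h < d -> - (e * h ^+ 2) <= f (y + h) + f (y - h) - 2 * f y) ->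
  forall y : R, 0 <= y -> y <= b -> f y <= 0.
Proof.
move=> cf f0 fb sf y0 y00 y0b; rewrite leNgt; apply/negP => fy0.
have b0 : 0 < b.
  rewrite lt_neqAle (le_trans y00 y0b) andbT; apply/eqP => bb.
  have yy : y0 = 0 by apply/eqP; rewrite eq_le y00 bb y0b.
  by move: fy0; rewrite yy; lra.
have b20 : 0 < b ^+ 2 by rewrite exprn_gt0.
pose e := f y0 / (2 * b ^+ 2).
have e0 : 0 < e by rewrite divr_gt0// mulr_gt0.
have eb : e * b ^+ 2 = f y0 / 2 by rewrite /e; field; exact: lt0r_neq0.
(* The correction vanishes at both ends, is at most half of [f y0] in between, and adds 2 e h^2 to
   second differences, so the maximum is interior and contradictory. *)
pose v (x y : R) := f y - e * y * (b - y).
have [|x [y [_ /andP[hy0 hyb] mx]]] := @box_max _ v _ _ _ _ (lexx 0) (le_trans y00 y0b).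
  by move=> x y *; rewrite /v; solve_cont2; exact: cf.
have vy0 : 0 < v 0 y0.
  rewrite /v; have : e * y0 * (b - y0) <= e * b ^+ 2.
    rewrite -mulrA ler_pM2l//; clear -y00 y0b b0; nra.
  by rewrite eb; clear -fy0; lra.
have vy : 0 < v x y by apply: lt_le_trans vy0 _; exact: mx.
have y0' : 0 < y.
  rewrite lt_neqAle hy0 andbT; apply/eqP => yy; move: vy.
  by rewrite -yy /v mulr0 mul0r subr0 ltNge f0.
have yb : y < b.
  rewrite lt_neqAle hyb andbT; apply/eqP => yy; move: vy.
  by rewrite yy /v subrr mulr0 subr0 ltNge fb.
have [d d0 hd] := sf y y0' yb _ e0.
pose h := Num.min (d / 2) (Num.min y (b - y)).
have h0 : 0 < h by rewrite /h !lt_min y0' subr_gt0 yb divr_gt0.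
have [h1 h2 h3] : [/\ h <= d / 2, h <= y & h <= b - y].
  by split; rewrite /h !ge_min lexx ?orbT.
have hlt : h < d by clear -h1 d0; lra.
have := hd h h0 hlt.
have m1 : v 0 (y + h) <= v 0 y by apply: mx => //; clear -h0 h3 y0'; lra.
have m2 : v 0 (y - h) <= v 0 y by apply: mx => //; clear -h0 h2 yb; lra.
have eh : 0 < e * h ^+ 2 by rewrite mulr_gt0// exprn_gt0.
move: m1 m2 eh; rewrite /v; clear; lra.
Qed.

(** The hypothesis says that f + C y^2 / 2 is convex, and the conclusion is that this function lies
    below its chord from 0 to y2. It is proved by the one-dimensional maximum principle applied to
    the difference. *)
Lemma chord_bound (R : realType) (f : R -> R) (C Y : R) :
  (forall x y : R, 0 <= y -> y <= Y -> cont2 (fun _ y => f y) x y) ->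
  (forall y : R, 0 < y -> y < Y -> forall e : R, 0 < e -> exists2 d, 0 < d &
     forall h : R, 0 < h -> h < d ->
       - ((C + e) * h ^+ 2) <= f (y + h) + f (y - h) - 2 * f y) ->
  f 0 = 0 ->
  forall y1 y2 : R, 0 <= y1 -> y1 <= y2 -> 0 < y2 -> y2 <= Y ->
    f y1 <= y1 / y2 * f y2 + C / 2 * y1 * (y2 - y1).
Proof.
move=> cf sf f0 y1 y2 y10 y12 y20 y2Y.
pose q y := y / y2 * f y2 + C / 2 * y * (y2 - y).
suff : f y1 - q y1 <= 0 by rewrite subr_le0.
apply: (@max_principle1 _ (fun y => f y - q y) y2) => //.
- move=> x y h1 h2; apply: cont2B; first by apply: cf => //; exact: le_trans y2Y.
  by rewrite /q; solve_cont2.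
- by rewrite f0 /q !(mulr0, mul0r) addr0 subrr.
- by rewrite /q subrr mulr0 addr0 divff ?mul1r ?subrr// gt_eqF.
- move=> y y0 yy2 e e0; have [d d0 hd] := sf y y0 (lt_le_trans yy2 y2Y) _ e0.
  exists d => // h h0 hlt; have := hd h h0 hlt; rewrite /q; clear; lra.
Qed.

(** By [chord_bound] for f and for -f, the quotient f y / y is Lipschitz with constant C / 2, hence
    has a limit at 0. That limit is produced as the supremum of the lower bounds f y / y - C y /
    2. *)
Lemma quotient_limit (R : realType) (f : R -> R) (C Y : R) :
  0 <= C -> 0 < Y ->
  (forall x y : R, 0 <= y -> y <= Y -> cont2 (fun _ y => f y) x y) ->
  (forall y : R, 0 < y -> y < Y -> forall e : R, 0 < e -> exists2 d, 0 < d &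
     forall h : R, 0 < h -> h < d ->
       `|f (y + h) + f (y - h) - 2 * f y| <= (C + e) * h ^+ 2) ->
  f 0 = 0 ->
  exists al : R, forall y : R, 0 <= y -> y <= Y -> `|f y - al * y| <= C * y ^+ 2.
Proof.
move=> C0 Y0 cf sf f0.
have up (y1 y2 : R) : 0 < y1 -> y1 <= y2 -> y2 <= Y -> `|f y1 / y1 - f y2 / y2| <= C / 2 * (y2 - y1).
  move=> y10 y12 y2Y; have y20 : 0 < y2 by apply: lt_le_trans y12.
  have H1 : f y1 <= y1 / y2 * f y2 + C / 2 * y1 * (y2 - y1).
    apply: (chord_bound cf) => // [y y0 yY e e0|]; last exact: ltW.
    have [d d0 hd] := sf y y0 yY e e0; exists d => // h h0 hlt.
    by have := hd h h0 hlt; rewrite ler_norml => /andP[].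
  have H2 : - f y1 <= y1 / y2 * - f y2 + C / 2 * y1 * (y2 - y1).
    apply: (@chord_bound _ (fun y => - f y) C Y) => //.
    - by move=> *; apply: cont2N; exact: cf.
    - move=> y y0 yY e e0.
      have [d d0 hd] := sf y y0 yY e e0; exists d => // h h0 hlt.
      by have := hd h h0 hlt; rewrite ler_norml => /andP[_]; clear; lra.
    - by rewrite f0 oppr0.
    - exact: ltW.
  have e1 : f y1 / y1 - f y2 / y2 = (f y1 - y1 / y2 * f y2) / y1.
    by field; rewrite !gt_eqF.
  rewrite e1 normrM normfV (gtr0_norm y10) ler_pdivrMr//.
  by rewrite ler_norml; apply/andP; split; move: H1 H2; clear; lra.
have {}up (y1 y2 : R) : 0 < y1 -> 0 < y2 -> y1 <= Y -> y2 <= Y -> f y1 / y1 - f y2 / y2 <= C / 2 * (y2 + y1).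
  move=> y10 y20 y1Y y2Y.
  have Cy1 : 0 <= C * y1 by apply: mulr_ge0 => //; exact: ltW.
  have Cy2 : 0 <= C * y2 by apply: mulr_ge0 => //; exact: ltW.
  case: (leP y1 y2) => [y12|/ltW y12].
    have := up _ _ y10 y12 y2Y; rewrite ler_norml => /andP[_]; move: Cy1 Cy2; clear; lra.
  have := up _ _ y20 y12 y1Y; rewrite ler_norml => /andP[+ _]; move: Cy1 Cy2; clear; lra.
pose A := [set f y / y - C / 2 * y | y in [set y | 0 < y <= Y]].
have hA : has_sup A.
  split; first by exists (f Y / Y - C / 2 * Y); exists Y => //=; rewrite Y0 lexx.
  exists (f Y / Y + C / 2 * Y) => _ [y /= /andP[y0 yY] <-].
  by have := up y Y y0 Y0 yY (lexx Y); clear; lra.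
exists (sup A) => y; rewrite le_eqVlt => /orP[/eqP <- _|y0 yY].
  by rewrite f0 mulr0 subrr normr0 expr0n mulr0.
have l1 : f y / y - C / 2 * y <= sup A.
  by apply: sup_upper_bound => //; exists y => //=; rewrite y0.
have l2 : sup A <= f y / y + C / 2 * y.
  apply: sup_le_ub; first exact: hA.1.
  move=> _ [z /= /andP[z0 zY] <-].
  by have := up z y z0 y0 zY yY; clear; lra.
have -> : f y - sup A * y = (f y / y - sup A) * y by field; exact: lt0r_neq0.
rewrite normrM (gtr0_norm y0) expr2 mulrA; apply: ler_wpM2r; first exact: ltW.
have Cy : 0 <= C * y by apply: mulr_ge0 => //; exact: ltW.
by rewrite ler_norml; apply/andP; split; move: l1 l2 Cy; clear; lra.
Qed.

(** Using [tangential_lipschitz] for u and then for u (x + h, y) - u (x, y) bounds horizontal second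
    differences at x = 0 by C h^2. Harmonicity transfers the bound to vertical second differences,
    so [quotient_limit] applies to y -> u (0, y). One more tangential estimate moves from x = 0 to
    general x. *)
Lemma boundary_regularity (R : realType) (u : R -> R -> R) (X : R) :
  0 < X -> harm_halfbox u X ->
  exists al C Y : R, [/\ 0 <= C, 0 < Y, Y <= X & forall x y : R, `|x| <= Y -> 0 <= y -> y <= Y ->
    `|u x y - al * y| <= C * (`|x| + y) * y].
Proof.
move=> X0; pose r := X / 4; have XE : X = 4 * r by rewrite /r; lra.
have r0 : 0 < r by rewrite /r divr_gt0.
rewrite XE => hb; have [cu hu u0] := hb.
have [B uB] : exists B : R, forall x y : R, `|x| <= 4 * r -> 0 <= y -> y <= 4 * r -> `|u x y| <= B.
  have [||x y h1 h2 h3 h4|x [y [_ _ m]]] :=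
    @box_max _ (fun x y => `|u x y|) (- (4 * r)) (4 * r) 0 (4 * r).
  - by lra.
  - by lra.
  - apply: (@cont2_comp _ u); last exact: norm_continuous.
    by apply: cu => //; rewrite ler_norml h1.
  - by exists `|u x y| => x' y'; rewrite ler_norml => /andP[? ?] ? ?; exact: m.
have B0 : 0 <= B by apply: le_trans (uB 0 0 _ _ _) => //; rewrite ?normr0//; lra.
pose k := 4 * B / r ^+ 2.
have k0 : 0 <= k by rewrite /k divr_ge0 ?sqr_ge0// mulr_ge0.
have tl (x1 x2 y : R) : `|x1| <= r -> `|x2| <= r -> 0 <= y -> y <= r ->
    `|u x2 y - u x1 y| <= k * `|x2 - x1| * y.
  move=> h1 h2 h3 h4; have := tangential_lipschitz r0 hb uB h1 h2 h3 h4.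
  by rewrite (_ : _ / _ = k * `|x2 - x1| * y)// /k; ring.
have r80 : 0 < r / 8 by rewrite divr_gt0.
pose C := 4 * (k * r) / (r / 8) ^+ 2 * r.
have C0 : 0 <= C.
  apply: mulr_ge0; last exact: ltW.
  by rewrite divr_ge0 ?sqr_ge0//; do 2!apply: mulr_ge0 => //; exact: ltW.
have d2 (y h : R) : 0 < h -> h <= r / 8 -> 0 <= y -> y <= r / 8 ->
    `|u h y + u (- h) y - 2 * u 0 y| <= C * h ^+ 2.
  move=> h0 hr y0 yr.
  pose v x y := u (x + h) y - u x y.
  have xh (x : R) : `|x| <= r / 2 -> `|x + h| <= r.
    by rewrite !ler_norml => /andP[ha hb']; apply/andP; split; clear -hr h0 r0 ha hb'; lra.
  have x4 (x : R) : `|x| <= r -> `|x| <= 4 * r by move=> H; clear -r0 H; lra.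
  have xr (x : R) : `|x| <= r / 2 -> `|x| <= r by move=> H; clear -r0 H; lra.
  have r2E : 4 * (r / 8) = r / 2 by clear; lra.
  have hv : harm_halfbox v (4 * (r / 8)).
    rewrite r2E; split.
    - move=> x z hx z0 zr; have z4 : z <= 4 * r by clear -zr r0; lra.
      by apply: cont2B; [apply: cont2_comp2; solve_cont2|]; apply: cu => //; apply: x4; auto.
    - move=> x z hx z0 zr; have z4 : z <= 4 * r by clear -zr r0; lra.
      apply: harmB; last by apply: hu => //; apply: x4; auto.
      have hp : `|x + h| <= 4 * r by apply: x4; auto.
      apply: (@eq_harm _ u _ _ _ (x + h) z) (hu _ _ hp z0 z4) => t.
      by rewrite /lap4 (addrAC x h t) (addrAC x h (- t)).
    - by move=> x hx; rewrite /v !u0 ?subrr//; apply: x4; auto.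
  have vB (x z : R) : `|x| <= 4 * (r / 8) -> 0 <= z -> z <= 4 * (r / 8) -> `|v x z| <= k * h * r.
    rewrite r2E => hx z0 zr; have zr' : z <= r by clear -zr r0; lra.
    have := tl x (x + h) z (xr _ hx) (xh _ hx) z0 zr'.
    rewrite (addrC x) addrK (gtr0_norm h0) addrC => H; apply: le_trans H _.
    by apply: ler_wpM2l => //; apply: mulr_ge0 => //; exact: ltW.
  have n1 : `|- h| <= r / 8 by rewrite normrN gtr0_norm.
  have n2 : `|0 : R| <= r / 8 by rewrite normr0 ltW.
  have := tangential_lipschitz r80 hv vB n1 n2 y0 yr.
  rewrite /v add0r addNr sub0r opprK (gtr0_norm h0).
  have -> : u h y - u 0 y - (u 0 y - u (- h) y) = u h y + u (- h) y - 2 * u 0 y by ring.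
  move=> H; apply: le_trans H _.
  rewrite (_ : 4 * (k * h * r) * h * y / (r / 8) ^+ 2 = 4 * (k * r) / (r / 8) ^+ 2 * y * h ^+ 2); last by ring.
  apply: ler_wpM2r; first exact: sqr_ge0.
  apply: ler_wpM2l; first by rewrite divr_ge0 ?sqr_ge0//; do 2!apply: mulr_ge0 => //; exact: ltW.
  by clear -yr r0; lra.
have [|||al hal] := @quotient_limit _ (fun y => u 0 y) C (r / 8) C0 r80.
- move=> x y h1 h2; apply: cont2_comp2; solve_cont2.
  by apply: cu => //; rewrite ?normr0; clear -h2 r0; lra.
- move=> y y0 yr e e0.
  have y4 : y <= 4 * r by clear -yr r0; lra.
  have n04 : `|0 : R| <= 4 * r by rewrite normr0; clear -r0; lra.
  have [d d0 hd] := hu 0 y n04 y0 y4 e e0.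
  exists (Num.min d (r / 8)); first by rewrite lt_min d0.
  move=> h h0; rewrite lt_min => /andP[hlt hr].
  have -> : u 0 (y + h) + u 0 (y - h) - 2 * u 0 y =
    lap4 u 0 y h - (u h y + u (- h) y - 2 * u 0 y).
    by rewrite /lap4 add0r sub0r; ring.
  apply: le_trans (ler_normB _ _) _; rewrite [leRHS]mulrDl [leRHS]addrC.
  by apply: lerD; [exact: hd|apply: d2; rewrite // ltW].
- by apply: u0; rewrite normr0; clear -r0; lra.
exists al, (k + C), (r / 8); split; [by rewrite addr_ge0|exact: r80|by clear -r0; lra|].
move=> x y hx y0 yr.
have xr : `|x| <= r by clear -hx r0; lra.
have yr' : y <= r by clear -yr r0; lra.
have n0r : `|0 : R| <= r by rewrite normr0 ltW.
have t1 := tl 0 x y n0r xr y0 yr'.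
have t2 := hal y y0 yr; rewrite subr0 in t1.
have -> : u x y - al * y = (u x y - u 0 y) + (u 0 y - al * y) by ring.
apply: le_trans (ler_normD _ _) _; apply: le_trans (lerD t1 t2) _.
have p1 : 0 <= C * (`|x| * y) by do 2!apply: mulr_ge0 => //.
have p2 : 0 <= k * y ^+ 2 by apply: mulr_ge0 => //; exact: sqr_ge0.
by move: p1 p2; clear; lra.
Qed.

(** * Strong minimum principle and Hopf's lemma *)

(* The barrier is a multiple of [(1 - t) + (1 - t) ^+ 2], where [t] is the
   squared distance to [p] over [rho ^+ 2]; it is subharmonic for [3/4 <= t]. *)
Lemma ball_barrier (R : realType) (u : R -> R -> R) (px py rho e : R) :
  let q (x y : R) := (x - px) ^+ 2 + (y - py) ^+ 2 in
  0 < rho -> 0 <= e ->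
  (forall x y : R, `|x - px| <= rho -> `|y - py| <= rho -> cont2 u x y) ->
  (forall x y : R, `|x - px| <= rho -> `|y - py| <= rho -> 0 <= u x y) ->
  (forall x y : R, q x y < rho ^+ 2 -> harm u x y) ->
  (forall x y : R, q x y <= 3 / 4 * rho ^+ 2 -> e <= u x y) ->
  forall x y : R, `|x - px| <= rho -> `|y - py| <= rho ->
    e / 2 * (1 - q x y / rho ^+ 2) <= u x y.
Proof.
move=> q rho0 e0 cu u0 hu ue.
pose k := (rho ^+ 2)^-1.
have k0 : 0 < k by rewrite invr_gt0 exprn_gt0.
have krho : k * rho ^+ 2 = 1 by rewrite mulVf// expf_neq0// gt_eqF.
(* With t = k q this is (1 - t) (2 - t). On the box t <= 2, so the barrier is nonpositive between
   the circle and the corners of the box, and a maximum principle for boxes suffices. *)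
pose f (x y : R) := 2 - 3 * (k * q x y) + (k * q x y) ^+ 2.
pose v (x y : R) := e / 2 * f x y - u x y.
have sqd (z p : R) : `|z - p| <= rho -> (z - p) ^+ 2 <= rho ^+ 2.
  by rewrite ler_norml => /andP[h1 h2]; clear -h1 h2; nra.
have q2 (x y : R) : `|x - px| <= rho -> `|y - py| <= rho -> k * q x y <= 2.
  move=> /sqd h1 /sqd h2; have : k * q x y <= k * (2 * rho ^+ 2).
    by apply: ler_wpM2l; [exact: ltW|rewrite /q mulr_natl mulr2n lerD].
  by rewrite mulrCA krho mulr1.
have box (z p : R) : p - rho <= z -> z <= p + rho -> `|z - p| <= rho.
  by move=> h1 h2; rewrite ler_norml; apply/andP; split; lra.
have unbox (z p : R) : `|z - p| <= rho -> p - rho <= z /\ z <= p + rho.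
  by rewrite ler_norml => /andP[h1 h2]; split; lra.
move=> x0 y0 hx hy; have : v x0 y0 <= 0.
  have [x1 x2] := unbox _ _ hx; have [y1 y2] := unbox _ _ hy.
  apply: (max_principle _ _ x1 x2 y1 y2) => {x1 x2 y1 y2}.
    move=> x y h1 h2 h3 h4; apply: cont2B; last by apply: cu; exact: box.
    by rewrite /f /q; solve_cont2.
  move=> x y h1 h2 h3 h4 v0.
  have bx := box _ _ h1 h2; have by' := box _ _ h3 h4.
  have uxy := u0 _ _ bx by'.
  have t2 := q2 _ _ bx by'.
  have t1 : k * q x y < 1.
    rewrite ltNge; apply/negP => t1; have : 0 < e / 2 * f x y by move: v0; rewrite /v; lra.
    rewrite ltNge => /negP; apply; apply: mulr_ge0_le0; first by rewrite divr_ge0.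
    rewrite /f; clear -t1 t2; nra.
  have t34 : 3 / 4 < k * q x y.
    rewrite ltNge; apply/negP => t34.
    have ux : e <= u x y.
      apply: ue; rewrite -(ler_pM2l k0); apply: le_trans t34 _.
      by rewrite mulrCA krho mulr1.
    have q0 : 0 <= k * q x y by rewrite mulr_ge0 ?addr_ge0 ?sqr_ge0// ltW.
    have : e / 2 * f x y <= e / 2 * 2.
      apply: ler_wpM2l; first by rewrite divr_ge0.
      rewrite /f; clear -t34 q0; nra.
    move: v0; rewrite /v => v0 H; clear -v0 H ux; lra.
  have qr : q x y < rho ^+ 2 by rewrite -(ltr_pM2l k0) krho.
  have [/andP[a1 a2] /andP[b1 b2]] := disc_lt rho0 qr.
  split; [by apply/andP; split; lra|by apply/andP; split; lra|].
  apply: subharmD; last by apply: harm_sub; apply: harmN; exact: hu.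
  apply: subharmZ; first by rewrite divr_ge0.
  move=> c c0; exists 1 => // h h0 _.
  have -> : lap4 f x y h = k * h ^+ 2 * (16 * (k * q x y) - 12) + 4 * (k * h ^+ 2) ^+ 2.
    by rewrite /lap4 /f /q; ring.
  apply: (@le_trans _ _ 0); first by rewrite oppr_le0 mulr_ge0 ?sqr_ge0// ltW.
  apply: addr_ge0; last by rewrite mulr_ge0 ?sqr_ge0.
  apply: mulr_ge0; first by rewrite mulr_ge0 ?sqr_ge0// ltW.
  by lra.
rewrite /v subr_le0; apply: le_trans.
apply: ler_wpM2l; first by rewrite divr_ge0.
rewrite /f -(mulrC k).
have := sqr_ge0 (1 - k * q x0 y0); clear; lra.
Qed.

Definition pos_harm_box (R : realType) (u : R -> R -> R) (a b c d : R) : Prop :=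
  [/\ forall x y : R, a <= x -> x <= b -> c <= y -> y <= d -> cont2 u x y,
      forall x y : R, a <= x -> x <= b -> c <= y -> y <= d -> 0 <= u x y &
      forall x y : R, a < x -> x < b -> c < y -> y < d -> harm u x y].

(** The minimum is taken over the surrounding box, where [box_max] is available. The penalty
    [max 0 (q - s)] vanishes on the disc and is positive off it, so u plus the penalty is positive
    on the whole box. *)
Lemma ball_min (R : realType) (u : R -> R -> R) (px py rho s : R) :
  let q (x y : R) := (x - px) ^+ 2 + (y - py) ^+ 2 in
  0 < rho ->
  (forall x y : R, `|x - px| <= rho -> `|y - py| <= rho -> cont2 u x y) ->
  (forall x y : R, `|x - px| <= rho -> `|y - py| <= rho -> 0 <= u x y) ->
  (forall x y : R, q x y <= s -> 0 < u x y) ->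
  s <= rho ^+ 2 ->
  exists2 e, 0 < e & forall x y : R, q x y <= s -> e <= u x y.
Proof.
move=> q rho0 cu u0 up srho.
pose v (x y : R) := - (u x y + Num.max 0 (q x y - s)).
have box (z p : R) : p - rho <= z -> z <= p + rho -> `|z - p| <= rho.
  by move=> h1 h2; rewrite ler_norml; apply/andP; split; lra.
have [||x y h1 h2 h3 h4|x [y [/andP[h1 h2] /andP[h3 h4] m]]] :=
    @box_max _ v (px - rho) (px + rho) (py - rho) (py + rho).
- by lra.
- by lra.
- apply: cont2N; apply: cont2D; first by apply: cu; exact: box.
  apply: (@cont2_comp _ (fun x y => q x y - s) (Num.max 0)).
    by rewrite /q; solve_cont2.
  by apply: (@continuous_max R R (fun=> 0) id); [exact: cvg_cst|exact: cvg_id].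
exists (u x y + Num.max 0 (q x y - s)).
  have b1 := box _ _ h1 h2; have b2 := box _ _ h3 h4.
  case: (leP (q x y) s) => h.
    by apply: ltr_wpDr; [rewrite le_max lexx|exact: up].
  by apply: ltr_wpDl; [exact: u0|rewrite lt_max subr_gt0 h orbT].
move=> x' y' hq.
have [] := disc_le (ltW rho0) (le_trans hq srho).
rewrite !ler_norml => /andP[a1 a2] /andP[b1 b2].
have : v x' y' <= v x y by apply: m; lra.
by rewrite /v lerN2 => /le_trans; apply; rewrite max_l ?addr0// subr_le0.
Qed.

Lemma bernoulli_ge (R : realType) (n : nat) : 1 + n%:R / 8 <= (9 / 8 : R) ^+ n.
Proof.
elim: n => [|n IH]; first by rewrite mul0r addr0 expr0.
rewrite exprS -natr1; have n0 : 0 <= n%:R :> R by [].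
by move: IH n0; set a := (_ ^+ n); set b := (n%:R); clear; lra.
Qed.

(** Continuity gives positivity on some small disc, and the barrier enlarges a disc of positivity by
    the factor 9 / 8. Finitely many enlargements, counted by Bernoulli's inequality, reach the
    radius dl / 2. *)
Lemma pos_ball (R : realType) (u : R -> R -> R) (a b c d px py dl : R) :
  let q (x y : R) := (x - px) ^+ 2 + (y - py) ^+ 2 in
  pos_harm_box u a b c d -> 0 < dl ->
  a <= px - dl -> px + dl <= b -> c <= py - dl -> py + dl <= d ->
  0 < u px py -> forall x y : R, q x y <= (dl / 2) ^+ 2 -> 0 < u x y.
Proof.
move=> q [cu u0 hu] dl0 ha hb hc hd up.
have sq (t : R) (z p : R) : `|z - p| <= t -> p - t <= z /\ z <= p + t.
  by rewrite ler_norml => /andP[h1 h2]; split; lra.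
have [r0 r00 hr0] : exists2 r0, 0 < r0 & forall x y : R, q x y <= r0 ^+ 2 -> 0 < u x y.
  have cN : cont2 (fun x y => - u x y) px py by apply: cont2N; apply: cu; lra.
  have [|r r0 hr] := cont2_near (c := 0) cN; first by rewrite oppr_lt0.
  exists (r / 2) => [|x y hq]; first by rewrite divr_gt0.
  have r20 : 0 <= r / 2 by rewrite divr_ge0// ltW.
  have [h1 h2] := disc_le r20 hq.
  by rewrite -oppr_lt0; apply: hr; [move: h1|move: h2]; clear -r0; lra.
have grow (r : R) : 0 < r -> 2 * (9 / 8 * r) <= dl ->
    (forall x y : R, q x y <= r ^+ 2 -> 0 < u x y) ->
    forall x y : R, q x y <= (9 / 8 * r) ^+ 2 -> 0 < u x y.
  (* Two inequalities fix 8 / 7: (7 / 8)^2 >= 3 / 4, so the known disc contains the one on which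
     [ball_barrier] wants a lower bound, and 9 / 8 < 8 / 7, so the barrier is positive on the
     enlarged disc. *)
  move=> r0' rdl ur x y hq; pose rho := 8 / 7 * r.
  have rho0 : 0 < rho by rewrite mulr_gt0// divr_gt0.
  have rhodl : rho < dl by rewrite /rho; clear -rdl r0'; lra.
  have inb (x' y' : R) : `|x' - px| <= rho -> `|y' - py| <= rho ->
      [/\ a < x', x' < b, c < y' & y' < d].
    by move=> /sq[? ?] /sq[? ?]; split; lra.
  have cr (x' y' : R) : `|x' - px| <= rho -> `|y' - py| <= rho -> cont2 u x' y'.
    by move=> h1 h2; have [? ? ? ?] := inb _ _ h1 h2; apply: cu; exact: ltW.
  have pr (x' y' : R) : `|x' - px| <= rho -> `|y' - py| <= rho -> 0 <= u x' y'.
    by move=> h1 h2; have [? ? ? ?] := inb _ _ h1 h2; apply: u0; exact: ltW.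
  have inball (x' y' : R) : q x' y' <= rho ^+ 2 -> `|x' - px| <= rho /\ `|y' - py| <= rho.
    exact: disc_le (ltW rho0).
  have hr (x' y' : R) : q x' y' < rho ^+ 2 -> harm u x' y'.
    by move=> /ltW/inball[h1 h2]; have [? ? ? ?] := inb _ _ h1 h2; exact: hu.
  have rrho : r ^+ 2 <= rho ^+ 2 by rewrite /rho; clear -r0'; nra.
  have [e e0 he] := ball_min rho0 cr pr ur rrho.
  have he' (x' y' : R) : q x' y' <= 3 / 4 * rho ^+ 2 -> e <= u x' y'.
    by move=> h; apply: he; apply: le_trans h _; rewrite /rho; clear -r0'; nra.
  have hq2 : q x y < rho ^+ 2 by apply: le_lt_trans hq _; rewrite /rho; clear -r0'; nra.
  have [h1 h2] := inball _ _ (ltW hq2).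
  have := ball_barrier rho0 (ltW e0) cr pr hr he' h1 h2; apply: lt_le_trans.
  rewrite mulr_gt0 ?divr_gt0// subr_gt0 ltr_pdivrMr ?mul1r//.
  by rewrite exprn_gt0.
have all_k (k : nat) (r : R) : 0 < r -> r <= r0 * (9 / 8) ^+ k -> 2 * r <= dl ->
    forall x y : R, q x y <= r ^+ 2 -> 0 < u x y.
  elim: k r => [|k IH] r r1 hr rdl x y hq.
    apply: hr0; apply: le_trans hq _; rewrite expr0 mulr1 in hr.
    by clear -hr r00 r1; nra.
  have r8 : 9 / 8 * (8 / 9 * r) = r by field.
  rewrite -r8 in hq; apply: grow hq.
  - by rewrite mulr_gt0// divr_gt0.
  - by rewrite r8.
  - apply: IH; first by rewrite mulr_gt0// divr_gt0.
      by move: hr; rewrite exprS; set t := _ ^+ k; clear; lra.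
    by clear -rdl r1; lra.
move=> x y hq.
pose k := (Num.truncn (4 * dl / r0)).+1.
apply: (all_k k (dl / 2)) hq; first by rewrite divr_gt0.
  have : 4 * dl / r0 < k%:R by exact: truncnS_gt.
  rewrite ltr_pdivrMr// => hk; apply: (@le_trans _ _ (r0 * (1 + k%:R / 8))).
    by move: hk; set t := k%:R; clear -r00; lra.
  by apply: ler_wpM2l; [exact: ltW|exact: bernoulli_ge].
by clear; lra.
Qed.

(** Positivity is carried along the segment from p to q by a chain of discs of radius dl / 2. By
    convexity every centre keeps distance dl from the sides, and N is chosen so that consecutive
    centres are at most dl / 2 apart. *)
Lemma strong_minimum (R : realType) (u : R -> R -> R) (a b c d px py qx qy : R) :
  pos_harm_box u a b c d ->
  a < px -> px < b -> c < py -> py < d ->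
  a < qx -> qx < b -> c < qy -> qy < d ->
  0 < u px py -> 0 < u qx qy.
Proof.
move=> hu p1 p2 p3 p4 q1 q2 q3 q4 up.
pose dl := Num.min (Num.min (Num.min (px - a) (b - px)) (Num.min (py - c) (d - py)))
                   (Num.min (Num.min (qx - a) (b - qx)) (Num.min (qy - c) (d - qy))).
have dl0 : 0 < dl by rewrite /dl !lt_min !subr_gt0 p1 p2 p3 p4 q1 q2 q3.
have := lexx dl; rewrite {2}/dl !le_min.
move=> /andP[/andP[/andP[d1 d2] /andP[d3 d4]] /andP[/andP[d5 d6] /andP[d7 d8]]].
pose S := `|qx - px| + `|qy - py|.
pose N := (Num.truncn (2 * S / dl)).+1.
have N0 : 0 < N%:R :> R by rewrite ltr0n.
have SN : S / N%:R <= dl / 2.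
  have : 2 * S / dl < N%:R by exact: truncnS_gt.
  rewrite ltr_pdivrMr// => h; rewrite ler_pdivrMr//; move: h; set t := N%:R.
  by clear; lra.
have step (k : nat) : (k <= N)%N ->
    0 < u (px + k%:R / N%:R * (qx - px)) (py + k%:R / N%:R * (qy - py)).
  elim: k => [|k IH] kN; first by rewrite !mul0r !addr0.
  have {}IH := IH (ltnW kN).
  have [t0 t1] : 0 <= k%:R / N%:R :> R /\ k%:R / N%:R <= 1 :> R.
    split; first by rewrite divr_ge0.
    by rewrite ler_pdivrMr// mul1r ler_nat ltnW.
  have inter (l p q r : R) : l + dl <= p -> l + dl <= q -> p + dl <= r -> q + dl <= r ->
      l <= p + k%:R / N%:R * (q - p) - dl /\ p + k%:R / N%:R * (q - p) + dl <= r.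
    move: t0 t1; set t := k%:R / N%:R => t0 t1 h1 h2 h3 h4.
    by clear -t0 t1 h1 h2 h3 h4; split; nra.
  have [|||| i1 i2] := inter a px qx b; try lra.
  have [|||| i3 i4] := inter c py qy d; try lra.
  apply: (pos_ball hu dl0 i1 i2 i3 i4 IH).
  have e (p q : R) : p + k.+1%:R / N%:R * (q - p) - (p + k%:R / N%:R * (q - p)) = (q - p) / N%:R.
    by rewrite -natr1; field; exact: lt0r_neq0.
  rewrite !e; apply: (@le_trans _ _ ((S / N%:R) ^+ 2)); last first.
    by rewrite ler_pXn2r// nnegrE divr_ge0 ?addr_ge0// ltW.
  rewrite !expr_div_n -mulrDl; apply: ler_wpM2r; first by rewrite invr_ge0 sqr_ge0.
  rewrite /S -(real_normK (num_real (qx - px))) -(real_normK (num_real (qy - py))).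
  have := mulr_ge0 (normr_ge0 (qx - px)) (normr_ge0 (qy - py)).
  by set A := `|_|; set B := `|_|; clear; lra.
have := step N (leqnn N); rewrite divff ?gt_eqF// !mul1r.
by rewrite !(addrC _ (_ - _)) !subrK.
Qed.

(** The disc of centre (0, rho) and radius rho touches the axis at the origin. Its smaller
    concentric disc lies in the open half box, where u is bounded below by a positive constant; the
    barrier of [ball_barrier] vanishes only to first order at the point of contact. *)
Lemma hopf (R : realType) (u : R -> R -> R) (X px py : R) :
  pos_harm_box u (- X) X 0 X -> - X < px -> px < X -> 0 < py -> py < X ->
  0 < u px py ->
  exists k Y : R, [/\ 0 < k, 0 < Y & forall y : R, 0 <= y -> y <= Y -> k * y <= u 0 y].
Proof.
move=> hu p1 p2 p3 p4 up; have [cu u0 hr] := hu.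
have X0 : 0 < X by lra.
pose rho := X / 4; have rho0 : 0 < rho by rewrite divr_gt0.
have XE : X = 4 * rho by rewrite /rho; lra.
have inb (x y : R) : `|x - 0| <= rho -> `|y - rho| <= rho ->
    [/\ - X < x, x < X, 0 <= y & y < X].
  by rewrite !ler_norml subr0 XE => /andP[? ?] /andP[? ?]; split; lra.
have cr (x y : R) : `|x - 0| <= rho -> `|y - rho| <= rho -> cont2 u x y.
  by move=> h1 h2; have [? ? ? ?] := inb _ _ h1 h2; apply: cu => //; exact: ltW.
have pr (x y : R) : `|x - 0| <= rho -> `|y - rho| <= rho -> 0 <= u x y.
  by move=> h1 h2; have [? ? ? ?] := inb _ _ h1 h2; apply: u0 => //; exact: ltW.
have inball (x y : R) : (x - 0) ^+ 2 + (y - rho) ^+ 2 < rho ^+ 2 ->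
    [/\ - X < x, x < X, 0 < y & y < X].
  rewrite subr0 XE => hq.
  by have [/andP[? ?] /andP[? ?]] := disc_lt rho0 hq; split; lra.
have hh (x y : R) : (x - 0) ^+ 2 + (y - rho) ^+ 2 < rho ^+ 2 -> harm u x y.
  by move=> /inball[? ? ? ?]; exact: hr.
have rho20 : 0 < rho ^+ 2 by rewrite exprn_gt0.
have ps (x y : R) : (x - 0) ^+ 2 + (y - rho) ^+ 2 <= 3 / 4 * rho ^+ 2 -> 0 < u x y.
  move=> h; have /inball[? ? ? ?] : (x - 0) ^+ 2 + (y - rho) ^+ 2 < rho ^+ 2.
    by apply: le_lt_trans h _; clear -rho20; lra.
  exact: (strong_minimum hu p1 p2 p3 p4).
have rr : 3 / 4 * rho ^+ 2 <= rho ^+ 2 by clear -rho20; lra.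
have [e e0 he] := ball_min rho0 cr pr ps rr.
exists (e / 2 / rho), rho; split=> //; first by rewrite !divr_gt0.
move=> y y0 yr.
have h1 : `|0 - 0 : R| <= rho by rewrite subrr normr0 ltW.
have h2 : `|y - rho| <= rho by rewrite ler_norml; apply/andP; split; lra.
have := ball_barrier rho0 (ltW e0) cr pr hh he h1 h2; apply: le_trans.
rewrite -[leLHS]mulrA -[leLHS]mulrA -[leRHS]mulrA; apply: ler_wpM2l; first exact: ltW.
apply: ler_wpM2l => //.
rewrite subrr expr0n add0r.
have -> : 1 - (y - rho) ^+ 2 / rho ^+ 2 = rho^-1 * (2 * y - y ^+ 2 / rho).
  by field; exact: lt0r_neq0.
apply: ler_wpM2l; first by rewrite invr_ge0 ltW.
have : y ^+ 2 / rho <= y by rewrite ler_pdivrMr// expr2; apply: ler_wpM2l.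
lra.
Qed.

(** * Second order expansions in the complex plane *)

Lemma modulus_sqr (R : realType) (z : R[i]) :
  modulus z ^+ 2 = complex.Re z ^+ 2 + complex.Im z ^+ 2.
Proof.
rewrite /modulus; case: z => a b /=; rewrite sqr_sqrtr// addr_ge0 ?sqr_ge0//.
Qed.

Lemma modulus_ge0 (R : realType) (z : R[i]) : 0 <= modulus z.
Proof. by case: z => a b; rewrite /modulus /= sqrtr_ge0. Qed.

Lemma modulusM (R : realType) (z w : R[i]) : modulus (z * w) = modulus z * modulus w.
Proof. exact: ComplexField.Normc.normcM. Qed.

Lemma modulusD (R : realType) (z w : R[i]) : modulus (z + w) <= modulus z + modulus w.
Proof. exact: le_normcD. Qed.

Lemma modulusN (R : realType) (z : R[i]) : modulus (- z) = modulus z.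
Proof. exact: normcN. Qed.

Lemma modulusB (R : realType) (z w : R[i]) : modulus (z - w) <= modulus z + modulus w.
Proof. by rewrite -[in leRHS](modulusN w); exact: modulusD. Qed.

Lemma modulus_distC (R : realType) (z w : R[i]) : modulus (z - w) = modulus (w - z).
Proof. by rewrite -modulusN opprB. Qed.

Lemma modulusV (R : realType) (z : R[i]) : modulus z^-1 = (modulus z)^-1.
Proof. exact: ComplexField.Normc.normcV. Qed.

Lemma modulus0 (R : realType) : modulus (0 : R[i]) = 0.
Proof. exact: ComplexField.Normc.normc0. Qed.

Lemma modulus1 (R : realType) : modulus (1 : R[i]) = 1.
Proof. exact: ComplexField.Normc.normc1. Qed.

Lemma modulus0_eq0 (R : realType) (z : R[i]) : modulus z = 0 -> z = 0.
Proof. exact: ComplexField.Normc.eq0_normc. Qed.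

Lemma modulus_gt0 (R : realType) (z : R[i]) : (0 < modulus z) = (z != 0).
Proof.
rewrite lt_neqAle modulus_ge0 andbT eq_sym; congr negb.
by apply/eqP/eqP => [/modulus0_eq0|->] //; rewrite modulus0.
Qed.

Lemma modulusX (R : realType) (z : R[i]) (n : nat) : modulus (z ^+ n) = modulus z ^+ n.
Proof.
by elim: n => [|n IH]; rewrite ?expr0 ?modulus1// !exprS modulusM IH.
Qed.

Lemma modulus_real (R : realType) (r : R) : modulus r%:C = `|r|.
Proof. by rewrite /modulus /= expr0n /= addr0 sqrtr_sqr. Qed.

Lemma modulus_conj (R : realType) (z : R[i]) : modulus (conjc z) = modulus z.
Proof. by case: z => a b; rewrite /modulus /= sqrrN. Qed.

Lemma modulus_i (R : realType) : modulus ('i : R[i]) = 1.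
Proof. by rewrite /modulus /= expr0n expr1n /= add0r sqrtr1. Qed.

Lemma Re_le_modulus (R : realType) (z : R[i]) : `|complex.Re z| <= modulus z.
Proof.
by case: z => a b; rewrite /modulus /= -sqrtr_sqr ler_wsqrtr// lerDl sqr_ge0.
Qed.

Lemma Im_le_modulus (R : realType) (z : R[i]) : `|complex.Im z| <= modulus z.
Proof.
by case: z => a b; rewrite /modulus /= -sqrtr_sqr ler_wsqrtr// lerDr sqr_ge0.
Qed.

Lemma modulus_le_ReIm (R : realType) (z : R[i]) :
  modulus z <= `|complex.Re z| + `|complex.Im z|.
Proof.
rewrite -(ler_pXn2r (n := 2))// ?nnegrE ?modulus_ge0 ?addr_ge0//.
rewrite modulus_sqr -(real_normK (num_real (complex.Re z))) -(real_normK (num_real (complex.Im z))).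
have := mulr_ge0 (normr_ge0 (complex.Re z)) (normr_ge0 (complex.Im z)).
by set a := `|_|; set b := `|complex.Im z|; clear; lra.
Qed.

Lemma ReD (R : realType) (z w : R[i]) : complex.Re (z + w) = complex.Re z + complex.Re w.
Proof. by case: z; case: w. Qed.

Lemma ReN (R : realType) (z : R[i]) : complex.Re (- z) = - complex.Re z.
Proof. by case: z. Qed.

Lemma ImD (R : realType) (z w : R[i]) : complex.Im (z + w) = complex.Im z + complex.Im w.
Proof. by case: z; case: w. Qed.

Lemma ImN (R : realType) (z : R[i]) : complex.Im (- z) = - complex.Im z.
Proof. by case: z. Qed.

Lemma Re_scale (R : realType) (r : R) (z : R[i]) : complex.Re (r%:C * z) = r * complex.Re z.
Proof. by case: z => a b /=; rewrite mul0r subr0. Qed.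

Lemma Im_scale (R : realType) (r : R) (z : R[i]) : complex.Im (r%:C * z) = r * complex.Im z.
Proof. by case: z => a b /=; rewrite mul0r addr0. Qed.

(** The argument k is the increment from the base point. A cubic remainder is o(h^2), hence
    invisible to [lap4], and expansions of this kind are stable under sums, products and
    polynomials. *)
Definition taylor2 (R : realType) (f : R[i] -> R[i]) (A a b : R[i]) : Prop :=
  exists M d : R, [/\ 0 <= M, 0 < d & forall k, modulus k < d ->
    modulus (f k - (A + a * k + b * k ^+ 2)) <= M * modulus k ^+ 3].

Lemma taylor2_0 (R : realType) (f : R[i] -> R[i]) (A a b : R[i]) :
  taylor2 f A a b -> f 0 = A.
Proof.
move=> [M [d [M0 d0 hf]]].
have := hf 0; rewrite modulus0 => /(_ d0).
rewrite expr0n mulr0 expr0n !mulr0 !addr0 => h.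
apply/eqP; rewrite -subr_eq0; apply/eqP/modulus0_eq0.
by apply/eqP; rewrite eq_le h modulus_ge0.
Qed.

Lemma taylor2_lipschitz (R : realType) (f : R[i] -> R[i]) (A a b : R[i]) :
  taylor2 f A a b -> exists L d : R, [/\ 0 <= L, 0 < d & forall k, modulus k < d ->
    modulus (f k - A) <= L * modulus k].
Proof.
move=> [M [d [M0 d0 hf]]].
exists (modulus a + modulus b + M), (Num.min d 1); split.
- by do 2!apply: addr_ge0 => //; exact: modulus_ge0.
- by rewrite lt_min d0 ltr01.
move=> k; rewrite lt_min => /andP[/hf h /ltW k1].
have k0 := modulus_ge0 k.
rewrite (_ : f k - A = (f k - (A + a * k + b * k ^+ 2)) + a * k + b * k ^+ 2); last by ring.
have e1 : M * modulus k ^+ 3 <= M * modulus k.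
  apply: ler_wpM2l => //; rewrite exprS ler_piMr// exprn_ile1//.
have e2 : modulus (b * k ^+ 2) <= modulus b * modulus k.
  by rewrite modulusM modulusX; apply: ler_wpM2l; rewrite ?modulus_ge0// expr2 ler_piMr.
have := modulusM a k.
have := modulusD (f k - (A + a * k + b * k ^+ 2) + a * k) (b * k ^+ 2).
have := modulusD (f k - (A + a * k + b * k ^+ 2)) (a * k).
move: e1 e2 h; set x1 := modulus _; clear; lra.
Qed.

Lemma taylor2_cst (R : realType) (c : R[i]) : taylor2 (fun=> c) c 0 0.
Proof.
exists 0, 1; split=> // k _.
by rewrite !mul0r !addr0 subrr modulus0.
Qed.

Lemma taylor2_id (R : realType) (z : R[i]) : taylor2 (fun k => z + k) z 1 0.
Proof.
by exists 0, 1; split=> // k _; rewrite mul1r !mul0r addr0 subrr modulus0.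
Qed.

Lemma taylor2D (R : realType) (f g : R[i] -> R[i]) (A a b A' a' b' : R[i]) :
  taylor2 f A a b -> taylor2 g A' a' b' ->
  taylor2 (fun k => f k + g k) (A + A') (a + a') (b + b').
Proof.
move=> [M [d [M0 d0 hf]]] [N [d' [N0 d'0 hg]]].
exists (M + N), (Num.min d d'); split; [exact: addr_ge0|by rewrite lt_min d0|].
move=> k; rewrite lt_min => /andP[k1 k2].
rewrite (_ : _ - _ = (f k - (A + a * k + b * k ^+ 2)) + (g k - (A' + a' * k + b' * k ^+ 2))); last by ring.
by apply: le_trans (modulusD _ _) _; rewrite mulrDl lerD ?hf ?hg.
Qed.

Lemma taylor2M (R : realType) (f g : R[i] -> R[i]) (A a b A' a' b' : R[i]) :
  taylor2 f A a b -> taylor2 g A' a' b' ->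
  taylor2 (fun k => f k * g k) (A * A') (A * a' + a * A') (A * b' + a * a' + b * A').
Proof.
move=> [M [d [M0 d0 hf]]] [N [d' [N0 d'0 hg]]].
pose S := modulus A + modulus a + modulus b.
pose S' := modulus A' + modulus a' + modulus b'.
pose T := modulus (a * b' + b * a') + modulus (b * b').
have S0 : 0 <= S by rewrite !addr_ge0 ?modulus_ge0.
have S'0 : 0 <= S' by rewrite !addr_ge0 ?modulus_ge0.
have T0 : 0 <= T by rewrite !addr_ge0 ?modulus_ge0.
exists (T + S * N + S' * M + M * N), (Num.min 1 (Num.min d d')); split.
- by apply: addr_ge0; [apply: addr_ge0; [apply: addr_ge0 => //|]|]; apply: mulr_ge0.
- by rewrite !lt_min ltr01 d0.
move=> k; rewrite !lt_min => /and3P[k1 /hf h1 /hg h2].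
set F := A + a * k + b * k ^+ 2 in h1.
set G := A' + a' * k + b' * k ^+ 2 in h2.
set r := f k - F in h1; set s := g k - G in h2.
have fE : f k = F + r by rewrite /r addrC subrK.
have gE : g k = G + s by rewrite /s addrC subrK.
set m := modulus k in k1 h1 h2 *.
have m0 : 0 <= m by exact: modulus_ge0.
have m1 : m <= 1 by exact: ltW.
have mX (n : nat) : m ^+ n <= 1 by exact: exprn_ile1.
have bnd (c0 c1 c2 : R[i]) : modulus (c0 + c1 * k + c2 * k ^+ 2) <= modulus c0 + modulus c1 + modulus c2.
  apply: le_trans (modulusD _ _) _; apply: lerD.
    apply: le_trans (modulusD _ _) _; apply: lerD => //.
    by rewrite modulusM ler_piMr// modulus_ge0.
  by rewrite modulusM modulusX ler_piMr// modulus_ge0.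
have hF : modulus F <= S by exact: bnd.
have hG : modulus G <= S' by exact: bnd.
have m30 : 0 <= m ^+ 3 by rewrite exprn_ge0.
rewrite (_ : _ - _ = (a * b' + b * a' + b * b' * k) * k ^+ 3 + F * s + G * r + r * s); last first.
  by rewrite fE gE /F /G; ring.
have e1 : modulus ((a * b' + b * a' + b * b' * k) * k ^+ 3) <= T * m ^+ 3.
  rewrite modulusM modulusX; apply: ler_wpM2r => //.
  apply: le_trans (modulusD _ _) _; apply: lerD => //.
  by rewrite (modulusM (b * b')) ler_piMr// modulus_ge0.
have e2 : modulus (F * s) <= S * (N * m ^+ 3).
  by rewrite modulusM ler_pM// modulus_ge0.
have e3 : modulus (G * r) <= S' * (M * m ^+ 3).
  by rewrite modulusM ler_pM// modulus_ge0.
have e4 : modulus (r * s) <= M * (N * m ^+ 3).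
  rewrite modulusM ler_pM ?modulus_ge0//; apply: le_trans h1 _.
  by rewrite ler_piMr.
have -> : (T + S * N + S' * M + M * N) * m ^+ 3 =
    T * m ^+ 3 + S * (N * m ^+ 3) + S' * (M * m ^+ 3) + M * (N * m ^+ 3) by ring.
apply: le_trans (modulusD _ _) _; apply: lerD => //.
apply: le_trans (modulusD _ _) _; apply: lerD => //.
by apply: le_trans (modulusD _ _) _; apply: lerD.
Qed.

Lemma taylor2_horner (R : realType) (P : {poly R[i]}) (f : R[i] -> R[i]) (A a b : R[i]) :
  taylor2 f A a b -> exists c, taylor2 (fun k => P.[f k]) P.[A] (P^`().[A] * a) c.
Proof.
move=> hf; elim/poly_ind: P => [|P c [e IH]].
  exists 0; have := taylor2_cst (0 : R[i]); rewrite horner0 deriv0 horner0 mul0r.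
  by congr taylor2; apply/funext => k; rewrite horner0.
exists (P.[A] * b + P^`().[A] * a * a + e * A + 0).
have := taylor2D (taylor2M IH hf) (taylor2_cst c).
have -> : (P * 'X + c%:P)^`().[A] * a = P.[A] * a + P^`().[A] * a * A + 0.
  by rewrite derivD derivC addr0 derivM derivX mulr1 hornerD hornerM hornerX; ring.
rewrite hornerMXaddC.
by congr taylor2; apply/funext => k; rewrite hornerMXaddC.
Qed.

Lemma taylor2_rot (R : realType) (f : R[i] -> R[i]) (A a b c : R[i]) :
  modulus c = 1 -> taylor2 f A a b ->
  taylor2 (fun k => f (c * k)) A (a * c) (b * c ^+ 2).
Proof.
move=> c1 [M [d [M0 d0 hf]]]; exists M, d; split=> // k kd.
have := hf (c * k); rewrite modulusM c1 mul1r => /(_ kd).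
by rewrite exprMn !mulrA.
Qed.

Lemma conjD (R : realType) (z w : R[i]) : conjc (z + w) = conjc z + conjc w.
Proof. exact: rmorphD. Qed.

Lemma conjM (R : realType) (z w : R[i]) : conjc (z * w) = conjc z * conjc w.
Proof. exact: rmorphM. Qed.

Lemma conjB (R : realType) (z w : R[i]) : conjc (z - w) = conjc z - conjc w.
Proof. exact: rmorphB. Qed.

Lemma conjX (R : realType) (z : R[i]) (n : nat) : conjc (z ^+ n) = conjc z ^+ n.
Proof. exact: rmorphXn. Qed.

Lemma taylor2_conj (R : realType) (f : R[i] -> R[i]) (A a b : R[i]) :
  taylor2 f A a b -> taylor2 (fun k => conjc (f (conjc k))) (conjc A) (conjc a) (conjc b).
Proof.
move=> [M [d [M0 d0 hf]]]; exists M, d; split=> // k kd.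
have -> : conjc (f (conjc k)) - (conjc A + conjc a * k + conjc b * k ^+ 2) =
    conjc (f (conjc k) - (A + a * conjc k + b * conjc k ^+ 2)).
  by rewrite conjB !conjD !(conjX, conjM) !conjcK.
by rewrite modulus_conj -(modulus_conj k); apply: hf; rewrite modulus_conj.
Qed.

Lemma ln_near1 (R : realType) (x : R) : `|x - 1| <= 1 / 2 -> `|ln x| <= 2 * `|x - 1|.
Proof.
move=> h; have /andP[h1 h2] : - (1 / 2) <= x - 1 <= 1 / 2 by rewrite -ler_norml.
have x0 : 0 < x by lra.
have up (y : R) : 0 < y -> ln y <= y - 1.
  by move=> y0; have := @le_ln1Dx R (y - 1); rewrite (addrC 1) subrK; apply; lra.
have u1 := up _ x0; have xV : 0 < x^-1 by rewrite invr_gt0.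
have := up _ xV; rewrite lnV ?posrE// => u2.
have n1 := ler_norm (x - 1); have n2 := ler_norm (- (x - 1)); rewrite normrN in n2.
have u3 : x^-1 - 1 <= 2 * `|x - 1|.
  have -> : x^-1 - 1 = (1 - x) / x by field; exact: lt0r_neq0.
  rewrite ler_pdivrMr//.
  have n0 := normr_ge0 (x - 1).
  by move: n0 n2; set t := `|_|; clear -h1; nra.
rewrite ler_norml; apply/andP; split; last first.
  by move: u1 n1 (normr_ge0 (x - 1)); clear; lra.
by move: u2 u3; clear; lra.
Qed.

Lemma complex_steps (R : realType) (x y h : R) :
  prod (prod ((x + h) +i* y = x +i* y + h%:C) ((x - h) +i* y = x +i* y - h%:C))
    (prod (x +i* (y + h) = x +i* y + 'i * h%:C) (x +i* (y - h) = x +i* y - 'i * h%:C)).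
Proof. by split; split; rewrite /real_complex_def; simpc. Qed.

(* The four values of [f] at [h, -h, ih, -ih] have product
   [A ^+ 4 + O(h ^+ 3)]. *)
Lemma ln_modulus_harm (R : realType) (F : R[i] -> R[i]) (x y : R) (A a b : R[i]) :
  taylor2 (fun k => F ((x +i* y) + k)) A a b -> A != 0 ->
  harm (fun x y => ln (modulus (F (x +i* y)))) x y.
Proof.
set f := fun k => _ => tf A0.
have m1 : modulus (-1 : R[i]) = 1 by rewrite modulusN modulus1.
(* The product f (k) f (-k) has no linear term; multiplying it by its value at ik, where the
   quadratic term has the opposite sign, leaves only the constant A^4. *)
have tQ := taylor2M tf (taylor2_rot m1 tf).
have [M [d [M0 d0 hH]]] := taylor2M tQ (taylor2_rot (modulus_i R) tQ).
have {}hH k : modulus k < d ->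
    modulus (f k * f (- k) * (f ('i * k) * f (- ('i * k))) - A ^+ 4) <= M * modulus k ^+ 3.
  move=> /hH; congr (modulus _ <= _); rewrite !mulN1r -(mulrA A).
  congr (_ - _); rewrite sqr_i; ring.
have fA : f 0 = A by exact: taylor2_0 tf.
have A4 : 0 < modulus A ^+ 4 by rewrite exprn_gt0// modulus_gt0.
set K := modulus A ^+ 4 in A4.
move=> e e0.
pose dl := Num.min (Num.min d 1) (Num.min (K / (2 * (M + 1))) (e * K / (2 * (M + 1)))).
have M1 : 0 < M + 1 by rewrite ltr_wpDl.
exists dl; first by rewrite /dl !lt_min d0 ltr01 /= !divr_gt0// mulr_gt0.
move=> h h0; rewrite /dl !lt_min => /andP[/andP[hd h1] /andP[h2 h3]].
have mh : modulus h%:C = h by rewrite modulus_real gtr0_norm.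
have := hH h%:C; rewrite mh => /(_ hd).
set H := _ * _ * _ => hHA.
have Mh : M * h ^+ 3 <= (M + 1) * h * h ^+ 2.
  by rewrite -mulrA -exprS; apply: ler_wpM2r; [rewrite exprn_ge0// ltW|rewrite lerDl].
have h21 : h ^+ 2 <= 1 by apply: exprn_ile1; exact: ltW.
have h20 : 0 <= h ^+ 2 by exact: sqr_ge0.
rewrite ltr_pdivlMr ?mulr_gt0// in h2; rewrite ltr_pdivlMr ?mulr_gt0// in h3.
have q1 : `|modulus H / K - 1| <= M * h ^+ 3 / K.
  have -> : modulus H / K - 1 = (modulus H - K) / K by field; exact: lt0r_neq0.
  rewrite normrM normfV (gtr0_norm A4); apply: ler_wpM2r; first by rewrite invr_ge0 ltW.
  apply: le_trans _ hHA; rewrite /K -modulusX ler_norml; apply/andP; split.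
    by have := modulusB H (H - A ^+ 4); rewrite subKr; lra.
  by have := modulusD (H - A ^+ 4) (A ^+ 4); rewrite subrK; lra.
have q2 : M * h ^+ 3 / K <= 1 / 2.
  rewrite ler_pdivrMr//; apply: le_trans Mh _.
  have : (M + 1) * h * h ^+ 2 <= (M + 1) * h by rewrite ler_piMr// mulr_ge0 ?ltW.
  by clear -h2; lra.
have q3 : M * h ^+ 3 / K <= e / 2 * h ^+ 2.
  rewrite ler_pdivrMr//; apply: le_trans Mh _.
  rewrite [leRHS]mulrAC; apply: ler_wpM2r => //; clear -h3; lra.
have HK : 0 < modulus H / K.
  by move: (le_trans q1 q2); rewrite ler_norml => /andP[]; lra.
have H0 : 0 < modulus H by move: HK; rewrite pmulr_lgt0// invr_gt0.
have := ln_near1 (le_trans q1 q2).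
rewrite ln_div ?posrE// => hl.
have -> : lap4 (fun x y => ln (modulus (F (x +i* y)))) x y h = ln (modulus H) - ln K.
  have e1 (k : R[i]) : modulus (F (x +i* y + k)) = modulus (f k) by [].
  rewrite /lap4.
  rewrite !(complex_steps x y h).
  rewrite !e1 -[x +i* y in X in _ - 4 * X]addr0 e1 fA /K lnXn ?modulus_gt0//.
  move: H0; rewrite /H !modulusM.
  set p1 := modulus (f _); set p2 := modulus (f _); set p3 := modulus (f _); set p4 := modulus (f _).
  have [s1 s2 s3 s4] : [/\ 0 <= p1, 0 <= p2, 0 <= p3 & 0 <= p4] by split; exact: modulus_ge0.
  move=> p0; have [r1 r2 r3 r4] : [/\ 0 < p1, 0 < p2, 0 < p3 & 0 < p4].
    split; rewrite lt_neqAle ?s1 ?s2 ?s3 ?s4 andbT; apply/eqP => pp;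
      by move: p0; rewrite -pp ?mul0r ?mulr0 ?mul0r ltxx.
  by rewrite !lnM ?posrE ?mulr_gt0//; ring.
apply: le_trans hl _; move: q1 q3; clear; lra.
Qed.

(* The Laplacian vanishes exactly when the quadratic part of the expansion is
   the real part of [be * k ^+ 2]. *)
Definition harm_jet (R : realType) (g : R[i] -> R) (z : R[i]) : Prop :=
  exists al be : R[i], forall e : R, 0 < e -> exists2 d, 0 < d &
    forall k, modulus k < d ->
      `|g (z + k) - g z - complex.Re (al * k + be * k ^+ 2)| <= e * modulus k ^+ 2.

(** Substituting the expansion of F into al E + be E^2, with E = F - A, again gives the real part of
    a polynomial c1 k + c2 k^2 up to o(|k|^2). Over k = h, -h, ih, -ih both k and k^2 sum to
    zero. *)
Lemma harm_jet_comp (R : realType) (g : R[i] -> R) (F : R[i] -> R[i]) (x y : R) (A a b : R[i]) :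
  taylor2 (fun k => F ((x +i* y) + k)) A a b -> harm_jet g A ->
  harm (fun x y => g (F (x +i* y))) x y.
Proof.
set f := fun k => _ => tf [al [be hg]].
have fA : f 0 = A by exact: taylor2_0 tf.
have tE := taylor2D tf (taylor2_cst (- A)).
pose G k := al * (f k + - A) + be * ((f k + - A) * (f k + - A)).
have [c0 [c1 [c2 tG]]] : exists c0 c1 c2, taylor2 G c0 c1 c2.
  do 3 eexists; exact: (taylor2D (taylor2M (taylor2_cst al) tE)
    (taylor2M (taylor2_cst be) (taylor2M tE tE))).
have c00 : c0 = 0 by rewrite -(taylor2_0 tG) /G fA subrr !mulr0 addr0.
rewrite {}c00 in tG; have [M [d2 [M0 d20 hG]]] := tG.
have [L [d1 [L0 d10 hL]]] := taylor2_lipschitz tf.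
move=> e e0.
have L10 : 0 < L + 1 by rewrite ltr_wpDl.
have L20 : 0 < L ^+ 2 + 1 by rewrite ltr_wpDl ?sqr_ge0.
have M10 : 0 < M + 1 by rewrite ltr_wpDl.
have eta0 : 0 < e / (8 * (L ^+ 2 + 1)) by rewrite divr_gt0// mulr_gt0.
have [d3 d30 h3] := hg _ eta0.
exists (Num.min (Num.min d1 d2) (Num.min (d3 / (L + 1)) (e / (8 * (M + 1))))).
  by rewrite !lt_min d10 d20 /= !divr_gt0// mulr_gt0.
move=> h h0; rewrite !lt_min => /andP[/andP[hd1 hd2] /andP[hd3 hd4]].
rewrite ltr_pdivlMr// in hd3; rewrite ltr_pdivlMr ?mulr_gt0// in hd4.
have h20 : 0 <= h ^+ 2 by exact: sqr_ge0.
have key (k : R[i]) : modulus k = h ->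
    `|g (f k) - g A - complex.Re (c1 * k + c2 * k ^+ 2)| <= e / 4 * h ^+ 2.
  move=> kh; have := hL k; rewrite kh => /(_ hd1) Ek.
  have Ed3 : modulus (f k - A) < d3.
    by apply: le_lt_trans Ek _; apply: le_lt_trans hd3; clear -h0; nra.
  have := h3 _ Ed3; rewrite (addrC A) subrK expr2 -/(G k) => g1.
  have := hG k; rewrite kh add0r => /(_ hd2) g2.
  have g3 := le_trans (Re_le_modulus _) g2.
  have g4 : e / (8 * (L ^+ 2 + 1)) * modulus (f k - A) ^+ 2 <= e / 8 * h ^+ 2.
    have E2 : modulus (f k - A) ^+ 2 <= (L ^+ 2 + 1) * h ^+ 2.
      apply: (@le_trans _ _ ((L * h) ^+ 2)).
        by rewrite ler_pXn2r// ?nnegrE ?modulus_ge0// mulr_ge0// ltW.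
      by rewrite exprMn mulrDl mul1r lerDl.
    apply: le_trans (ler_wpM2l (ltW eta0) E2) _.
    by apply: le_of_eq; field; exact: lt0r_neq0.
  have g5 : M * h ^+ 3 <= e / 8 * h ^+ 2.
    rewrite exprS mulrA; apply: ler_wpM2r => //; clear -hd4 h0; lra.
  have -> : g (f k) - g A - complex.Re (c1 * k + c2 * k ^+ 2) =
    (g (f k) - g A - complex.Re (G k)) + complex.Re (G k - (c1 * k + c2 * k ^+ 2)).
    by rewrite (ReD (G k) (- _)) ReN; ring.
  apply: le_trans (ler_normD _ _) _; move: g1 g3 g4 g5; clear; lra.
have mh : modulus h%:C = h by rewrite modulus_real gtr0_norm.
have k1 := key h%:C mh.
have k2 := key (- h%:C); rewrite modulusN mh in k2; have {}k2 := k2 erefl.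
have k3 := key ('i * h%:C); rewrite modulusM modulus_i mul1r mh in k3; have {}k3 := k3 erefl.
have k4 := key (- ('i * h%:C)).
rewrite modulusN modulusM modulus_i mul1r mh in k4; have {}k4 := k4 erefl.
have : complex.Re (c1 * h%:C + c2 * h%:C ^+ 2) + complex.Re (c1 * - h%:C + c2 * (- h%:C) ^+ 2) +
  complex.Re (c1 * ('i * h%:C) + c2 * ('i * h%:C) ^+ 2) +
  complex.Re (c1 * (- ('i * h%:C)) + c2 * (- ('i * h%:C)) ^+ 2) = 0.
  rewrite -!ReD (_ : _ + _ = 0)//.
  by rewrite !sqrrN exprMn sqr_i; ring.
move: k1 k2 k3 k4; rewrite /lap4.
rewrite !(complex_steps x y h).
have -> : F (x +i* y) = A by rewrite -fA /f addr0.
rewrite -/(f h%:C) -/(f (- h%:C)) -/(f ('i * h%:C)) -/(f (- ('i * h%:C))).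
rewrite !ler_norml => /andP[p1 p2] /andP[p3 p4] /andP[p5 p6] /andP[p7 p8] S0.
by apply/andP; split; move: p1 p2 p3 p4 p5 p6 p7 p8 S0; clear; lra.
Qed.

Lemma ball_modulus (R : realType) (A : set R[i]) (z : R[i]) :
  nbhs (z : R[i]^o) A -> exists2 d : R, 0 < d & forall k, modulus k < d -> A (z + k).
Proof.
move=> /nbhs_ballP[[d d'] /=]; rewrite ltcE /= => /andP[/eqP d'0 d0] hd.
exists d => // k kd; apply: hd; rewrite /ball /= opprD addrA subrr add0r normrN.
by rewrite ltcE /= d'0 eqxx.
Qed.

Lemma continuous_at_modulus (R : realType) (u : R[i] -> R) (z : R[i]) :
  @continuous_at R[i]^o R z u ->
  forall e : R, 0 < e -> exists2 d, 0 < d &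
    forall k, modulus k < d -> `|u (z + k) - u z| < e.
Proof.
move=> /cvgrPdist_lt cu e e0; have /ball_modulus[d d0 hd] := cu e e0.
by exists d => // k /hd; rewrite distrC.
Qed.

Lemma within_modulus (R : realType) (K : set R[i]) (u : R[i] -> R) (z : R[i]) :
  u @ within (~` K) (nbhs (z : R[i]^o)) --> (0 : R) ->
  forall e : R, 0 < e -> exists2 d, 0 < d &
    forall k, modulus k < d -> ~ K (z + k) -> `|u (z + k)| < e.
Proof.
move=> /cvgrPdist_lt cu e e0; have := cu e e0.
rewrite near_withinE => /ball_modulus[d d0 hd].
by exists d => // k kd Kk; have := hd k kd Kk; rewrite sub0r normrN.
Qed.

Lemma cont2_modulus (R : realType) (u : R[i] -> R) (x y : R) :
  (forall e : R, 0 < e -> exists2 d, 0 < d &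
     forall k, modulus k < d -> `|u ((x +i* y) + k) - u (x +i* y)| < e) <->
  cont2 (fun x y => u (x +i* y)) x y.
Proof.
split=> [cu|/cont2P cu].
  apply/cont2P => e /cu[d d0 hd]; exists (d / 2); first by rewrite divr_gt0.
  move=> x' y' xx yy.
  have -> : x' +i* y' = x +i* y + ((x' - x) +i* (y' - y)).
    by simpc; rewrite !(addrC _ (_ - _)) !subrK.
  apply: hd; apply: le_lt_trans (modulus_le_ReIm _) _ => /=; lra.
move=> e /cu[d d0 hd]; exists d => // -[a b] kd; simpc.
by apply: hd; rewrite addrAC subrr add0r; apply: le_lt_trans kd;
  [exact: (Re_le_modulus (a +i* b))|exact: (Im_le_modulus (a +i* b))].
Qed.

Lemma modulus_lipschitz (R : realType) (z w : R[i]) :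
  `|modulus z - modulus w| <= modulus (z - w).
Proof.
rewrite ler_norml; apply/andP; split.
  by have := modulusB z (z - w); rewrite subKr; lra.
by have := modulusD (z - w) w; rewrite subrK; lra.
Qed.

Lemma chart_cont2 (R : realType) (g : R[i] -> R) (Gam : R[i] -> R[i]) (x y : R) (A a b : R[i]) :
  (forall z, forall e : R, 0 < e -> exists2 d : R, 0 < d &
    forall k, modulus k < d -> `|g (z + k) - g z| < e) ->
  taylor2 (fun h => Gam ((x +i* y) + h)) A a b ->
  cont2 (fun x y => g (Gam (x +i* y))) x y.
Proof.
move=> cg hT; have GA : Gam (x +i* y) = A by have := taylor2_0 hT; rewrite addr0.
apply: (cont2_modulus (fun w => g (Gam w)) x y).1 => e e0.
have [L [d [L0 d0 hL]]] := taylor2_lipschitz hT.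
have L10 : 0 < L + 1 by rewrite ltr_wpDl.
have [d1 d10 h1] := cg A e e0.
exists (Num.min d (d1 / (L + 1))); first by rewrite lt_min d0 divr_gt0.
move=> k; rewrite lt_min => /andP[/hL hk ke].
rewrite ltr_pdivlMr// in ke.
have -> : Gam (x +i* y + k) = A + (Gam (x +i* y + k) - A) by rewrite (addrC A) subrK.
rewrite GA; apply: h1; apply: le_lt_trans hk _.
by apply: le_lt_trans ke; have := modulus_ge0 k; clear; lra.
Qed.

Lemma modulus_cont2 (R : realType) (F : R[i] -> R[i]) (x y : R) (c A a b : R[i]) :
  taylor2 (fun h => F ((x +i* y) + h)) A a b ->
  cont2 (fun x y => modulus (F (x +i* y) + c)) x y.
Proof.
move=> hT; apply: (@chart_cont2 _ (fun z => modulus (z + c)) F x y A a b) => //.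
move=> z e e0; exists e => // k ke; apply: le_lt_trans (modulus_lipschitz _ _) _.
by rewrite (_ : _ - _ = k)//; ring.
Qed.

Lemma taylor_mean_value (R : realType) (f df : R -> R) (x s p q eta : R) :
  (forall y : R, `|y - x| <= `|s| -> is_derive y (1 : R) f (df y)) ->
  (forall y : R, `|y - x| <= `|s| -> `|df y - (p + q * (y - x))| <= eta) ->
  `|f (x + s) - f x - (p * s + q / 2 * s ^+ 2)| <= eta * `|s|.
Proof.
move=> fd fb.
pose P : {poly R} := p *: ('X - x%:P) + (q / 2) *: ('X - x%:P) ^+ 2.
have Pd y : P^`().[y] = p + q * (y - x).
  rewrite /P derivD !derivZ expr2 derivM derivXsubC mulr1 mul1r.
  by rewrite !(hornerD, hornerZ, hornerN, hornerX) -polyC1 !hornerC; field.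
pose g : R -> R := f - horner P.
have gd y : `|y - x| <= `|s| -> is_derive y (1 : R) g (df y - P^`().[y]).
  by move=> yx; apply: is_deriveB; exact: fd.
have main a b : a <= b -> (forall y : R, a <= y -> y <= b -> `|y - x| <= `|s|) ->
    exists2 c, `|c - x| <= `|s| & g b - g a = (df c - P^`().[c]) * (b - a).
  move=> ab hab.
  have [||c cab e] := @MVT_segment R g (fun y => df y - P^`().[y]) a b ab.
  - by move=> y; rewrite in_itv /= => /andP[/ltW h1 /ltW h2]; apply: gd; exact: hab.
  - apply: derivable_within_continuous => y; rewrite in_itv /= => /andP[h1 h2].
    by have [] := gd y (hab y h1 h2).
  - by move: cab; rewrite in_itv /= => /andP[h1 h2]; exists c => //; exact: hab.
have fin c : `|c - x| <= `|s| -> g (x + s) - g x = (df c - P^`().[c]) * s ->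
    `|f (x + s) - f x - (p * s + q / 2 * s ^+ 2)| <= eta * `|s|.
  move=> cx; have -> : g (x + s) - g x = f (x + s) - f x - (p * s + q / 2 * s ^+ 2).
    by rewrite /g !fctE /P expr2 !(hornerD, hornerZ, hornerM, hornerN, hornerX, hornerC); ring.
  by move=> ->; rewrite normrM Pd ler_wpM2r// fb.
case: (leP 0 s) => s0.
  have [||c cx e] := main x (x + s); first by rewrite lerDl.
    move=> y h1 h2; rewrite !ger0_norm//; first by rewrite lerBlDl.
    by rewrite subr_ge0.
  by apply: (fin c) => //; rewrite e (addrC x s) addrK.
have [||c cx e] := main (x + s) x; first by rewrite gerDl ltW.
  move=> y h1 h2; rewrite (ltr0_norm s0) ler0_norm ?subr_le0//.
  by rewrite lerN2 lerBrDl.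
by apply: (fin c) => //; rewrite -[LHS]opprB e opprD addrA subrr add0r mulrN opprK.
Qed.

Lemma differentiable_of_partials (R : realType) (f fx fy : R -> R -> R) (x y r : R) :
  0 < r ->
  (forall s t : R, `|s - x| < r -> `|t - y| < r ->
     is_derive s (1 : R) (fun s => f s t) (fx s t)) ->
  (forall s t : R, `|s - x| < r -> `|t - y| < r ->
     is_derive t (1 : R) (fun t => f s t) (fy s t)) ->
  cont2 fx x y -> cont2 fy x y ->
  forall e : R, 0 < e -> exists2 d, 0 < d & forall s t : R, `|s| < d -> `|t| < d ->
    `|f (x + s) (y + t) - f x y - (fx x y * s + fy x y * t)| <= e * (`|s| + `|t|).
Proof.
move=> r0 hx hy /cont2P cx /cont2P cy e e0.
have [d1 d10 h1] := cx _ e0; have [d2 d20 h2] := cy _ e0.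
exists (Num.min r (Num.min d1 d2)); first by rewrite !lt_min r0 d10.
move=> s t; rewrite !lt_min => /and3P[sr sd1 sd2] /and3P[tr td1 td2].
have yt : y + t - y = t by rewrite addrAC subrr add0r.
have e1 : `|f (x + s) (y + t) - f x (y + t) - (fx x y * s + 0 / 2 * s ^+ 2)| <= e * `|s|.
  apply: (@taylor_mean_value _ (fun s => f s (y + t)) (fun s => fx s (y + t))) => z zs.
    by apply: hx; rewrite ?yt//; exact: le_lt_trans sr.
  by rewrite mul0r addr0 ltW// h1 ?yt//; exact: le_lt_trans sd1.
have e2 : `|f x (y + t) - f x y - (fy x y * t + 0 / 2 * t ^+ 2)| <= e * `|t|.
  apply: (@taylor_mean_value _ (fun t => f x t) (fun t => fy x t)) => z zt.
    by apply: hy; rewrite ?subrr ?normr0//; exact: le_lt_trans tr.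
  by rewrite mul0r addr0 ltW// h2 ?subrr ?normr0//; exact: le_lt_trans td2.
rewrite mulrDr; apply: le_trans (lerD e1 e2); apply: le_trans (ler_normD _ _).
by rewrite !mul0r !addr0; apply: le_of_eq; congr `|_|; ring.
Qed.

(** The increment is split into a horizontal step at height y followed by a vertical step over x +
    s. On each leg the mean value theorem integrates the first order expansion of [partial_x g] or
    [partial_y g], which holds because their partial derivatives are continuous at z. *)
Lemma harmonic_on_jet (R : realType) (U : set R[i]) (g : R[i] -> R) (z : R[i]) (r : R) :
  harmonic_on U g -> 0 < r -> (forall k, modulus k < r -> U (z + k)) -> harm_jet g z.
Proof.
case: z => x y hg r0 Ur.
have Uxy s t : `|s - x| < r / 2 -> `|t - y| < r / 2 -> U (s +i* t).
  move=> sx ty; have -> : s +i* t = x +i* y + ((s - x) +i* (t - y)).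
    by simpc; rewrite !(addrC _ (_ - _)) !subrK.
  by apply: Ur; apply: le_lt_trans (modulus_le_ReIm _) _ => /=; lra.
have r20 : 0 < r / 2 by rewrite divr_gt0.
pose G (s t : R) := g (s +i* t).
pose gx (s t : R) := partial_x g (s +i* t); pose gy (s t : R) := partial_y g (s +i* t).
pose gxx (s t : R) := partial_x (partial_x g) (s +i* t).
pose gxy (s t : R) := partial_y (partial_x g) (s +i* t).
pose gyx (s t : R) := partial_x (partial_y g) (s +i* t).
pose gyy (s t : R) := partial_y (partial_y g) (s +i* t).
have dx (u : R[i] -> R) s t : has_partials u (s +i* t) ->
    is_derive s (1 : R) (fun s => u (s +i* t)) (partial_x u (s +i* t)).
  by move=> [h _]; apply: DeriveDef => //=; rewrite /partial_x derive1E.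
have dy (u : R[i] -> R) s t : has_partials u (s +i* t) ->
    is_derive t (1 : R) (fun t => u (s +i* t)) (partial_y u (s +i* t)).
  by move=> [_ h]; apply: DeriveDef => //=; rewrite /partial_y derive1E.
have dG s t : `|s - x| < r / 2 -> `|t - y| < r / 2 -> has_partials g (s +i* t).
  by move=> h1 h2; have [[]] := hg _ (Uxy _ _ h1 h2).
have dgx s t : `|s - x| < r / 2 -> `|t - y| < r / 2 -> has_partials (partial_x g) (s +i* t).
  by move=> h1 h2; have [_ []] := hg _ (Uxy _ _ h1 h2).
have dgy s t : `|s - x| < r / 2 -> `|t - y| < r / 2 -> has_partials (partial_y g) (s +i* t).
  by move=> h1 h2; have [_ _ []] := hg _ (Uxy _ _ h1 h2).
have xx0 : `|x - x| < r / 2 by rewrite subrr normr0.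
have yy0 : `|y - y| < r / 2 by rewrite subrr normr0.
have [_ _ _ [cxx cxy cyx cyy] lap] := hg (x +i* y) (Uxy x y xx0 yy0).
have {}lap : gyy x y = - gxx x y by move: lap; rewrite -/(gxx x y) -/(gyy x y); lra.
have cc (u : R[i] -> R) : @continuous_at R[i]^o R (x +i* y) u -> cont2 (fun x y => u (x +i* y)) x y.
  by move=> h; apply/cont2_modulus; exact: continuous_at_modulus.
have ex := @differentiable_of_partials R gx gxx gxy x y _ r20
  (fun s t h1 h2 => dx _ _ _ (dgx s t h1 h2)) (fun s t h1 h2 => dy _ _ _ (dgx s t h1 h2))
  (cc _ cxx) (cc _ cxy).
have ey := @differentiable_of_partials R gy gyx gyy x y _ r20
  (fun s t h1 h2 => dx _ _ _ (dgy s t h1 h2)) (fun s t h1 h2 => dy _ _ _ (dgy s t h1 h2))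
  (cc _ cyx) (cc _ cyy).
(* For k = s + it the real part is gx s + gy t + gxx (s^2 - t^2) / 2 + gyx s t, which is the second
   order expansion once gyy = - gxx; the mixed derivative that occurs is the one met on the vertical
   leg. *)
exists (gx x y -i* gy x y), ((gxx x y / 2) -i* (gyx x y / 2)) => e e0.
have e40 : 0 < e / 4 by rewrite divr_gt0.
have [d1 d10 h1] := ex _ e40; have [d2 d20 h2] := ey _ e40.
exists (Num.min (r / 2) (Num.min d1 d2)); first by rewrite !lt_min r20 d10.
move=> -[s t] kd; pose m := modulus (s +i* t).
have sm : `|s| <= m by exact: (Re_le_modulus (s +i* t)).
have tm : `|t| <= m by exact: (Im_le_modulus (s +i* t)).
move: kd; rewrite -/m !lt_min => /and3P[mr md1 md2].
have m0 : 0 <= m by exact: modulus_ge0.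
have a1 : `|G (x + s) y - G x y - (gx x y * s + gxx x y / 2 * s ^+ 2)| <= e / 4 * `|s| * `|s|.
  apply: (@taylor_mean_value _ (fun s => G s y) (fun s => gx s y)) => z zs.
    by apply: dx; apply: dG => //; apply: le_lt_trans (le_trans zs sm) mr.
  have := h1 (z - x) 0; rewrite normr0 addr0 mulr0 !addr0 (addrC x) subrK opprD addrA.
  move=> h; apply: le_trans (h _ d10) _; first exact: le_lt_trans (le_trans zs sm) md1.
  by apply: ler_wpM2l => //; exact: ltW.
have a2 : `|G (x + s) (y + t) - G (x + s) y - ((gy x y + gyx x y * s) * t + gyy x y / 2 * t ^+ 2)|
    <= e / 4 * (`|s| + `|t|) * `|t|.
  apply: (@taylor_mean_value _ (fun t => G (x + s) t) (fun t => gy (x + s) t)) => z zt.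
    apply: dy; apply: dG; last exact: le_lt_trans (le_trans zt tm) mr.
    by rewrite addrAC subrr add0r; exact: le_lt_trans sm mr.
  have := h2 s (z - y); rewrite (addrC y) subrK => h.
  have := h (le_lt_trans sm md2) (le_lt_trans (le_trans zt tm) md2).
  rewrite !opprD !addrA => {}h; apply: le_trans h _.
  by apply: ler_wpM2l; [exact: ltW|rewrite lerD2l].
rewrite -/m; have -> : x +i* y + (s +i* t) = (x + s) +i* (y + t) by simpc.
rewrite -/(G (x + s) (y + t)) -/(G x y).
have -> : complex.Re ((gx x y -i* gy x y) * (s +i* t) +
    (gxx x y / 2 -i* (gyx x y / 2)) * (s +i* t) ^+ 2) =
    (gx x y * s + gxx x y / 2 * s ^+ 2) +
    ((gy x y + gyx x y * s) * t + gyy x y / 2 * t ^+ 2).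
  by rewrite lap expr2; simpc => /=; field.
have b1 : e / 4 * `|s| * `|s| <= e / 4 * m ^+ 2.
  by rewrite -mulrA expr2; apply: ler_wpM2l; [exact: ltW|exact: ler_pM].
have b2 : e / 4 * (`|s| + `|t|) * `|t| <= e / 4 * (2 * m ^+ 2).
  rewrite -mulrA expr2; apply: ler_wpM2l; first exact: ltW.
  by rewrite mulrA; apply: ler_pM => //; rewrite mulr_natl mulr2n lerD.
have m20 : 0 <= e * m ^+ 2 by rewrite mulr_ge0 ?sqr_ge0// ltW.
rewrite ler_norml; move: a1 a2; rewrite !ler_norml => /andP[p1 p2] /andP[p3 p4].
by apply/andP; split; move: p1 p2 p3 p4 b1 b2 m20; clear; lra.
Qed.

(** * Power series and charts of an analytic arc *)

Definition clim (R : realType) (s : nat -> R[i]) (S : R[i]) : Prop :=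
  forall e : R, 0 < e -> exists N, forall n, (N <= n)%N -> modulus (S - s n) <= e.

Lemma climD (R : realType) (s t : nat -> R[i]) (S T : R[i]) :
  clim s S -> clim t T -> clim (fun n => s n + t n) (S + T).
Proof.
move=> cs ct e e0; have e20 : 0 < e / 2 by rewrite divr_gt0.
have [N hN] := cs _ e20; have [M hM] := ct _ e20.
exists (maxn N M) => n; rewrite geq_max => /andP[/hN h1 /hM h2].
rewrite opprD addrACA; apply: le_trans (modulusD _ _) _.
by rewrite [leRHS]splitr; exact: lerD.
Qed.

Lemma climZ (R : realType) (s : nat -> R[i]) (S c : R[i]) :
  clim s S -> clim (fun n => c * s n) (c * S).
Proof.
move=> cs e e0; have c0 : 0 < modulus c + 1 by rewrite ltr_wpDl// modulus_ge0.
have [N hN] := cs _ (divr_gt0 e0 c0); exists N => n /hN h.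
rewrite -mulrBr modulusM; apply: le_trans (ler_wpM2l (modulus_ge0 c) h) _.
rewrite mulrA ler_pdivrMr// mulrC; apply: ler_wpM2l; first exact: ltW.
by rewrite lerDl.
Qed.

Lemma clim_le (R : realType) (s : nat -> R[i]) (S : R[i]) (B : R) (N : nat) :
  (forall n, (N <= n)%N -> modulus (s n) <= B) -> clim s S -> modulus S <= B.
Proof.
move=> sB cs; apply/ler_addgt0Pr => e e0; have [M hM] := cs e e0.
pose n := maxn N M.
rewrite -(subrK (s n) S) addrC; apply: le_trans (modulusD _ _) _.
by apply: lerD; [apply: sB; exact: leq_maxl|apply: hM; exact: leq_maxr].
Qed.

Lemma eq_clim (R : realType) (s t : nat -> R[i]) (S : R[i]) :
  s =1 t -> clim s S -> clim t S.
Proof. by move=> st cs e /cs[N hN]; exists N => n /hN; rewrite st. Qed.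

Lemma clim_unique (R : realType) (s : nat -> R[i]) (S T : R[i]) :
  clim s S -> clim s T -> S = T.
Proof.
move=> h1 h2; apply/eqP; rewrite -subr_eq0; apply/eqP/modulus0_eq0/eqP.
rewrite eq_le modulus_ge0 andbT.
apply: (@clim_le _ (fun n => s n + -1 * s n) _ _ 0) => [n _|].
  by rewrite mulN1r subrr modulus0.
have -> : S - T = S + -1 * T by rewrite mulN1r.
by apply: climD => //; exact: climZ.
Qed.

Lemma clim_ReIm (R : realType) (s : nat -> R[i]) (a b : R) :
  (fun n => complex.Re (s n)) @ \oo --> a -> (fun n => complex.Im (s n)) @ \oo --> b ->
  clim s (a +i* b).
Proof.
move=> /cvgrPdist_le ca /cvgrPdist_le cb e e0; have e20 : 0 < e / 2 by rewrite divr_gt0.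
have [N _ hN] := ca _ e20; have [M _ hM] := cb _ e20.
exists (maxn N M) => n; rewrite geq_max => /andP[/hN /= h1 /hM /= h2].
apply: le_trans (modulus_le_ReIm _) _.
rewrite ReD ReN ImD ImN /= [leRHS]splitr; exact: lerD.
Qed.

Lemma half_sum (R : realType) (n : nat) : \sum_(0 <= k < n) (1 / 2 : R) ^+ k <= 2.
Proof.
suff -> : \sum_(0 <= k < n) (1 / 2 : R) ^+ k = 2 - 2 * (1 / 2) ^+ n.
  by rewrite lerBlDr lerDl mulr_ge0// exprn_ge0// divr_ge0.
elim: n => [|n IH]; first by rewrite big_geq// expr0; lra.
by rewrite big_nat_recr//= IH exprS; lra.
Qed.

Lemma modulus_sum (R : realType) (f : nat -> R[i]) (n : nat) :
  modulus (\sum_(0 <= k < n) f k) <= \sum_(0 <= k < n) modulus (f k).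
Proof.
elim: n => [|n IH]; first by rewrite !big_geq// modulus0.
by rewrite !big_nat_recr//=; apply: le_trans (modulusD _ _) _; exact: lerD.
Qed.

Lemma modulus_sum_le (R : realType) (f : nat -> R[i]) (C : R) (n : nat) :
  (forall k, modulus (f k) <= C * (1 / 2) ^+ k) ->
  modulus (\sum_(0 <= k < n) f k) <= 2 * C.
Proof.
move=> fC; have C0 : 0 <= C.
  by apply: le_trans (modulus_ge0 (f 0%N)) _; have := fC 0%N; rewrite expr0 mulr1.
apply: le_trans (modulus_sum _ _) _.
apply: (@le_trans _ _ (\sum_(0 <= k < n) C * (1 / 2) ^+ k)); first by apply: ler_sum => k _.
by rewrite -mulr_sumr mulrC; apply: ler_wpM2r => //; exact: half_sum.
Qed.

Lemma real_series_cvg (R : realType) (f : nat -> R) (C : R) :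
  (forall k, `|f k| <= C * (1 / 2) ^+ k) -> cvgn (series f).
Proof.
move=> fC; have C0 : 0 <= C.
  by apply: le_trans (normr_ge0 (f 0%N)) _; have := fC 0%N; rewrite expr0 mulr1.
apply: normed_cvg; apply: (series_le_cvg _ _ fC) => [n|n|].
- exact: normr_ge0.
- by rewrite mulr_ge0// exprn_ge0// divr_ge0.
- by apply: (@is_cvg_geometric_series R C (1 / 2)); rewrite ger0_norm; lra.
Qed.

Lemma Re_sum (R : realType) (f : nat -> R[i]) (n : nat) :
  complex.Re (\sum_(0 <= k < n) f k) = \sum_(0 <= k < n) complex.Re (f k).
Proof.
elim: n => [|n IH]; first by rewrite !big_geq.
by rewrite !big_nat_recr//= ReD IH.
Qed.

Lemma Im_sum (R : realType) (f : nat -> R[i]) (n : nat) :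
  complex.Im (\sum_(0 <= k < n) f k) = \sum_(0 <= k < n) complex.Im (f k).
Proof.
elim: n => [|n IH]; first by rewrite !big_geq.
by rewrite !big_nat_recr//= ImD IH.
Qed.

Lemma csum_exists (R : realType) (f : nat -> R[i]) (C : R) :
  (forall k, modulus (f k) <= C * (1 / 2) ^+ k) ->
  exists S, clim (fun n => \sum_(0 <= k < n) f k) S.
Proof.
move=> fC.
have cR : cvgn (series (fun k => complex.Re (f k))).
  by apply: (real_series_cvg (C := C)) => k; exact: le_trans (Re_le_modulus _) (fC k).
have cI : cvgn (series (fun k => complex.Im (f k))).
  by apply: (real_series_cvg (C := C)) => k; exact: le_trans (Im_le_modulus _) (fC k).
exists (limn (series (fun k => complex.Re (f k))) +i* limn (series (fun k => complex.Im (f k)))).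
apply: clim_ReIm.
  by rewrite (_ : (fun n => _) = series (fun k => complex.Re (f k)))//; apply/funext => n; rewrite Re_sum.
by rewrite (_ : (fun n => _) = series (fun k => complex.Im (f k)))//; apply/funext => n; rewrite Im_sum.
Qed.

(* [pow1 w k] and [pow2 w k] are the coefficients of [h] and [h ^+ 2] in
   [(w + h) ^+ k]. *)
Fixpoint pow1 (R : realType) (w : R[i]) (k : nat) : R[i] :=
  if k is k'.+1 then w * pow1 w k' + w ^+ k' else 0.

Fixpoint pow2 (R : realType) (w : R[i]) (k : nat) : R[i] :=
  if k is k'.+1 then w * pow2 w k' + pow1 w k' else 0.

Lemma double_pow (R : realType) (q : R) (k : nat) : 0 <= q -> q ^+ k <= (2 * q) ^+ k.
Proof. by move=> q0; apply: lerXn2r; rewrite ?nnegrE ?mulr_ge0//; lra. Qed.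

Lemma pow1_bound (R : realType) (w : R[i]) (q : R) (k : nat) :
  0 < q -> modulus w <= q -> modulus (pow1 w k) <= (2 * q) ^+ k / q.
Proof.
move=> q0 wq; elim: k => [|k IH] /=.
  by rewrite modulus0 expr0 divr_ge0// ltW.
apply: le_trans (modulusD _ _) _; rewrite modulusM modulusX.
have h1 : modulus w * modulus (pow1 w k) <= q * ((2 * q) ^+ k / q).
  by apply: ler_pM => //; exact: modulus_ge0.
have h2 : modulus w ^+ k <= (2 * q) ^+ k.
  apply: le_trans (double_pow k (ltW q0)).
  by apply: lerXn2r; rewrite ?nnegrE ?modulus_ge0// ltW.
apply: le_trans (lerD h1 h2) _; rewrite (exprS (2 * q)); apply: le_of_eq.
by set t := (2 * q) ^+ k; field; exact: lt0r_neq0.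
Qed.

Lemma pow2_bound (R : realType) (w : R[i]) (q : R) (k : nat) :
  0 < q -> modulus w <= q -> modulus (pow2 w k) <= (2 * q) ^+ k / q ^+ 2.
Proof.
move=> q0 wq; elim: k => [|k IH] /=.
  by rewrite modulus0 expr0 divr_ge0// exprn_ge0// ltW.
apply: le_trans (modulusD _ _) _; rewrite modulusM.
have h1 : modulus w * modulus (pow2 w k) <= q * ((2 * q) ^+ k / q ^+ 2).
  by apply: ler_pM => //; exact: modulus_ge0.
apply: le_trans (lerD h1 (pow1_bound k q0 wq)) _.
rewrite (exprS (2 * q)); apply: le_of_eq.
by set t := (2 * q) ^+ k; field; exact: lt0r_neq0.
Qed.

Lemma pow_taylor (R : realType) (w h : R[i]) (q : R) (k : nat) :
  0 < q -> modulus w <= q -> modulus (w + h) <= q ->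
  modulus ((w + h) ^+ k - (w ^+ k + pow1 w k * h + pow2 w k * h ^+ 2))
    <= (2 * q) ^+ k / q ^+ 3 * modulus h ^+ 3.
Proof.
move=> q0 wq whq; elim: k => [|k IH] /=.
  rewrite !expr0 !mul0r !addr0 subrr modulus0.
  by rewrite mulr_ge0 ?exprn_ge0 ?modulus_ge0// divr_ge0// exprn_ge0// ltW.
rewrite (_ : _ - _ = (w + h) * ((w + h) ^+ k - (w ^+ k + pow1 w k * h + pow2 w k * h ^+ 2)) +
    pow2 w k * h ^+ 3); last by rewrite !exprS expr0; ring.
apply: le_trans (modulusD _ _) _; rewrite modulusM (modulusM (pow2 w k)) modulusX.
have h1 : modulus (w + h) * modulus ((w + h) ^+ k - (w ^+ k + pow1 w k * h + pow2 w k * h ^+ 2))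
    <= q * ((2 * q) ^+ k / q ^+ 3 * modulus h ^+ 3).
  by apply: ler_pM => //; exact: modulus_ge0.
have h2 : modulus (pow2 w k) * modulus h ^+ 3 <= (2 * q) ^+ k / q ^+ 2 * modulus h ^+ 3.
  by apply: ler_wpM2r; [rewrite exprn_ge0// modulus_ge0|exact: pow2_bound].
apply: le_trans (lerD h1 h2) _.
rewrite (exprS (2 * q)); apply: le_of_eq.
by set t := (2 * q) ^+ k; field; exact: lt0r_neq0.
Qed.

(** Once the linear power is subtracted, each difference of powers carries a factor s besides w1 -
    w2. Summed against the coefficients this shows that a power series is nearly linear on small
    discs. *)
Lemma pow_diff (R : realType) (w1 w2 : R[i]) (s q : R) (k : nat) :
  0 < q -> modulus w1 <= s -> modulus w2 <= s -> s <= q ->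
  modulus (w1 ^+ k - w2 ^+ k - (k == 1%N)%:R * (w1 - w2)) <=
    s * (2 * q) ^+ k / q ^+ 2 * modulus (w1 - w2).
Proof.
move=> q0 w1s w2s sq.
have s0 : 0 <= s by apply: le_trans (modulus_ge0 w1) w1s.
have pos (n : nat) : 0 <= s * (2 * q) ^+ n / q ^+ 2 * modulus (w1 - w2).
  rewrite mulr_ge0 ?modulus_ge0// divr_ge0 ?sqr_ge0// mulr_ge0// exprn_ge0//.
  by rewrite mulr_ge0// ltW.
have m0 := modulus_ge0 (w1 - w2).
case: k => [|[|k]].
- by have := pos 0%N; rewrite /= mul0r subr0 (expr0 w1) (expr0 w2) subrr modulus0.
- by have := pos 1%N; rewrite /= mul1r (expr1 w1) (expr1 w2) subrr modulus0.
rewrite /= mul0r subr0; elim: k => [|k IH].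
  rewrite subr_sqr mulrC modulusM; apply: ler_wpM2r => //.
  apply: le_trans (modulusD _ _) _.
  have -> : s * (2 * q) ^+ 2 / q ^+ 2 = 4 * s by field; exact: lt0r_neq0.
  lra.
rewrite (exprS w1) (exprS w2).
have -> : w1 * w1 ^+ k.+2 - w2 * w2 ^+ k.+2 =
    w1 * (w1 ^+ k.+2 - w2 ^+ k.+2) + w2 * w2 ^+ k.+1 * (w1 - w2).
  by rewrite (exprS w2 k.+1); ring.
apply: le_trans (modulusD _ _) _; rewrite !modulusM modulusX.
have h1 : modulus w1 * modulus (w1 ^+ k.+2 - w2 ^+ k.+2) <=
    q * (s * (2 * q) ^+ k.+2 / q ^+ 2 * modulus (w1 - w2)).
  by apply: ler_pM => //; rewrite ?modulus_ge0//; exact: le_trans sq.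
have h2 : modulus w2 * modulus w2 ^+ k.+1 * modulus (w1 - w2) <=
    s * (2 * q) ^+ k.+1 * modulus (w1 - w2).
  apply: ler_wpM2r => //; apply: ler_pM; rewrite ?exprn_ge0 ?modulus_ge0//.
  apply: le_trans (double_pow k.+1 (ltW q0)).
  by apply: lerXn2r; rewrite ?nnegrE ?modulus_ge0 ?(ltW q0)//; exact: le_trans sq.
apply: le_trans (lerD h1 h2) _.
have h3 : s * (2 * q) ^+ k.+1 * modulus (w1 - w2) <= 2 * (s * (2 * q) ^+ k.+1 * modulus (w1 - w2)).
  rewrite [leRHS]mulr_natl mulr2n lerDl mulr_ge0// mulr_ge0// exprn_ge0//.
  by rewrite mulr_ge0// ltW.
apply: le_trans (lerD (lexx _) h3) _; rewrite (exprS _ k.+2) (exprS _ k.+1).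
apply: le_of_eq.
by set t := (2 * q) ^+ k; field; exact: lt0r_neq0.
Qed.

Lemma power_series_chart (R : realType) (e : nat -> R[i]) (rho C : R) :
  0 < rho -> (forall k, modulus (e k) * rho ^+ k <= C) ->
  exists Gam : R[i] -> R[i], exists q K : R, [/\ 0 < q, 0 <= K,
    forall w, modulus w <= q -> clim (fun n => \sum_(0 <= k < n) e k * w ^+ k) (Gam w),
    forall w, modulus w < q -> exists a b, taylor2 (fun h => Gam (w + h)) (Gam w) a b &
    forall (s : R) w1 w2, s <= q -> modulus w1 <= s -> modulus w2 <= s ->
      modulus (Gam w1 - Gam w2 - e 1%N * (w1 - w2)) <= K * s * modulus (w1 - w2)].
Proof.
(* The estimates for powers are in terms of (2 q)^k = rho^k / 2^k, so the coefficient bound leaves a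
   geometric series of ratio 1 / 2. *)
move=> rho0 eC; pose q := rho / 4; have q0 : 0 < q by rewrite divr_gt0.
have C0 : 0 <= C.
  by apply: le_trans (eC 0%N); rewrite expr0 mulr1 modulus_ge0.
have e2q k : modulus (e k) * (2 * q) ^+ k <= C * (1 / 2) ^+ k.
  have -> : 2 * q = rho * (1 / 2) by rewrite /q; field.
  by rewrite exprMn mulrA; apply: ler_wpM2r; rewrite ?exprn_ge0 ?divr_ge0.
have ebnd (D : R) (t : R[i]) k : 0 <= D -> modulus t <= (2 * q) ^+ k * D ->
    modulus (e k * t) <= C * D * (1 / 2) ^+ k.
  move=> D0 tD; rewrite modulusM; apply: le_trans (ler_wpM2l (modulus_ge0 _) tD) _.
  by rewrite mulrA [leRHS]mulrAC; apply: ler_wpM2r.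
have ex w : exists S, modulus w <= q -> clim (fun n => \sum_(0 <= k < n) e k * w ^+ k) S.
  have [wq|wq] := boolP (modulus w <= q); last by exists 0.
  have [|S hS] := @csum_exists _ (fun k => e k * w ^+ k) (C * 1); last by exists S.
  move=> k; apply: ebnd => //; rewrite mulr1 modulusX.
  apply: le_trans (double_pow k (ltW q0)).
  by apply: lerXn2r; rewrite ?nnegrE ?modulus_ge0// ltW.
have [Gam hG] := choice ex.
have iq n : 0 <= 1 / q ^+ n by rewrite divr_ge0// exprn_ge0// ltW.
exists Gam, q, (2 * C / q ^+ 2); split=> //.
- by rewrite divr_ge0 ?sqr_ge0// mulr_ge0.
- move=> w wq; have wq' := ltW wq.
  have [|a ha] := @csum_exists _ (fun k => e k * pow1 w k) (C * (1 / q ^+ 1)).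
    move=> k; apply: ebnd => //; rewrite expr1 mul1r; exact: pow1_bound.
  have [|b hb] := @csum_exists _ (fun k => e k * pow2 w k) (C * (1 / q ^+ 2)).
    move=> k; apply: ebnd => //; rewrite mul1r; exact: pow2_bound.
  exists a, b, (2 * (C * (1 / q ^+ 3))), (q - modulus w); split.
  + by apply: mulr_ge0 => //; apply: mulr_ge0.
  + by rewrite subr_gt0.
  move=> h hq; have whq : modulus (w + h) <= q.
    by apply: le_trans (modulusD _ _) _; lra.
  pose F n := \sum_(0 <= k < n) e k * ((w + h) ^+ k - (w ^+ k + pow1 w k * h + pow2 w k * h ^+ 2)).
  have cF : clim F (Gam (w + h) - (Gam w + a * h + b * h ^+ 2)).
    have := climD (hG _ whq) (climZ (-1) (climD (climD (hG _ wq') (climZ h ha)) (climZ (h ^+ 2) hb))).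
    rewrite mulN1r (mulrC h) (mulrC (h ^+ 2) b); apply: eq_clim => n.
    rewrite /F mulN1r !mulr_sumr -!big_split /= -sumrB; apply: eq_bigr => k _; ring.
  apply: (clim_le (N := 0)) cF => n _.
  have -> : 2 * (C * (1 / q ^+ 3)) * modulus h ^+ 3 =
    2 * (C * (1 / q ^+ 3 * modulus h ^+ 3)) by ring.
  apply: modulus_sum_le => k; apply: ebnd.
    by rewrite mulr_ge0// exprn_ge0// modulus_ge0.
  apply: le_trans (pow_taylor k q0 wq' whq) _.
  by rewrite mul1r [leRHS]mulrA.
- move=> s w1 w2 sq w1s w2s.
  have s0 : 0 <= s by apply: le_trans w1s; exact: modulus_ge0.
  pose f k := e k * (w1 ^+ k - w2 ^+ k - (k == 1%N)%:R * (w1 - w2)).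
  pose F n := \sum_(0 <= k < n) f k.
  have d1 n : (2 <= n)%N -> \sum_(0 <= k < n) e k * (k == 1%N)%:R = e 1%N.
    case: n => [|[|n]]// _; elim: n => [|n IH].
      by rewrite !big_nat_recr//= big_geq// mulr0 mulr1 !add0r.
    by rewrite big_nat_recr//= IH mulr0 addr0.
  have h1 := hG w1 (le_trans w1s sq); have h2 := hG w2 (le_trans w2s sq).
  have cD := climD h1 (climZ (-1) h2).
  have cE : clim (fun n => F n + e 1%N * (w1 - w2)) (Gam w1 - Gam w2).
    move=> ep ep0; have [N hN] := cD ep ep0; exists (maxn N 2) => n.
    rewrite geq_max => /andP[/hN + n2]; rewrite !mulN1r; congr (modulus (_ - _) <= _).
    rewrite -(d1 n n2) mulr_suml /F -big_split /= -sumrB; apply: eq_bigr => k _.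
    by rewrite /f; ring.
  have cF : clim F (Gam w1 - Gam w2 - e 1%N * (w1 - w2)).
    move=> ep ep0; have [N hN] := cE ep ep0; exists N => n /hN.
    by congr (modulus _ <= _); ring.
  apply: (clim_le (N := 0)) cF => n _.
  have -> : 2 * C / q ^+ 2 * s * modulus (w1 - w2) =
    2 * (C * (s / q ^+ 2 * modulus (w1 - w2))) by ring.
  apply: modulus_sum_le => k; apply: ebnd.
    by rewrite mulr_ge0 ?modulus_ge0// divr_ge0 ?sqr_ge0.
  apply: le_trans (pow_diff k q0 w1s w2s sq) _.
  by apply: le_of_eq; ring.
Qed.

Lemma pseries_coef_bound (R : realType) (c : R^nat) (r l : R) :
  pseries c r @ \oo --> l -> exists C, forall k, `|c k| * `|r| ^+ k <= C.
Proof.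
move=> h; have : cvgn (pseries c r) by apply/cvg_ex; exists l.
move=> /cvg_series_bounded/pinfty_ex_gt0[M M0 /= hM].
by exists M => k; have := hM k I; rewrite normrM normrX.
Qed.

Lemma derive1_of_quadratic (R : realType) (f : R -> R) (s0 l K d : R) :
  0 < d -> 0 <= K -> (forall t, `|t| < d -> `|f (s0 + t) - f s0 - l * t| <= K * t ^+ 2) ->
  derive1 f s0 = l.
Proof.
move=> d0 K0 hf; apply: cvg_lim => //; apply/cvgrPdist_le => e e0.
have K10 : 0 < K + 1 by rewrite ltr_wpDl.
near=> h.
have h0 : h != 0 by near: h; exact: nbhs_dnbhs_neq.
have hd : `|h| < Num.min d (e / (K + 1)).
  near: h; apply: dnbhs0_lt; rewrite lt_min d0 divr_gt0//.
move: hd; rewrite lt_min => /andP[/hf hK he].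
rewrite ltr_pdivlMr// in he.
have -> : l - h^-1 *: (f (h + s0) - f s0) = - (h^-1 * (f (s0 + h) - f s0 - l * h)).
  by rewrite (addrC h) /GRing.scale /=; field.
rewrite normrN normrM normfV mulrC ler_pdivrMr ?normr_gt0//.
apply: le_trans hK _; rewrite -(real_normK (num_real h)) expr2 mulrA.
apply: ler_wpM2r => //; apply: le_trans (ltW he); rewrite mulrC ler_wpM2l//.
by rewrite lerDl.
Unshelve. all: by end_near. Qed.

Lemma taylor2_deriv_unique (R : realType) (f : R[i] -> R[i]) (A a b e : R[i]) (K d : R) :
  taylor2 f A a b -> 0 < d -> 0 <= K ->
  (forall t : R, `|t| < d -> modulus (f t%:C - A - e * t%:C) <= K * t ^+ 2) -> a = e.
Proof.
move=> [M [d1 [M0 d10 hf]]] d0 K0 he.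
apply/eqP; rewrite -subr_eq0; apply/eqP/modulus0_eq0/eqP.
rewrite eq_le modulus_ge0 andbT; apply/ler_addgt0Pr => ep ep0; rewrite add0r.
pose S := K + M + modulus b.
have S0 : 0 <= S by rewrite !addr_ge0 ?modulus_ge0.
pose t := Num.min (Num.min 1 (d / 2)) (Num.min (d1 / 2) (ep / (S + 1))).
have S10 : 0 < S + 1 by rewrite ltr_wpDl.
have t0 : 0 < t by rewrite /t !lt_min ltr01 !divr_gt0.
have [t1 td td1 te] : [/\ t <= 1, t <= d / 2, t <= d1 / 2 & t <= ep / (S + 1)].
  by split; rewrite /t !ge_min lexx ?orbT.
have mt : modulus t%:C = t by rewrite modulus_real gtr0_norm.
have h1 : modulus (f t%:C - (A + a * t%:C + b * t%:C ^+ 2)) <= M * t ^+ 3.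
  by have := hf t%:C; rewrite mt => h; apply: h; clear -td1 d10; lra.
have h2 : modulus (f t%:C - A - e * t%:C) <= K * t ^+ 2.
  by apply: he; rewrite gtr0_norm//; clear -td d0; lra.
have e1 : modulus ((a - e) * t%:C) <= S * t ^+ 2.
  have -> : (a - e) * t%:C = (f t%:C - A - e * t%:C) -
      (f t%:C - (A + a * t%:C + b * t%:C ^+ 2)) - b * t%:C ^+ 2 by ring.
  apply: le_trans (modulusB _ _) _; apply: le_trans (lerD (modulusB _ _) (lexx _)) _.
  rewrite (modulusM b) modulusX mt /S !mulrDl; apply: lerD => //; apply: lerD => //.
  apply: le_trans h1 _; apply: ler_wpM2l => //.
  by rewrite exprS ler_piMl// sqr_ge0.
move: e1; rewrite modulusM mt expr2 mulrA ler_pM2r// => e1; apply: le_trans e1 _.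
rewrite ler_pdivlMr// in te; apply: le_trans _ te.
by rewrite mulrC; apply: ler_wpM2l; [exact: ltW|rewrite lerDl].
Qed.

(** The real series of the two coordinates are combined into one series with coefficients c k + i d
    k, summed at complex arguments. The last property, a deviation from a linear map of at most half
    its size, replaces the inverse function theorem: it gives injectivity at once and openness in
    [chart_open]. *)
Lemma analytic_chart (R : realType) (gamma : R -> R[i]) (s0 : R) :
  real_analytic_at (@complex.Re R \o gamma) s0 ->
  real_analytic_at (@complex.Im R \o gamma) s0 ->
  curve_derive gamma s0 != 0 ->
  exists Gam : R[i] -> R[i], exists2 X : R, 0 < X & [/\
    forall t : R, `|t| < X -> Gam t%:C = gamma (s0 + t),
    forall w, modulus w < X -> exists a b, taylor2 (fun h => Gam (w + h)) (Gam w) a b,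
    exists b, taylor2 Gam (gamma s0) (curve_derive gamma s0) b &
    forall w1 w2, modulus w1 < X -> modulus w2 < X ->
      modulus (Gam w1 - Gam w2 - curve_derive gamma s0 * (w1 - w2)) <=
      modulus (curve_derive gamma s0) / 2 * modulus (w1 - w2)].
Proof.
move=> [c [r1 [r10 hc]]] [d [r2 [r20 hd]]] cd0.
pose rho := Num.min r1 r2 / 2; have rho0 : 0 < rho by rewrite divr_gt0// lt_min r10.
have rr : rho < Num.min r1 r2.
  by rewrite /rho; have : 0 < Num.min r1 r2 by [rewrite lt_min r10]; lra.
move: (rr); rewrite lt_min => /andP[rr1 rr2].
have s0r : s0 + rho - s0 = rho by ring.
have rhon : `|rho| = rho by rewrite gtr0_norm.
have [C1 hC1] : exists C, forall k, `|c k| * rho ^+ k <= C.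
  by rewrite -{1}rhon; apply: (@pseries_coef_bound _ _ rho); rewrite -{1}s0r; apply: hc; rewrite s0r rhon.
have [C2 hC2] : exists C, forall k, `|d k| * rho ^+ k <= C.
  by rewrite -{1}rhon; apply: (@pseries_coef_bound _ _ rho); rewrite -{1}s0r; apply: hd; rewrite s0r rhon.
pose e k := c k +i* d k.
have eC k : modulus (e k) * rho ^+ k <= C1 + C2.
  apply: le_trans (lerD (hC1 k) (hC2 k)); rewrite -mulrDl; apply: ler_wpM2r.
    by rewrite exprn_ge0// ltW.
  exact: modulus_le_ReIm.
have [Gam [q [K [q0 K0 hG hT hD]]]] := power_series_chart rho0 eC.
have real_t (t : R) : `|t| <= q -> `|t| < r1 -> `|t| < r2 -> Gam t%:C = gamma (s0 + t).
  move=> tq t1 t2; apply: (clim_unique (hG _ _)); first by rewrite modulus_real.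
  have st : s0 + t - s0 = t by ring.
  have := hc (s0 + t); rewrite st => /(_ t1) c1.
  have := hd (s0 + t); rewrite st => /(_ t2) d1.
  have -> : gamma (s0 + t) = complex.Re (gamma (s0 + t)) +i* complex.Im (gamma (s0 + t)).
    by case: (gamma _).
  have eX k : e k * t%:C ^+ k = (c k * t ^+ k) +i* (d k * t ^+ k).
    have -> : t%:C ^+ k = (t ^+ k)%:C by rewrite rmorphXn.
    by rewrite /e /real_complex_def; simpc.
  apply: clim_ReIm.
    rewrite (_ : (fun n => _) = pseries c t)//; apply/funext => n.
    by rewrite Re_sum; apply: eq_bigr => k _; rewrite eX.
  rewrite (_ : (fun n => _) = pseries d t)//; apply/funext => n.
  by rewrite Im_sum; apply: eq_bigr => k _; rewrite eX.
pose dl := Num.min q (Num.min r1 r2).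
have dl0 : 0 < dl by rewrite !lt_min q0 r10.
have real_d (t : R) : `|t| < dl -> Gam t%:C = gamma (s0 + t).
  by rewrite !lt_min => /and3P[/ltW ? ? ?]; exact: real_t.
have G0 : Gam 0 = gamma s0 by have := real_d 0; rewrite normr0 addr0 => ->.
have quad (t : R) : `|t| < dl -> modulus (gamma (s0 + t) - gamma s0 - e 1%N * t%:C) <= K * t ^+ 2.
  move=> tdl; have tq : `|t| <= q by move: tdl; rewrite lt_min => /andP[/ltW].
  have := hD `|t| t%:C 0 tq; rewrite modulus_real modulus0 => /(_ (lexx _) (normr_ge0 _)).
  by rewrite subr0 modulus_real -mulrA -expr2 real_normK ?num_real// G0 real_d.
have cdE : curve_derive gamma s0 = e 1%N.
  rewrite /curve_derive /e; congr (_ +i* _).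
    apply: (derive1_of_quadratic dl0 K0) => t /quad h; apply: le_trans h.
    apply: le_trans (Re_le_modulus _); rewrite !(ReD, ReN) /=; apply: le_of_eq.
    by congr `|_|; ring.
  apply: (derive1_of_quadratic dl0 K0) => t /quad h; apply: le_trans h.
  apply: le_trans (Im_le_modulus _); rewrite !(ImD, ImN) /=; apply: le_of_eq.
  by congr `|_|; ring.
have cdm : 0 < modulus (curve_derive gamma s0) by rewrite modulus_gt0.
have K10 : 0 < K + 1 by rewrite ltr_wpDl.
(* This makes K X at most half of the modulus of the derivative. *)
pose X := Num.min dl (modulus (curve_derive gamma s0) / (2 * (K + 1))).
have X0 : 0 < X by rewrite lt_min dl0 divr_gt0// mulr_gt0.
have Xdl : X <= dl by rewrite /X ge_min lexx.
have Xq : X <= q by apply: le_trans Xdl _; rewrite /dl ge_min lexx.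
exists Gam, X => //; split.
- by move=> t tX; apply: real_d; exact: lt_le_trans Xdl.
- by move=> w wX; apply: hT; exact: lt_le_trans Xq.
- have [|a [b hab]] := hT 0; first by rewrite modulus0.
  have {}hab : taylor2 Gam (gamma s0) a b.
    by move: hab; rewrite G0; congr taylor2; apply/funext => h; rewrite add0r.
  exists b; suff <- : a = curve_derive gamma s0 by [].
  rewrite cdE; apply: (taylor2_deriv_unique hab dl0 K0) => t tdl.
  by rewrite real_d//; exact: quad.
- move=> w1 w2 w1X w2X; rewrite cdE.
  apply: le_trans (hD X w1 w2 Xq (ltW w1X) (ltW w2X)) _.
  apply: ler_wpM2r; first exact: modulus_ge0.
  have : X <= modulus (curve_derive gamma s0) / (2 * (K + 1)) by rewrite /X ge_min lexx orbT.
  rewrite -cdE ler_pdivlMr ?mulr_gt0// => h.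
  by move: h X0; clear -K0; lra.
Qed.

(** * Geometry of the arc *)

Lemma segment_pos_min (R : realType) (phi : R -> R) (a b : R) :
  a <= b ->
  (forall s : R, a <= s -> s <= b -> forall e : R, 0 < e -> exists2 d, 0 < d &
     forall s' : R, `|s' - s| < d -> `|phi s' - phi s| < e) ->
  (forall s : R, a <= s -> s <= b -> 0 < phi s) ->
  exists2 m : R, 0 < m & forall s : R, a <= s -> s <= b -> m <= phi s.
Proof.
move=> ab cphi phi0.
have cw : {within `[a, b], continuous phi}.
  apply: continuous_in_subspaceT => s; rewrite inE /= in_itv /= => /andP[h1 h2].
  apply/cvgrPdist_lt => e /(cphi s h1 h2)[d d0 hd].
  by apply/nbhs_ballP; exists d => //= t st; rewrite distrC; apply: hd; rewrite distrC.
have [c cab m] := EVT_min ab cw.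
move: cab; rewrite in_itv /= => /andP[h1 h2].
exists (phi c); first exact: phi0.
by move=> s s1 s2; apply: m; rewrite in_itv /= s1.
Qed.

Lemma arc_continuous (R : realType) (K : set R[i]) (a b : R) (gamma : R -> R[i]) (s : R) :
  analytic_arc_param K a b gamma -> a <= s -> s <= b ->
  forall e : R, 0 < e -> exists2 d : R, 0 < d &
    forall s' : R, `|s' - s| < d -> modulus (gamma s' - gamma s) < e.
Proof.
move=> [_ an dn _ _] as_ sb e e0.
have sab : s \in `[a, b] by rewrite in_itv /= as_.
have [aR aI] := an s sab.
have [Gam [X X0 [hr _ [c hT] _]]] := analytic_chart aR aI (dn s sab).
have [L [d [L0 d0 hL]]] := taylor2_lipschitz hT.
have L10 : 0 < L + 1 by rewrite ltr_wpDl.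
exists (Num.min X (Num.min d (e / (L + 1)))); first by rewrite !lt_min X0 d0 divr_gt0.
move=> s'; rewrite !lt_min => /and3P[h1 h2 h3].
have := hr _ h1; rewrite (addrC s) subrK => <-.
have := hL (s' - s)%:C; rewrite modulus_real => /(_ h2) h.
apply: le_lt_trans h _; rewrite ltr_pdivlMr// in h3.
apply: le_lt_trans h3; rewrite mulrC; apply: ler_wpM2l => //.
by rewrite lerDl.
Qed.

Lemma arc_closed (R : realType) (K : set R[i]) (a b : R) (gamma : R -> R[i]) (z : R[i]) :
  analytic_arc_param K a b gamma -> ~ K z ->
  exists2 r : R, 0 < r & forall k, modulus k < r -> ~ K (z + k).
Proof.
move=> hK Kz; have [ab _ _ _ KE] := hK.
have [||m m0 hm] := @segment_pos_min R (fun s => modulus (gamma s - z)) a b (ltW ab).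
- move=> s h1 h2 e e0; have [d d0 hd] := arc_continuous hK h1 h2 e0.
  exists d => // s' /hd h; apply: le_lt_trans (modulus_lipschitz _ _) _.
  by rewrite (_ : _ - _ = gamma s' - gamma s)//; ring.
- move=> s h1 h2; rewrite modulus_gt0 subr_eq0; apply/eqP => gz; apply: Kz.
  by rewrite KE; exists s => //=; rewrite in_itv /= h1.
exists m => // k km; rewrite KE => -[s /= + gs]; rewrite in_itv /= => /andP[h1 h2].
have := hm s h1 h2; rewrite gs (addrC z) addrK; lra.
Qed.

Lemma arc_bounded (R : realType) (K : set R[i]) (a b : R) (gamma : R -> R[i]) :
  analytic_arc_param K a b gamma -> exists L : R, forall z, K z -> modulus z <= L.
Proof.
move=> hK; have [ab _ _ _ KE] := hK.
have cw : {within `[a, b], continuous (fun s => modulus (gamma s))}.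
  apply: continuous_in_subspaceT => s; rewrite inE /= in_itv /= => /andP[h1 h2].
  apply/cvgrPdist_lt => e e0; have [d d0 hd] := arc_continuous hK h1 h2 e0.
  apply/nbhs_ballP; exists d => //= t st.
  apply: le_lt_trans (modulus_lipschitz _ _) _; rewrite modulus_distC.
  by apply: hd; rewrite distrC.
have [c _ m] := EVT_max (ltW ab) cw.
by exists (modulus (gamma c)) => z; rewrite KE => -[s sab <-]; exact: m.
Qed.

(** This is continuity of the inverse of gamma, by compactness of the parameter interval. The added
    term [max 0 (dl - |t - s|)] makes phi positive at s itself and disappears for parameters at
    distance dl or more. *)
Lemma arc_separated (R : realType) (K : set R[i]) (a b : R) (gamma : R -> R[i]) (s dl : R) :
  analytic_arc_param K a b gamma -> a <= s -> s <= b -> 0 < dl ->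
  exists2 d : R, 0 < d & forall s' : R, a <= s' -> s' <= b ->
    modulus (gamma s' - gamma s) < d -> `|s' - s| < dl.
Proof.
move=> hK as_ sb dl0; have [ab _ _ inj KE] := hK.
pose phi t := modulus (gamma t - gamma s) + Num.max 0 (dl - `|t - s|).
have [||m m0 hm] := @segment_pos_min R phi a b (ltW ab).
- move=> t h1 h2 e e0; have e20 : 0 < e / 2 by rewrite divr_gt0.
  have [d d0 hd] := arc_continuous hK h1 h2 e20.
  exists (Num.min d (e / 2)) => [|t']; first by rewrite lt_min d0.
  rewrite lt_min => /andP[/hd h3 h4].
  have p1 : `|modulus (gamma t' - gamma s) - modulus (gamma t - gamma s)| < e / 2.
    apply: le_lt_trans (modulus_lipschitz _ _) _.
    by rewrite (_ : _ - _ = gamma t' - gamma t)//; ring.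
  have p2 : `|Num.max 0 (dl - `|t' - s|) - Num.max 0 (dl - `|t - s|)| < e / 2.
    have q1 : `|t' - s| <= `|t' - t| + `|t - s|.
      exact: ler_distD.
    have q2 : `|t - s| <= `|t' - t| + `|t' - s|.
      by rewrite (distrC t'); exact: ler_distD.
    move: h4 q1 q2.
    set A := `|t' - t|; set B := `|t' - s|; set D := `|t - s| => h4 q1 q2.
    by case: (leP 0 (dl - B)) => c1; case: (leP 0 (dl - D)) => c2;
      rewrite ltr_norml; apply/andP; split; clear -h4 q1 q2 c1 c2 e0; lra.
  rewrite /phi opprD addrACA; apply: le_lt_trans (ler_normD _ _) _.
  by rewrite [ltRHS]splitr; exact: ltrD.
- move=> t h1 h2; rewrite /phi; have [->|ts] := eqVneq t s.
    by rewrite !subrr modulus0 normr0 subr0 add0r lt_max dl0 orbT.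
  apply: ltr_wpDr; first by rewrite le_max lexx.
  rewrite modulus_gt0 subr_eq0; apply: contra ts => /eqP gts; apply/eqP.
  by apply: inj => //; rewrite in_itv /= ?h1 ?as_.
exists m => // s' h1 h2 hs; rewrite ltNge; apply/negP => hdl.
have := hm s' h1 h2; rewrite /phi max_l ?subr_le0// addr0; lra.
Qed.

(** For the last property: a point of K close to gamma s0 has its parameter close to s0 by
    [arc_separated], hence is the image of a real point of the chart, and injectivity excludes a
    second, nonreal preimage. *)
Lemma arc_chart (R : realType) (K : set R[i]) (a b : R) (gamma : R -> R[i]) (s0 : R) :
  analytic_arc_param K a b gamma -> a <= s0 -> s0 <= b ->
  exists Gam : R[i] -> R[i], exists2 X : R, 0 < X & [/\
    forall t : R, `|t| < X -> Gam t%:C = gamma (s0 + t),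
    forall w, modulus w < X -> exists a b, taylor2 (fun h => Gam (w + h)) (Gam w) a b,
    exists b, taylor2 Gam (gamma s0) (curve_derive gamma s0) b,
    forall w1 w2, modulus w1 < X -> modulus w2 < X ->
      modulus (Gam w1 - Gam w2 - curve_derive gamma s0 * (w1 - w2)) <=
      modulus (curve_derive gamma s0) / 2 * modulus (w1 - w2) &
    forall w, modulus w < X -> complex.Im w != 0 -> ~ K (Gam w)].
Proof.
move=> hK as0 s0b; have [ab an dn inj KE] := hK.
have sab : s0 \in `[a, b] by rewrite in_itv /= as0.
have [aR aI] := an s0 sab.
have [Gam [X X0 [hr hT hT0 hD]]] := analytic_chart aR aI (dn s0 sab).
have [d d0 hd] := arc_separated hK as0 s0b X0.
set e1 := curve_derive gamma s0 in hT0 hD *.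
have m0 : 0 < modulus e1 by rewrite modulus_gt0 /e1 dn.
have G0 : Gam 0 = gamma s0 by have := hr 0; rewrite normr0 addr0 => ->.
pose Y := Num.min X (d / (2 * modulus e1)).
have Y0 : 0 < Y by rewrite lt_min X0 divr_gt0// mulr_gt0.
have YX : Y <= X by rewrite /Y ge_min lexx.
exists Gam, Y => //; split.
- by move=> t /lt_le_trans-/(_ _ YX); exact: hr.
- by move=> w /lt_le_trans-/(_ _ YX); exact: hT.
- by [].
- by move=> w1 w2 /lt_le_trans-/(_ _ YX) h1 /lt_le_trans-/(_ _ YX) h2; exact: hD.
move=> w; rewrite lt_min => /andP[wX wd] Iw; rewrite KE => -[s' /= + gs].
rewrite in_itv /= => /andP[h1 h2].
have m00 : modulus (0 : R[i]) < X by rewrite modulus0.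
have s'X : `|s' - s0| < X.
  apply: hd => //; rewrite gs -G0; have := hD w 0 wX m00.
  rewrite subr0 => h; rewrite ltr_pdivlMr ?mulr_gt0// in wd.
  have := modulusD (Gam w - Gam 0 - e1 * w) (e1 * w); rewrite subrK modulusM.
  have p0 := mulr_ge0 (ltW m0) (modulus_ge0 w).
  move: h wd p0; clear; lra.
have gs' : Gam (s' - s0)%:C = Gam w by rewrite hr// (addrC s0) subrK gs.
have sX : modulus (s' - s0)%:C < X by rewrite modulus_real.
have := hD w (s' - s0)%:C wX sX.
rewrite gs' subrr sub0r modulusN modulusM => h.
have : modulus (w - (s' - s0)%:C) = 0.
  apply/eqP; rewrite eq_le modulus_ge0 andbT -(ler_pM2l m0) mulr0; move: h; clear; lra.
move=> /modulus0_eq0/eqP; rewrite subr_eq0 => /eqP ww.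
by move: Iw; rewrite ww /= eqxx.
Qed.

(** Take w minimising |Gam w - z| over a small box. If the residual v = Gam w - z were nonzero, the
    Newton step w - v / e1 would at least halve it. *)
Lemma chart_open (R : realType) (Gam : R[i] -> R[i]) (e1 : R[i]) (X ep : R) :
  e1 != 0 -> 0 < X ->
  (forall w, modulus w < X -> exists a b, taylor2 (fun h => Gam (w + h)) (Gam w) a b) ->
  (forall w1 w2, modulus w1 < X -> modulus w2 < X ->
      modulus (Gam w1 - Gam w2 - e1 * (w1 - w2)) <= modulus e1 / 2 * modulus (w1 - w2)) ->
  0 < ep -> exists2 d : R, 0 < d & forall z, modulus (z - Gam 0) < d ->
    exists w, [/\ modulus w < ep, modulus w < X & Gam w = z].
Proof.
move=> e10 X0 hT hD ep0.
have m0 : 0 < modulus e1 by rewrite modulus_gt0.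
pose c := Num.min X ep / 4.
have c0 : 0 < c by rewrite divr_gt0// lt_min X0.
have cX : 4 * c <= X by rewrite /c mulrC divfK// ge_min lexx.
have cep : 4 * c <= ep by rewrite /c mulrC divfK// ge_min lexx orbT.
have inc x y : - c <= x -> x <= c -> - c <= y -> y <= c -> modulus (x +i* y) < 4 * c.
  move=> h1 h2 h3 h4; apply: le_lt_trans (modulus_le_ReIm _) _ => /=.
  have a1 : `|x| <= c by rewrite ler_norml h1.
  have a2 : `|y| <= c by rewrite ler_norml h3.
  lra.
exists (c * modulus e1 / 8); first by rewrite divr_gt0// mulr_gt0.
move=> z zd.
have [||x y h1 h2 h3 h4|x [y [/andP[h1 h2] /andP[h3 h4] m]]] :=
  @box_max _ (fun x y => - modulus (Gam (x +i* y) - z)) (- c) c (- c) c.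
- by lra.
- by lra.
- have [a [b hab]] := hT _ (lt_le_trans (inc x y h1 h2 h3 h4) cX).
  by apply: cont2N; exact: modulus_cont2 hab.
set w := x +i* y in m.
have w4c : modulus w < 4 * c by exact: inc.
have wX : modulus w < X by exact: lt_le_trans cX.
exists w; split=> //; first exact: lt_le_trans cep.
apply/eqP; rewrite -subr_eq0; apply/negPn/negP => v0.
set v := Gam w - z in v0.
have vm : 0 < modulus v by rewrite modulus_gt0.
have m00 : modulus (0 : R[i]) < X by rewrite modulus0.
have v1 : modulus v <= modulus (z - Gam 0).
  have := m 0 0; rewrite -/v lerN2 (modulus_distC z); apply; lra.
(* The minimiser stays well inside the box because Gam w and Gam 0 are both close to z; the Newton
   step, of length at most c / 8, therefore does not leave the box. *)
have w1 : modulus w <= c / 2.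
  have := hD w 0 wX m00; rewrite subr0 => hw.
  have := modulusB (Gam w - Gam 0) (Gam w - Gam 0 - e1 * w); rewrite subKr modulusM => hh.
  have := modulusD v (z - Gam 0); rewrite /v addrA subrK -/v => h5.
  rewrite -(ler_pM2l m0); move: hw hh h5 v1 zd; clear; lra.
pose w' := w - v / e1.
have vc : modulus (v / e1) <= c / 8.
  rewrite modulusM modulusV ler_pdivrMr//; move: v1 zd; clear; lra.
have w'c : modulus w' <= c.
  apply: le_trans (modulusB _ _) _; move: w1 vc c0; clear; lra.
have w'X : modulus w' < X by apply: le_lt_trans w'c _; lra.
have := hD w' w w'X wX.
have -> : w' - w = - (v / e1) by rewrite /w'; ring.
have -> : Gam w' - Gam w - e1 * - (v / e1) = Gam w' - z.
  by rewrite /v; field.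
rewrite modulusN (modulusM v) modulusV => h.
have {}h : modulus (Gam w' - z) <= modulus v / 2.
  by apply: le_trans h _; apply: le_of_eq; field; exact: lt0r_neq0.
have [r1 r2] : `|complex.Re w'| <= c /\ `|complex.Im w'| <= c.
  by split; apply: le_trans w'c; [exact: Re_le_modulus|exact: Im_le_modulus].
move: r1 r2; rewrite !ler_norml => /andP[q1 q2] /andP[q3 q4].
have := m _ _ q1 q2 q3 q4; rewrite lerN2 -/v.
have -> : complex.Re w' +i* complex.Im w' = w' by case: (w').
move: h vm; clear; lra.
Qed.

(** * Green's function and the Bernstein-Walsh inequality *)

Lemma green_continuous (R : realType) (K : set R[i]) (g : R[i] -> R) (z : R[i]) :
  is_green_infty K g -> forall e : R, 0 < e -> exists2 d : R, 0 < d &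
    forall k, modulus k < d -> `|g (z + k) - g z| < e.
Proof.
move=> [hg _ g0 gK] e e0; have [Kz|Kz] := pselect (K z).
  have [d d0 hd] := within_modulus (g0 z Kz) e0.
  exists d => // k kd; rewrite (gK z Kz) subr0.
  by have [Kk|Kk] := pselect (K (z + k)); [rewrite gK// normr0|exact: hd].
by have [[cg _] _ _ _ _] := hg z Kz; exact: continuous_at_modulus.
Qed.

Lemma green_cont2 (R : realType) (K : set R[i]) (g : R[i] -> R) (x y : R) :
  is_green_infty K g -> cont2 (fun x y => g (x +i* y)) x y.
Proof. by move=> hg; apply/cont2_modulus => e e0; exact: (green_continuous _ hg). Qed.

Lemma green_jet (R : realType) (K : set R[i]) (a b : R) (gamma : R -> R[i])
    (g : R[i] -> R) (z : R[i]) :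
  analytic_arc_param K a b gamma -> is_green_infty K g -> ~ K z -> harm_jet g z.
Proof.
move=> hK [hg _ _ _] Kz; have [r r0 hr] := arc_closed hK Kz.
exact: harmonic_on_jet hg r0 hr.
Qed.

Lemma green_harm (R : realType) (K : set R[i]) (a b : R) (gamma : R -> R[i])
    (g : R[i] -> R) (x y : R) :
  analytic_arc_param K a b gamma -> is_green_infty K g -> ~ K (x +i* y) ->
  harm (fun x y => g (x +i* y)) x y.
Proof.
move=> hK hg Kz.
exact: (harm_jet_comp (F := id) (taylor2_id (x +i* y)) (green_jet hK hg Kz)).
Qed.

Lemma outer_max_principle (R : realType) (K : set R[i]) (v : R -> R -> R) (L : R) :
  (forall x y : R, cont2 v x y) ->
  (forall x y : R, ~ K (x +i* y) -> subharm v x y) ->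
  (forall x y : R, K (x +i* y) -> v x y <= 0) ->
  (forall x y : R, L <= modulus (x +i* y) -> v x y <= 0) ->
  forall x y : R, v x y <= 0.
Proof.
move=> cv sv vK vL x y.
pose T := `|L| + `|x| + `|y| + 1.
have [T1 T2 T3] : [/\ L < T, `|x| <= T & `|y| <= T].
  have := ler_norm L; have := normr_ge0 x; have := normr_ge0 y; have := normr_ge0 L.
  by rewrite /T; split; lra.
move: T2 T3; rewrite !ler_norml => /andP[x1 x2] /andP[y1 y2].
apply: (@max_principle _ v (- T) T (- T) T) => // x' y' h1 h2 h3 h4 v0.
have Kz : ~ K (x' +i* y') by move=> /vK; lra.
have zL : modulus (x' +i* y') < L.
  by rewrite ltNge; apply/negP => /vL; lra.
have := le_lt_trans (Re_le_modulus (x' +i* y')) (lt_trans zL T1).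
have := le_lt_trans (Im_le_modulus (x' +i* y')) (lt_trans zL T1).
rewrite /= !ltr_norml => ? ?; split=> //; exact: sv.
Qed.

Lemma green_growth (R : realType) (K : set R[i]) (g : R[i] -> R) :
  is_green_infty K g -> exists M : R, forall c : R, exists2 L : R, 1 <= L &
    forall z, L <= modulus z -> c <= ln (modulus z) /\ `|g z - ln (modulus z)| <= M.
Proof.
move=> [_ [M [r hM]] _ _]; exists M => c.
exists (Num.max 1 (Num.max (r + 1) (expR c))); first by rewrite le_max lexx.
move=> z; rewrite !ge_max => /and3P[h1 h2 h3]; split.
  by rewrite -[c]expRK ler_ln// ?posrE ?expR_gt0//; lra.
by apply: hM; lra.
Qed.

Lemma green_ge0 (R : realType) (K : set R[i]) (a b : R) (gamma : R -> R[i])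
    (g : R[i] -> R) (z : R[i]) :
  analytic_arc_param K a b gamma -> is_green_infty K g -> 0 <= g z.
Proof.
move=> hK hg; have [M hM] := green_growth hg; have [_ _ _ gK] := hg.
have [L L1 hL] := hM M.
case: z => x y; rewrite -oppr_le0.
apply: (@outer_max_principle _ K (fun x y => - g (x +i* y)) L) => {x y} x y.
- by apply: cont2N; exact: green_cont2 hg.
- by move=> Kz; apply: harm_sub; apply: harmN; exact: green_harm hK hg Kz.
- by move=> /gK ->; rewrite oppr0.
- by move=> /hL[]; set t := ln _ => h1; rewrite ler_norml => /andP[]; lra.
Qed.

(** The bounded discrepancy at infinity is absorbed by comparing g1 with (1 + eta) g2, which wins by
    eta ln |z|; then eta tends to 0 at the fixed point z. *)
Lemma green_le (R : realType) (K : set R[i]) (a b : R) (gamma : R -> R[i])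
    (g1 g2 : R[i] -> R) (z : R[i]) :
  analytic_arc_param K a b gamma -> is_green_infty K g1 -> is_green_infty K g2 ->
  g1 z <= g2 z.
Proof.
move=> hK hg1 hg2; have [M1 hM1] := green_growth hg1; have [M2 hM2] := green_growth hg2.
have [_ _ _ g1K] := hg1; have [_ _ _ g2K] := hg2.
have g20 := green_ge0 z hK hg2.
have main (eta : R) : 0 < eta -> g1 z - (1 + eta) * g2 z <= 0.
  (* When ln |z| >= c, the gain eta ln |z| exceeds both error bounds together. *)
  move=> eta0; pose c := (M1 + (1 + eta) * M2) / eta.
  have [L1 _ hL1] := hM1 c; have [L2 _ hL2] := hM2 c.
  case: {g20} z => x y.
  apply: (@outer_max_principle _ K (fun x y => g1 (x +i* y) - (1 + eta) * g2 (x +i* y)) (Num.max L1 L2)) => {x y} x y.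
  - apply: cont2B; first exact: green_cont2 hg1.
    by apply: cont2M; [exact: cont2_cst|exact: green_cont2 hg2].
  - move=> Kz; apply: harm_sub; apply: harmB; first exact: green_harm hK hg1 Kz.
    by apply: harmZ; exact: green_harm hK hg2 Kz.
  - by move=> Kz; rewrite g1K// g2K// mulr0 subrr.
  - rewrite ge_max => /andP[/hL1[h1 +] /hL2[_ +]].
    move: h1; set t := ln _; rewrite /c ler_pdivrMr// => h1.
    rewrite !ler_norml => /andP[a1 a2] /andP[a3 a4].
    have : (1 + eta) * (t - M2) <= (1 + eta) * g2 (x +i* y).
      by apply: ler_wpM2l; lra.
    move: h1 a2; clear; lra.
apply/ler_addgt0Pr => e e0.
have g21 : 0 < g2 z + 1 by rewrite ltr_wpDl.
have := main _ (divr_gt0 e0 g21).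
have : e / (g2 z + 1) * g2 z <= e.
  by rewrite mulrAC ler_pdivrMr//; apply: ler_wpM2l; [exact: ltW|rewrite lerDl].
lra.
Qed.

Lemma green_unique (R : realType) (K : set R[i]) (a b : R) (gamma : R -> R[i])
    (g1 g2 : R[i] -> R) :
  analytic_arc_param K a b gamma -> is_green_infty K g1 -> is_green_infty K g2 ->
  g1 = g2.
Proof.
move=> hK h1 h2; apply/funext => z; apply/eqP; rewrite eq_le.
by rewrite (green_le z hK h1 h2) (green_le z hK h2 h1).
Qed.

(** Since g tends to infinity, a function harmonic in the whole plane would satisfy g >= c for every
    c, by the maximum principle for c - g; the choice c = g 0 + 1 is absurd. *)
Lemma green_not_harmonic (R : realType) (K : set R[i]) (g : R[i] -> R) :
  is_green_infty K g -> ~ (forall x y : R, harm (fun x y => g (x +i* y)) x y).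
Proof.
move=> hg hh; have [M hM] := green_growth hg.
pose c := g 0 + 1; have [L _ hL] := hM (c + M).
have : c - g (0 +i* 0) <= 0.
  apply: (@outer_max_principle _ set0 (fun x y => c - g (x +i* y)) L) => // x y.
  - by apply: cont2B; [exact: cont2_cst|exact: green_cont2 hg].
  - move=> _; apply: harm_sub; apply: harmB => //.
    by move=> e e0; exists 1 => // h h0 _; rewrite (_ : lap4 _ _ _ _ = 0) ?normr0 ?mulr_ge0 ?sqr_ge0 ?ltW// /lap4; ring.
  - by move=> /hL[]; set t := ln _ => h1; rewrite ler_norml => /andP[]; lra.
by rewrite /c; lra.
Qed.

Lemma horner_growth (R : realType) (P : {poly R[i]}) (n : nat) : (size P <= n.+1)%N ->
  exists2 A : R, 1 <= A & forall z, 1 <= modulus z -> modulus P.[z] <= A * modulus z ^+ n.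
Proof.
move=> sP; exists (1 + \sum_(0 <= k < n.+1) modulus P`_k).
  by rewrite lerDl sumr_ge0// => k _; exact: modulus_ge0.
move=> z z1; rewrite (horner_coef_wide _ sP) -(big_mkord xpredT (fun i => P`_i * z ^+ i)).
apply: le_trans (modulus_sum _ _) _.
have z0 : 0 <= modulus z by exact: modulus_ge0.
rewrite mulrDl mul1r; apply: ler_wpDl; first by rewrite exprn_ge0.
rewrite mulr_suml; apply: ler_sum_nat => k /andP[_ kn].
rewrite modulusM modulusX; apply: ler_wpM2l; first exact: modulus_ge0.
by apply: ler_weXn2l.
Qed.

Lemma horner_cont2 (R : realType) (P : {poly R[i]}) (x y : R) :
  cont2 (fun x y => modulus P.[x +i* y]) x y.
Proof.
have [c hc] := taylor2_horner P (taylor2_id (x +i* y)).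
by have := modulus_cont2 (F := fun z => P.[z]) 0 hc; congr cont2;
  apply/funext => a; apply/funext => b; rewrite addr0.
Qed.

(** The function ln (max 1 (|P| / M)) is continuous across the zeros of P, subharmonic and zero on
    K, and grows like n ln |z| + O(1). It is compared with (1 + eta) n g, the factor again absorbing
    the bounded terms, and then eta tends to 0. *)
Lemma bernstein_walsh (R : realType) (K : set R[i]) (a b : R) (gamma : R -> R[i])
    (g : R[i] -> R) (P : {poly R[i]}) (n : nat) (M : R) (z : R[i]) :
  analytic_arc_param K a b gamma -> is_green_infty K g ->
  (0 < n)%N -> (size P <= n.+1)%N -> 0 < M ->
  (forall w, K w -> modulus P.[w] <= M) ->
  modulus P.[z] <= M * expR (n%:R * g z).
Proof.
move=> hK hg n0 sP M0 PK; have [_ _ _ gK] := hg.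
have g0 := green_ge0 z hK hg.
have nR : 0 < n%:R :> R by rewrite ltr0n.
pose lp x y := ln (Num.max 1 (modulus P.[x +i* y] / M)).
have main (eta : R) : 0 < eta ->
    ln (Num.max 1 (modulus P.[z] / M)) - (1 + eta) * n%:R * g z <= 0.
  move=> eta0; have [A A1 hA] := horner_growth sP.
  have [N hN] := green_growth hg.
  pose A' := Num.max 1 (A / M).
  pose c := (ln A' + (1 + eta) * n%:R * N) / (eta * n%:R).
  have [L L1 hL] := hN c.
  case: {g0} z => x y.
  apply: (@outer_max_principle _ K (fun x y => lp x y - (1 + eta) * n%:R * g (x +i* y)) L) => {x y} x y.
  - apply: cont2B; last by apply: cont2M; [exact: cont2_cst|exact: green_cont2 hg].
    apply: (@cont2_comp _ (fun x y => Num.max 1 (modulus P.[x +i* y] / M))); last first.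
      by apply: continuous_ln; rewrite lt_max ltr01.
    apply: (@cont2_comp _ (fun x y => modulus P.[x +i* y] / M) (Num.max 1)); last first.
      by apply: (@continuous_max R R (fun=> 1) id); [exact: cvg_cst|exact: cvg_id].
    by apply: cont2M; [exact: horner_cont2|exact: cont2_cst].
  - move=> Kz; apply: subharmD; last first.
      by apply: harm_sub; apply: harmN; apply: harmZ; exact: green_harm hK hg Kz.
    case: (leP (modulus P.[x +i* y] / M) 1) => hP.
      apply: subharm_min => x' y'; rewrite /lp (max_l hP) ln1.
      by apply: ln_ge0; rewrite le_max lexx.
    have P0 : 0 < modulus P.[x +i* y].
      by have := lt_trans ltr01 hP; rewrite pmulr_lgt0// invr_gt0.
    pose Q := (M^-1)%:C *: P.
    have QE w : modulus Q.[w] = modulus P.[w] / M.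
      by rewrite hornerZ modulusM modulus_real gtr0_norm ?invr_gt0// mulrC.
    apply: (@subharm_ge _ _ (fun x y => ln (modulus Q.[x +i* y]))).
    + apply: harm_sub; have [e he] := taylor2_horner Q (taylor2_id (x +i* y)).
      by apply: (ln_modulus_harm he); rewrite -modulus_gt0 QE divr_gt0.
    + by rewrite /lp (max_r (ltW hP)) QE.
    + exists 1 => // x' y' _ _; rewrite /lp -QE.
      have := modulus_ge0 Q.[x' +i* y']; rewrite le_eqVlt => /orP[/eqP <-|Q'0].
        by rewrite ln0// max_l// ln1.
      rewrite ler_ln ?posrE ?lt_max ?ltr01//.
      by rewrite le_max lexx orbT.
  - move=> Kz; rewrite (gK _ Kz) mulr0 subr0 /lp max_l ?ln1//.
    by rewrite ler_pdivrMr// mul1r PK.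
  - move=> zL; have [h1 h2] := hL _ zL.
    have z1 : 1 <= modulus (x +i* y) by exact: le_trans zL.
    have z0 : 0 < modulus (x +i* y) by lra.
    have zn1 : 1 <= modulus (x +i* y) ^+ n by exact: exprn_ege1.
    have A'1 : 1 <= A' by rewrite le_max lexx.
    have lpu : lp x y <= ln A' + n%:R * ln (modulus (x +i* y)).
      have -> : ln A' + n%:R * ln (modulus (x +i* y)) = ln (A' * modulus (x +i* y) ^+ n).
        by rewrite lnM ?posrE ?exprn_gt0 ?lnXn ?mulr_natl//; lra.
      rewrite /lp ler_ln ?posrE ?lt_max ?ltr01//; last by rewrite mulr_gt0 ?exprn_gt0//; lra.
      rewrite ge_max; apply/andP; split; first by rewrite -[leLHS]mulr1; apply: ler_pM.
      apply: (@le_trans _ _ (A * modulus (x +i* y) ^+ n / M)).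
        by apply: ler_wpM2r; [rewrite invr_ge0 ltW|exact: hA].
      rewrite mulrAC; apply: ler_wpM2r; first by rewrite exprn_ge0 ?modulus_ge0.
      by rewrite le_max lexx orbT.
    move: h1 h2 lpu; set t := ln (modulus _); rewrite /c ler_pdivrMr ?mulr_gt0// => h1.
    rewrite ler_norml => /andP[a1 a2] lpu.
    have : (1 + eta) * n%:R * (t - N) <= (1 + eta) * n%:R * g (x +i* y).
      apply: ler_wpM2l; last by lra.
      by rewrite mulr_ge0 ?ltW// addr_gt0.
    move: h1 lpu; clear; lra.
have lg : ln (Num.max 1 (modulus P.[z] / M)) <= n%:R * g z.
  have ng : 0 <= n%:R * g z by rewrite mulr_ge0.
  apply/ler_addgt0Pr => e e0.
  have ng1 : 0 < n%:R * g z + 1 by rewrite ltr_wpDl.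
  have := main _ (divr_gt0 e0 ng1).
  have : e / (n%:R * g z + 1) * (n%:R * g z) <= e.
    by rewrite mulrAC ler_pdivrMr//; apply: ler_wpM2l; [exact: ltW|rewrite lerDl].
  lra.
have : modulus P.[z] / M <= expR (n%:R * g z).
  apply: (@le_trans _ _ (Num.max 1 (modulus P.[z] / M))); first by rewrite le_max lexx orbT.
  by rewrite -[leLHS]lnK ?posrE ?lt_max ?ltr01// ler_expR.
by rewrite ler_pdivrMr// mulrC.
Qed.

(** * Green's function near the arc *)

Lemma segment_propagation (R : realType) (P : R -> Prop) (a b s0 s1 : R) :
  (forall s : R, a <= s -> s <= b -> exists2 d : R, 0 < d & forall s' : R,
     a <= s' -> s' <= b -> `|s' - s| < d -> (P s <-> P s')) ->
  a <= s0 -> s0 <= b -> a <= s1 -> s1 <= b -> P s0 -> P s1.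
Proof.
move=> hP a0 b0 a1 b1 P0.
have [d hd] : exists d : R -> R, forall s, a <= s -> s <= b -> 0 < d s /\
    forall s', a <= s' -> s' <= b -> `|s' - s| < d s -> (P s <-> P s').
  suff /choice[d hd] : forall s : R, exists d : R, a <= s -> s <= b -> 0 < d /\
    forall s', a <= s' -> s' <= b -> `|s' - s| < d -> (P s <-> P s') by exists d.
  move=> s; have [h1|h1] := boolP (a <= s); last by exists 0.
  have [h2|h2] := boolP (s <= b); last by exists 0.
  by have [d d0 h] := hP s h1 h2; exists d.
have cI : connected (`[a, b] : set R) by exact: segment_connected.
pose B := [set s : R | [/\ a <= s, s <= b & P s]].
suff : B = `[a, b]%classic.
  by move=> BE; have : B s1 by [rewrite BE /= in_itv /= a1]; case.
have ob (Q : R -> Prop) : (forall s, Q s -> a <= s /\ s <= b) ->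
    open (\bigcup_(s in [set s | Q s]) ball s (d s)).
  by move=> _; apply: bigcup_open => s _; exact: ball_open.
apply: cI.
- by exists s0.
- exists (\bigcup_(s in [set s | [/\ a <= s, s <= b & P s]]) ball s (d s)).
    by apply: (ob (fun s => [/\ a <= s, s <= b & P s])) => s [].
  apply/seteqP; split=> [s [h1 h2 h3]|s [/=]].
    split; first by rewrite /= in_itv /= h1.
    exists s => //=; have [ds _] := hd s h1 h2.
    by rewrite /ball /= subrr normr0.
  rewrite in_itv /= => /andP[h1 h2] [t /= [t1 t2 Pt]]; rewrite /ball /= => st.
  split=> //; have [_ ht] := hd t t1 t2.
  by apply/(ht s h1 h2) => //; rewrite distrC.
- exists (~` \bigcup_(s in [set s | [/\ a <= s, s <= b & ~ P s]]) ball s (d s)).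
    by apply: open_closedC; apply: (ob (fun s => [/\ a <= s, s <= b & ~ P s])) => s [].
  apply/seteqP; split=> [s [h1 h2 h3]|s [/=]].
    split; first by rewrite /= in_itv /= h1.
    move=> [t /= [t1 t2 Pt]]; rewrite /ball /= => st.
    apply: Pt; have [_ ht] := hd t t1 t2.
    by apply/(ht s h1 h2) => //; rewrite distrC.
  rewrite in_itv /= => /andP[h1 h2] h; split=> //.
  apply: contrapT => Ps; apply: h; exists s => //=.
  by have [ds _] := hd s h1 h2; rewrite /ball /= subrr normr0.
Qed.

Definition zero_near (R : realType) (g : R[i] -> R) (z : R[i]) : Prop :=
  exists2 r : R, 0 < r & forall k, modulus k < r -> g (z + k) = 0.

Lemma zero_near_harm (R : realType) (g : R[i] -> R) (x y : R) :
  zero_near g (x +i* y) -> harm (fun x y => g (x +i* y)) x y.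
Proof.
move=> [r r0 hr] e e0; exists r => // h h0 hr'.
have gz k : modulus k < r -> g (x +i* y + k) = 0 by exact: hr.
have mh : modulus h%:C < r by rewrite modulus_real gtr0_norm.
have mi : modulus ('i * h%:C) < r by rewrite modulusM modulus_i mul1r.
rewrite /lap4.
rewrite !(complex_steps x y h).
have g0 : g (x +i* y) = 0 by have := gz 0; rewrite modulus0 addr0; exact.
rewrite !gz ?modulusN// g0 mulr0 !addr0 subr0 normr0.
by rewrite mulr_ge0 ?sqr_ge0 ?ltW.
Qed.

(* The signs [sg = 1] and [sg = -1] correspond to the two sides of the arc. *)
Definition pullback (R : realType) (g : R[i] -> R) (Gam : R[i] -> R[i]) (sg : R) (x y : R) : R :=
  g (Gam (x +i* (sg * y))).

Definition green_chart (R : realType) (K : set R[i]) (Gam : R[i] -> R[i]) (e1 : R[i]) (X : R) : Prop :=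
  [/\ 0 < X, e1 != 0,
    forall w, modulus w < X -> exists a b, taylor2 (fun h => Gam (w + h)) (Gam w) a b,
    forall w1 w2, modulus w1 < X -> modulus w2 < X ->
      modulus (Gam w1 - Gam w2 - e1 * (w1 - w2)) <= modulus e1 / 2 * modulus (w1 - w2) &
    forall w, modulus w < X -> complex.Im w != 0 -> ~ K (Gam w)].

Lemma small_modulus (R : realType) (x y sg X : R) :
  `|sg| = 1 -> 0 < X -> `|x| <= X / 3 -> `|y| <= X / 3 -> modulus (x +i* (sg * y)) < X.
Proof.
move=> s1 X0 h1 h2; apply: le_lt_trans (modulus_le_ReIm _) _ => /=.
by rewrite normrM s1 mul1r; lra.
Qed.

Lemma pullback_cont2 (R : realType) (K : set R[i]) (g : R[i] -> R) (Gam : R[i] -> R[i])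
    (e1 : R[i]) (X sg x y : R) :
  is_green_infty K g -> green_chart K Gam e1 X -> `|sg| = 1 ->
  `|x| <= X / 3 -> `|y| <= X / 3 -> cont2 (pullback g Gam sg) x y.
Proof.
move=> hg [X0 _ hT _ _] s1 h1 h2.
have [a [b hab]] := hT _ (small_modulus s1 X0 h1 h2).
apply: (@cont2_comp2 _ (fun x y => g (Gam (x +i* y))) (fun x _ => x) (fun _ y => sg * y)).
- exact: (chart_cont2 (fun z => @green_continuous _ K g z hg) hab).
- exact: cont2_fst.
- by apply: cont2M; [exact: cont2_cst|exact: cont2_snd].
Qed.

Lemma pullback_harm (R : realType) (K : set R[i]) (a b : R) (gamma : R -> R[i])
    (g : R[i] -> R) (Gam : R[i] -> R[i]) (e1 : R[i]) (X sg x y : R) :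
  analytic_arc_param K a b gamma ->
  is_green_infty K g -> green_chart K Gam e1 X -> sg = 1 \/ sg = -1 ->
  `|x| <= X / 3 -> 0 < y -> y <= X / 3 -> harm (pullback g Gam sg) x y.
Proof.
move=> hK hg [X0 _ hT _ hI] s1 h1 h2 h3.
have n1 : `|sg| = 1 by case: s1 => ->; rewrite ?normrN normr1.
have y3 : `|y| <= X / 3 by rewrite gtr0_norm.
have wX := small_modulus n1 X0 h1 y3.
have [a' [b' hab]] := hT _ wX.
have nK : ~ K (Gam (x +i* (sg * y))).
  apply: hI => //=; apply: mulf_neq0; last by rewrite gt_eqF.
  by rewrite -normr_gt0 n1.
have hh := harm_jet_comp hab (green_jet hK hg nK).
apply: eq_harm hh => h; rewrite /lap4 /pullback.
case: s1 => ->; rewrite ?mul1r// !mulN1r !opprD opprK.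
by ring.
Qed.

Lemma pullback_pos_box (R : realType) (K : set R[i]) (a b : R) (gamma : R -> R[i])
    (g : R[i] -> R) (Gam : R[i] -> R[i]) (e1 : R[i]) (X sg : R) :
  analytic_arc_param K a b gamma ->
  is_green_infty K g -> green_chart K Gam e1 X -> sg = 1 \/ sg = -1 ->
  pos_harm_box (pullback g Gam sg) (- (X / 3)) (X / 3) 0 (X / 3).
Proof.
move=> hK hg hG s1; have n1 : `|sg| = 1 by case: s1 => ->; rewrite ?normrN normr1.
split=> x y h1 h2 h3 h4.
- apply: (pullback_cont2 hg hG n1); first by rewrite ler_norml h1.
  by rewrite ger0_norm.
- exact: green_ge0 hK hg.
- by apply: (pullback_harm hK hg hG s1) => //; [rewrite ler_norml !ltW|exact: ltW].
Qed.

(* By continuity the pull-back then also vanishes on the real axis, and charts are open. *)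
Lemma chart_zero_near (R : realType) (K : set R[i]) (a b : R) (gamma : R -> R[i])
    (g : R[i] -> R) (Gam : R[i] -> R[i]) (e1 : R[i]) (X : R) :
  analytic_arc_param K a b gamma -> is_green_infty K g -> green_chart K Gam e1 X ->
  (forall sg x y : R, sg = 1 \/ sg = -1 -> `|x| < X / 3 -> 0 < y -> y < X / 3 ->
    pullback g Gam sg x y = 0) ->
  zero_near g (Gam 0).
Proof.
move=> hK hg hG hz; have [X0 e10 hT hD hI] := hG.
have X30 : 0 < X / 3 by rewrite divr_gt0.
have n1 : `|1 : R| = 1 by rewrite normr1.
have [d d0 hd] := chart_open e10 X0 hT hD X30.
exists d => // k kd.
have [|w [wX3 wX wk]] := hd (Gam 0 + k); first by rewrite addrAC subrr add0r.
rewrite -wk; case: w wX3 {wX wk} => x y wX3.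
have x3 := le_lt_trans (Re_le_modulus _) wX3; have y3 := le_lt_trans (Im_le_modulus _) wX3.
rewrite /= in x3 y3.
case: (ltgtP y 0) => y0.
- have := hz (-1) x (- y); rewrite /pullback mulN1r opprK; apply=> //; first by right.
    by rewrite oppr_gt0.
  by rewrite -(ltr0_norm y0).
- have := hz 1 x y; rewrite /pullback mul1r; apply=> //; first by left.
  by rewrite -(gtr0_norm y0).
rewrite {y y3 wX3}y0; apply/eqP; rewrite eq_le (green_ge0 _ hK hg) andbT leNgt; apply/negP => gp.
have c0 : cont2 (fun x y => - pullback g Gam 1 x y) x 0.
  by apply: cont2N; apply: (pullback_cont2 hg hG n1); [exact: ltW|rewrite normr0 ltW].
have [|r r0 hr] := cont2_near (c := 0) c0.
  by rewrite /pullback mulr0 oppr_lt0.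
pose t := Num.min (r / 2) (X / 6).
have t0 : 0 < t by rewrite lt_min !divr_gt0.
have [t1 t2] : t <= r / 2 /\ t <= X / 6 by split; rewrite /t ge_min lexx ?orbT.
have := hr x t; rewrite subrr normr0 subr0 gtr0_norm// hz ?oppr0 ?ltxx//; [|by left|lra].
by move=> /(_ r0); have tr : t < r by [lra]; move=> /(_ tr).
Qed.

Lemma green_chart_exists (R : realType) (K : set R[i]) (a b : R) (gamma : R -> R[i]) (s0 : R) :
  analytic_arc_param K a b gamma -> a <= s0 -> s0 <= b ->
  exists Gam : R[i] -> R[i], exists X : R, [/\
    green_chart K Gam (curve_derive gamma s0) X,
    forall t : R, `|t| < X -> Gam t%:C = gamma (s0 + t) &
    exists b, taylor2 Gam (gamma s0) (curve_derive gamma s0) b].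
Proof.
move=> hK h1 h2; have [Gam [X X0 [hr hT hT0 hD hI]]] := arc_chart hK h1 h2.
exists Gam, X; split=> //; split=> //.
by have [_ _ dn _ _] := hK; apply: dn; rewrite in_itv /= h1.
Qed.

(** In the chart at gamma s, vanishing near gamma s' gives a zero of each pull-back just off the
    axis. By the strong minimum principle the nonnegative pull-back then vanishes on each half box,
    and [chart_zero_near] returns to the plane. *)
Lemma zero_near_propagates (R : realType) (K : set R[i]) (a b : R) (gamma : R -> R[i])
    (g : R[i] -> R) (s : R) :
  analytic_arc_param K a b gamma -> is_green_infty K g -> a <= s -> s <= b ->
  exists2 d : R, 0 < d & forall s' : R, a <= s' -> s' <= b -> `|s' - s| < d ->
    zero_near g (gamma s') -> zero_near g (gamma s).
Proof.
move=> hK hg as_ sb; have [Gam [X [hG hr _]]] := green_chart_exists hK as_ sb.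
have [X0 e10 hT hD hI] := hG.
exists (X / 3); first by rewrite divr_gt0.
move=> s' as' s'b ss [r r0 hz].
have G0 : Gam 0 = gamma s by have := hr 0; rewrite normr0 addr0 => ->.
rewrite -G0; apply: (chart_zero_near hK hg hG) => sg x y hsg hx y0 y3.
apply/eqP; rewrite eq_le (green_ge0 _ hK hg) andbT leNgt; apply/negP => up.
have X30 : 0 < X / 3 by rewrite divr_gt0.
set t := s' - s in ss.
have tX : modulus (t%:C) < X by rewrite modulus_real; lra.
have Gt : Gam t%:C = gamma s' by rewrite hr /t ?(addrC s) ?subrK//; lra.
have [c1 [c2 hc]] := hT _ tX; have [L [d [L0 d0 hL]]] := taylor2_lipschitz hc.
have L10 : 0 < L + 1 by rewrite ltr_wpDl.
(* The point at height h over t lies inside the half box, and the Lipschitz bound puts its image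
   within r of gamma s', where g vanishes. *)
pose h := Num.min (X / 6) (Num.min (d / 2) (r / (2 * (L + 1)))).
have h0 : 0 < h by rewrite !lt_min !divr_gt0// mulr_gt0.
have [h1 h2 h3] : [/\ h <= X / 6, h <= d / 2 & h <= r / (2 * (L + 1))].
  by split; rewrite /h !ge_min lexx ?orbT.
rewrite ler_pdivlMr ?mulr_gt0// in h3.
have n1 : `|sg| = 1 by case: hsg => ->; rewrite ?normrN normr1.
have hbox := pullback_pos_box hK hg hG hsg.
move: hx ss; rewrite !ltr_norml => /andP[x1 x2] /andP[t1 t2].
have hX3 : h < X / 3 by clear -h1 X0; lra.
have := strong_minimum hbox x1 x2 y0 y3 t1 t2 h0 hX3 up.
rewrite /pullback.
have -> : t +i* (sg * h) = t%:C + (0 +i* (sg * h)) by rewrite /real_complex_def; simpc.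
have mh : modulus (0 +i* (sg * h)) = h.
  by rewrite /modulus /= expr0n /= add0r sqrtr_sqr normrM n1 mul1r gtr0_norm.
have := hL (0 +i* (sg * h)); rewrite mh => hh.
have {}hh : modulus (Gam (t%:C + 0 +i* (sg * h)) - Gam t%:C) <= L * h.
  by apply: hh; clear -h2 d0; lra.
rewrite -[Gam (_ + _)](subrK (Gam t%:C)) [X in g X]addrC {1}Gt hz ?ltxx//.
by apply: le_lt_trans hh _; clear -h3 r0 h0 L0; lra.
Qed.

Lemma not_zero_near (R : realType) (K : set R[i]) (a b : R) (gamma : R -> R[i])
    (g : R[i] -> R) (s : R) :
  analytic_arc_param K a b gamma -> is_green_infty K g -> a <= s -> s <= b ->
  ~ zero_near g (gamma s).
Proof.
move=> hK hg as_ sb zs; have [_ _ _ _ KE] := hK.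
have all_s (s' : R) : a <= s' -> s' <= b -> zero_near g (gamma s').
  move=> h1 h2; apply: (segment_propagation (P := fun t => zero_near g (gamma t)) _ as_ sb h1 h2 zs).
  move=> t ta tb; have [d d0 hd] := zero_near_propagates hK hg ta tb.
  (* Local constancy along the arc: vanishing near a point is an open condition, and if it fails at
     t then [zero_near_propagates] forbids it at nearby parameters. *)
  have [[r r0 hr]|nz] := pselect (zero_near g (gamma t)).
    have r20 : 0 < r / 2 by rewrite divr_gt0.
    have [d' d'0 hd'] := arc_continuous hK ta tb r20.
    exists d' => // t' h3 h4 h5; split=> // _; last by exists r.
    exists (r / 2) => // k kr.
    have -> : gamma t' + k = gamma t + (gamma t' - gamma t + k) by ring.
    apply: hr; apply: le_lt_trans (modulusD _ _) _.
    by have := hd' t' h5; lra.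
  by exists d => // t' h3 h4 h5; split=> // h6; exact: hd h6.
apply: (green_not_harmonic hg) => x y.
have [Kz|Kz] := pselect (K (x +i* y)); last exact: green_harm hK hg Kz.
apply: zero_near_harm; move: Kz; rewrite KE => -[s' /= + <-].
by rewrite in_itv /= => /andP[h1 h2]; exact: all_s.
Qed.

Definition side_slope (R : realType) (g : R[i] -> R) (Gam : R[i] -> R[i]) (sg al C Y : R) : Prop :=
  forall x y : R, `|x| <= Y -> 0 <= y -> y <= Y ->
    `|pullback g Gam sg x y - al * y| <= C * (`|x| + y) * y.

Lemma side_slope_exists (R : realType) (K : set R[i]) (a b : R) (gamma : R -> R[i])
    (g : R[i] -> R) (Gam : R[i] -> R[i]) (e1 : R[i]) (X s0 sg : R) :
  analytic_arc_param K a b gamma -> is_green_infty K g -> green_chart K Gam e1 X ->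
  (forall t : R, `|t| < X -> Gam t%:C = gamma (s0 + t)) -> a < s0 -> s0 < b ->
  sg = 1 \/ sg = -1 ->
  exists al C Y : R, [/\ 0 <= C, 0 < Y, Y <= X / 3 & side_slope g Gam sg al C Y].
Proof.
move=> hK hg hG hr as0 s0b hsg; have [X0 _ _ _ _] := hG.
have [_ _ _ _ KE] := hK; have [_ _ _ gK] := hg.
have n1 : `|sg| = 1 by case: hsg => ->; rewrite ?normrN normr1.
(* The distance to the ends of the parameter interval enters so that the real segment of the half
   box is mapped into K, where g is 0. This is where an interior parameter matters. *)
pose Z := Num.min (X / 3) (Num.min (s0 - a) (b - s0)).
have Z0 : 0 < Z by rewrite !lt_min !subr_gt0 as0 s0b divr_gt0.
have [Z1 Z2 Z3] : [/\ Z <= X / 3, Z <= s0 - a & Z <= b - s0].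
  by split; rewrite /Z !ge_min lexx ?orbT.
have [|al [C [Y [C0 Y0 YZ hY]]]] := @boundary_regularity R (pullback g Gam sg) Z Z0.
  split.
  - move=> x y h1 h2 h3; apply: (pullback_cont2 hg hG n1); first exact: le_trans Z1.
    by rewrite ger0_norm//; exact: le_trans Z1.
  - move=> x y h1 h2 h3; apply: (pullback_harm hK hg hG hsg) => //; exact: le_trans Z1.
  - move=> x hx; rewrite /pullback mulr0; apply: gK.
    have := hr x; rewrite /real_complex_def => ->; last by move: hx; clear -Z1 X0; lra.
    rewrite KE; exists (s0 + x) => //=; rewrite in_itv /=.
    by move: hx; rewrite ler_norml => /andP[x1 x2]; apply/andP; split; clear -x1 x2 Z2 Z3; lra.
by exists al, C, Y; split=> //; exact: le_trans Z1.
Qed.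

(** [hopf] gives k t <= al t + C t^2 on the axis x = 0, which for small t is incompatible with al <=
    0. *)
Lemma side_slope_gt0 (R : realType) (K : set R[i]) (a b : R) (gamma : R -> R[i])
    (g : R[i] -> R) (Gam : R[i] -> R[i]) (e1 : R[i]) (X sg al C Y x y : R) :
  analytic_arc_param K a b gamma -> is_green_infty K g -> green_chart K Gam e1 X ->
  sg = 1 \/ sg = -1 -> 0 <= C -> 0 < Y -> side_slope g Gam sg al C Y ->
  `|x| < X / 3 -> 0 < y -> y < X / 3 -> 0 < pullback g Gam sg x y -> 0 < al.
Proof.
move=> hK hg hG hsg C0 Y0 hY; rewrite ltr_norml => /andP[x1 x2] y0 y3 up.
have hbox := pullback_pos_box hK hg hG hsg.
have [k [Z [k0 Z0 hk]]] := hopf hbox x1 x2 y0 y3 up.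
rewrite ltNge; apply/negP => al0.
have C10 : 0 < C + 1 by rewrite ltr_wpDl.
pose t := Num.min (Num.min Y Z) (k / (2 * (C + 1))).
have t0 : 0 < t by rewrite !lt_min Y0 Z0 divr_gt0// mulr_gt0.
have [t1 t2 t3] : [/\ t <= Y, t <= Z & t <= k / (2 * (C + 1))].
  by split; rewrite /t !ge_min lexx ?orbT.
rewrite ler_pdivlMr ?mulr_gt0// in t3.
have := hk t (ltW t0) t2; have := hY 0 t; rewrite normr0 add0r => /(_ (ltW Y0) (ltW t0) t1).
rewrite ler_norml => /andP[_ h1] h2.
have h3 : k * t <= C * t * t.
  have : al * t <= 0 by rewrite mulr_le0_ge0// ltW.
  lra.
rewrite ler_pM2r// in h3.
by move: h3 t3; have := mulr_gt0 C10 t0; clear -t0 k0; lra.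
Qed.

(** The preimage w of z0 + t nu under the chart is not on the imaginary axis, but the second order
    expansion puts it within N t^2 of i sg t / |e1|. The estimate of [side_slope] tolerates such a
    displacement, horizontal or vertical, at the cost of O(t^2). *)
Lemma normal_derivative_side (R : realType) (K : set R[i]) (g : R[i] -> R)
    (Gam : R[i] -> R[i]) (z0 e1 c : R[i]) (X sg al C Y : R) :
  green_chart K Gam e1 X -> taylor2 Gam z0 e1 c ->
  sg = 1 \/ sg = -1 -> 0 <= C -> 0 < Y -> side_slope g Gam sg al C Y ->
  normal_derivative g z0 ((sg / modulus e1)%:C * ('i * e1)) = al / modulus e1.
Proof.
move=> [X0 e10 hT hD hI] hc hsg C0 Y0 hY.
have n1 : `|sg| = 1 by case: hsg => ->; rewrite ?normrN normr1.
have sg2 : sg * sg = 1 by case: hsg => ->; rewrite ?mulrNN mulr1.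
have G0 := taylor2_0 hc.
set m := modulus e1; have m0 : 0 < m by rewrite modulus_gt0.
set nu := (sg / m)%:C * ('i * e1).
have nu1 : modulus nu = 1.
  by rewrite /nu !modulusM modulus_i mul1r modulus_real normrM n1 mul1r gtr0_norm ?invr_gt0// mulVf ?gt_eqF.
have [M [d [M0 d0 hM]]] := hc.
have Yd0 : 0 < Num.min (Num.min (Y / 2) d) 1 by rewrite !lt_min d0 ltr01 divr_gt0.
have [d1 d10 hopen] := chart_open e10 X0 hT hD Yd0.
(* The remainder (|c| + M) |w|^2, combined with |w| <= 2 t / m and divided by m, gives N t^2. *)
pose N := (modulus c + M) * 4 / m ^+ 3.
have N0 : 0 <= N by rewrite divr_ge0 ?exprn_ge0 ?(ltW m0)// mulr_ge0// addr_ge0 ?modulus_ge0.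
(* The second bound gives N t^2 <= t / m, so that w lies on the intended side of the axis. *)
pose t1 := Num.min d1 (1 / (m * (N + 1))).
have N10 : 0 < N + 1 by rewrite ltr_wpDl.
have t10 : 0 < t1 by rewrite lt_min d10 divr_gt0// mulr_gt0.
pose Q := C * (N * t1 + 2 / m) * (2 / m) + `|al| * N.
have Q0 : 0 <= Q.
  have Nt : 0 <= N * t1 by rewrite mulr_ge0// ltW.
  have m2 : 0 <= 2 / m by rewrite divr_ge0// ltW.
  by apply: addr_ge0; apply: mulr_ge0 => //; apply: mulr_ge0 => //; exact: addr_ge0.
have key (t : R) : 0 < t -> t < t1 -> `|g (z0 + t%:C * nu) / t - al / m| <= Q * t.
  move=> t0 tt1; move: (tt1); rewrite lt_min => /andP[td1 tN].
  rewrite ltr_pdivlMr ?mulr_gt0// in tN.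
  have zt : modulus (z0 + t%:C * nu - Gam 0) < d1.
    by rewrite G0 addrAC subrr add0r modulusM nu1 mulr1 modulus_real gtr0_norm.
  have [w [wY wX Gw]] := hopen _ zt.
  move: wY; rewrite !lt_min => /andP[/andP[wY wd] w1].
  have m00 : modulus (0 : R[i]) < X by rewrite modulus0.
  have w2t : modulus w <= 2 * t / m.
    have := hD w 0 wX m00; rewrite Gw subr0 -/m => h.
    have := modulusB (z0 + t%:C * nu - Gam 0) (z0 + t%:C * nu - Gam 0 - e1 * w).
    rewrite subKr modulusM -/m {1}G0 addrAC subrr add0r modulusM nu1 mulr1 modulus_real gtr0_norm// => h'.
    rewrite ler_pdivlMr//; move: h h'; clear; lra.
  have w0 := modulus_ge0 w.
  have wsq : modulus w ^+ 2 <= 4 * t ^+ 2 / m ^+ 2.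
    have -> : 4 * t ^+ 2 / m ^+ 2 = (2 * t / m) ^+ 2 by field; exact: lt0r_neq0.
    by apply: lerXn2r => //; rewrite nnegrE// divr_ge0 ?mulr_ge0// ltW.
  have hw : modulus (w - t%:C * nu / e1) <= N * t ^+ 2.
    have e : e1 * (w - t%:C * nu / e1) =
        - (Gam w - (z0 + e1 * w + c * w ^+ 2)) - c * w ^+ 2.
      by rewrite Gw; field.
    have h : m * modulus (w - t%:C * nu / e1) <= (modulus c + M) * modulus w ^+ 2.
      rewrite /m -modulusM e; apply: le_trans (modulusB _ _) _.
      rewrite modulusN modulusM modulusX mulrDl addrC; apply: lerD => //.
      apply: le_trans (hM w wd) _; apply: ler_wpM2l => //.
      by rewrite exprS ler_piMl ?sqr_ge0// ltW.
    rewrite -(ler_pM2l m0); apply: le_trans h _.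
    apply: le_trans (ler_wpM2l _ wsq) _; first by rewrite addr_ge0 ?modulus_ge0.
    by rewrite /N; apply: le_of_eq; field; exact: lt0r_neq0.
  have tnu : t%:C * nu / e1 = 0 +i* (sg * (t / m)).
    have -> : t%:C * nu / e1 = t%:C * (sg / m)%:C * 'i by rewrite /nu !mulrA mulfK.
    by apply/eqP; rewrite eq_complex /=; apply/andP; split; apply/eqP; ring.
  rewrite tnu in hw.
  pose y := sg * complex.Im w.
  have ywE : w = complex.Re w +i* (sg * y) by rewrite /y mulrA sg2 mul1r; case: (w).
  have hx : `|complex.Re w| <= N * t ^+ 2.
    by have := le_trans (Re_le_modulus _) hw; rewrite ReD ReN subr0.
  have hy : `|y - t / m| <= N * t ^+ 2.
    have := le_trans (Im_le_modulus _) hw; rewrite ImD ImN /=.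
    have -> : complex.Im w - sg * (t / m) = sg * (y - t / m) by rewrite /y mulrBr (mulrA sg sg) sg2 mul1r.
    by rewrite normrM n1 mul1r.
  have Nt2 : N * t ^+ 2 <= t / m.
    rewrite ler_pdivlMr// expr2 mulrA mulrAC.
    have : N * t * m <= 1.
      by have := mulr_gt0 t0 m0; move: tN; clear; lra.
    by move=> h; have := ler_wpM2r (ltW t0) h; rewrite mul1r mulrAC; clear; lra.
  have y0 : 0 <= y by move: hy; rewrite ler_norml => /andP[hy1 _]; clear -hy1 Nt2; lra.
  have y2 : y <= 2 / m * t.
    by move: hy; rewrite ler_norml => /andP[_ hy1]; clear -hy1 Nt2; lra.
  have xY : `|complex.Re w| <= Y.
    by apply: le_trans (Re_le_modulus _) _; clear -wY Y0; lra.
  have yY : y <= Y.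
    apply: le_trans (ler_norm _) _; rewrite normrM n1 mul1r.
    by apply: le_trans (Im_le_modulus _) _; clear -wY Y0; lra.
  have := hY _ _ xY y0 yY; rewrite /pullback -ywE Gw => hg.
  have xt : `|complex.Re w| <= N * t1 * t.
    apply: le_trans hx _; rewrite expr2 mulrA; apply: ler_wpM2r; first exact: ltW.
    by apply: ler_wpM2l => //; exact: ltW.
  have -> : g (z0 + t%:C * nu) / t - al / m =
    ((g (z0 + t%:C * nu) - al * y) + al * (y - t / m)) / t.
    by field; rewrite !gt_eqF.
  rewrite normrM normfV (gtr0_norm t0) ler_pdivrMr//.
  apply: le_trans (ler_normD _ _) _.
  have p1 : `|al * (y - t / m)| <= `|al| * N * t ^+ 2.
    by rewrite normrM -mulrA; apply: ler_wpM2l.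
  have p2 : `|g (z0 + t%:C * nu) - al * y| <= C * (N * t1 + 2 / m) * (2 / m) * t ^+ 2.
    apply: le_trans hg _.
    have -> : C * (N * t1 + 2 / m) * (2 / m) * t ^+ 2 =
      C * ((N * t1 * t + 2 / m * t)) * (2 / m * t) by ring.
    apply: ler_pM => //; first by rewrite mulr_ge0// addr_ge0.
    by apply: ler_wpM2l => //; exact: lerD.
  apply: le_trans (lerD p2 p1) _; rewrite /Q.
  by apply: le_of_eq; ring.
rewrite /normal_derivative; apply: cvg_lim => //; apply/cvgrPdist_le => e e0.
have Q10 : 0 < Q + 1 by rewrite ltr_wpDl.
near=> t.
have t0 : 0 < t by near: t; exact: nbhs_right_gt.
have tt : t < Num.min t1 (e / (Q + 1)).
  by near: t; apply: nbhs_right_lt; rewrite lt_min t10 divr_gt0.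
move: tt; rewrite lt_min => /andP[tt1 te].
rewrite distrC; apply: le_trans (key t t0 tt1) _.
rewrite ltr_pdivlMr// in te.
by move: te t0; clear; lra.
Unshelve. all: by end_near. Qed.

(** * A local Bernstein inequality *)

(* [ln (joukowski_modulus z)] is Green's function of the complement of [-1, 1]. *)
Definition joukowski_modulus (R : realType) (z : R[i]) : R :=
  let W := modulus (z - 1) + modulus (z + 1) in (W + Num.sqrt (W ^+ 2 - 4)) / 2.

(** The roots z + c and z - c have product 1, so one of them has modulus at least 1. From z = (r + 1
    / r) / 2 one gets |z - 1| = |r - 1|^2 / (2 |r|), likewise with +, and the parallelogram identity
    makes the focal sum W equal to |r| + 1 / |r|. *)
Lemma joukowskiP (R : realType) (z : R[i]) : exists r : R[i],
  [/\ r ^+ 2 - 2 * z * r + 1 = 0, 1 <= modulus r & joukowski_modulus z = modulus r].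
Proof.
pose c := sqrtc (z ^+ 2 - 1).
have c2 : c ^+ 2 = z ^+ 2 - 1 by exact: sqr_sqrtc.
wlog [r [hr r1]] : / exists r, [\/ r = z + c | r = z - c] /\ 1 <= modulus r.
  apply; have rr : modulus (z + c) * modulus (z - c) = 1.
    rewrite -modulusM (_ : _ * _ = 1) ?modulus1//.
    by rewrite mulrC -subr_sqr c2 subKr.
  case: (leP 1 (modulus (z + c))) => h; first by exists (z + c); split=> //; left.
  exists (z - c); split; first by right.
  rewrite leNgt; apply/negP => h'.
  have : modulus (z + c) * modulus (z - c) < 1.
    by apply: le_lt_trans h'; apply: ler_piMl; [exact: modulus_ge0|exact: ltW].
  by rewrite rr ltxx.
have root : r ^+ 2 - 2 * z * r + 1 = 0.
  have -> : r ^+ 2 - 2 * z * r + 1 = (r - z) ^+ 2 - (z ^+ 2 - 1) by ring.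
  by rewrite -c2; case: hr => ->; ring.
exists r; split=> //.
have r0 : r != 0 by rewrite -modulus_gt0; lra.
have zE : z = (r + r^-1) / 2.
  have : (r ^+ 2 - 2 * z * r + 1) / r / 2 = 0 by rewrite root !mul0r.
  by move=> h; apply/eqP; rewrite -subr_eq0 -oppr_eq0 -h; apply/eqP; field.
set t := modulus r in r1 *.
have t0 : 0 < t by lra.
have W1 : modulus (z - 1) + modulus (z + 1) = t + t^-1.
  have e1 : modulus (z - 1) = modulus (r - 1) ^+ 2 / (2 * t).
    rewrite -modulusX /t; have -> : z - 1 = (r - 1) ^+ 2 / (2 * r) by rewrite zE; field.
    rewrite modulusM modulusV modulusM; congr (_ / (_ * _)).
    by rewrite (_ : 2 = 2%:C) ?modulus_real ?normr_nat// rmorphMn.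
  have e2 : modulus (z + 1) = modulus (r + 1) ^+ 2 / (2 * t).
    rewrite -modulusX /t; have -> : z + 1 = (r + 1) ^+ 2 / (2 * r) by rewrite zE; field.
    rewrite modulusM modulusV modulusM; congr (_ / (_ * _)).
    by rewrite (_ : 2 = 2%:C) ?modulus_real ?normr_nat// rmorphMn.
  have t2 : t ^+ 2 = complex.Re r ^+ 2 + complex.Im r ^+ 2 by exact: modulus_sqr.
  rewrite e1 e2 !modulus_sqr !(ReD, ReN, ImD, ImN) /= -mulrDl oppr0 addr0.
  set p := complex.Re r in t2 *; set q := complex.Im r in t2 *.
  have -> : (p - 1) ^+ 2 + q ^+ 2 + ((p + 1) ^+ 2 + q ^+ 2) = 2 * t ^+ 2 + 2.
    by rewrite t2; ring.
  by field; exact: lt0r_neq0.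
rewrite /joukowski_modulus W1.
have -> : (t + t^-1) ^+ 2 - 4 = (t - t^-1) ^+ 2 by field; exact: lt0r_neq0.
have tV : t^-1 <= 1 by rewrite invf_le1.
rewrite sqrtr_sqr ger0_norm ?subr_ge0; last exact: le_trans tV r1.
by field; exact: lt0r_neq0.
Qed.

Lemma joukowski_modulus_ge1 (R : realType) (z : R[i]) : 1 <= joukowski_modulus z.
Proof. by have [r [_ h ->]] := joukowskiP z. Qed.

Lemma joukowski_modulus_upper (R : realType) (z : R[i]) :
  joukowski_modulus z <= 2 * modulus z + 2.
Proof.
rewrite /joukowski_modulus /=; set W := modulus _ + modulus _.
have WW : W <= 2 * modulus z + 2.
  have := modulusB z 1; have := modulusD z 1; rewrite modulus1 /W; lra.
have W0 : 0 <= W by rewrite addr_ge0 ?modulus_ge0.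
have : Num.sqrt (W ^+ 2 - 4) <= W.
  by rewrite -[leRHS](ger0_norm W0) -sqrtr_sqr; apply: ler_wsqrtr; rewrite lerBlDr lerDl.
lra.
Qed.

Lemma joukowski_modulus_segment (R : realType) (t : R) :
  `|t| <= 1 -> joukowski_modulus t%:C = 1.
Proof.
rewrite ler_norml => /andP[t1 t2]; rewrite /joukowski_modulus /=.
have -> : t%:C - 1 = (t - 1)%:C by rewrite rmorphB.
have -> : t%:C + 1 = (t + 1)%:C by rewrite rmorphD.
rewrite !modulus_real ler0_norm ?subr_le0// ger0_norm; last by lra.
have -> : - (t - 1) + (t + 1) = 2 by ring.
have -> : 2 ^+ 2 - 4 = 0 :> R by ring.
by rewrite sqrtr0; lra.
Qed.

(** The point z lies on the ellipse with foci -1 and 1 whose semi-minor axis is the right-hand side.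
    Algebraically, the quadratic equation for r is multiplied by the conjugate of r and imaginary
    parts are taken. *)
Lemma Im_joukowski (R : realType) (z : R[i]) :
  `|complex.Im z| <= (joukowski_modulus z - (joukowski_modulus z)^-1) / 2.
Proof.
have [r [root r1 ->]] := joukowskiP z.
set t := modulus r in r1 *; have t0 : 0 < t by lra.
have r0 : r != 0 by rewrite -modulus_gt0.
have t2 : t ^+ 2 = complex.Re r ^+ 2 + complex.Im r ^+ 2 by exact: modulus_sqr.
have e : 2 * complex.Im z * t ^+ 2 = complex.Im r * (t ^+ 2 - 1).
  have rc : r * conjc r = (t ^+ 2)%:C.
    by rewrite t2; apply/eqP; rewrite eq_complex; case: (r) => p q /=; apply/andP; split; apply/eqP; ring.
  have : (r ^+ 2 - 2 * z * r + 1) * conjc r = r * (r * conjc r) - 2 * z * (r * conjc r) + conjc r.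
    by ring.
  rewrite root mul0r rc => /(congr1 (@complex.Im R)).
  have e1 : complex.Im (r * (t ^+ 2)%:C) = t ^+ 2 * complex.Im r.
    by rewrite (mulrC r) Im_scale.
  have e2 : complex.Im (2 * z * (t ^+ 2)%:C) = 2 * (t ^+ 2 * complex.Im z).
    by rewrite (mulrC (2 * z)) Im_scale mulr_natl mulr2n ImD; ring.
  have e3 : complex.Im (conjc r) = - complex.Im r by case: (r).
  by rewrite ImD ImD ImN e1 e2 e3 /=; clear; lra.
have -> : (t - t^-1) / 2 = t * (t ^+ 2 - 1) / (2 * t ^+ 2) by field; exact: lt0r_neq0.
have t20 : 0 < t ^+ 2 by rewrite exprn_gt0.
rewrite ler_pdivlMr ?mulr_gt0//.
have -> : `|complex.Im z| * (2 * t ^+ 2) = `|complex.Im r * (t ^+ 2 - 1)|.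
  by rewrite -e normrM (ger0_norm (ltW t20)) normrM normr_nat; ring.
have tt : 0 <= t ^+ 2 - 1 by rewrite subr_ge0 exprn_ege1.
by rewrite normrM (ger0_norm tt); apply: ler_wpM2r => //; exact: Im_le_modulus.
Qed.

(** An approximate root is as good as its residual: the quadratic factors as (psi - r) (psi - 1 /
    r), and the second factor has modulus at least |psi| - 1. *)
Lemma joukowski_modulus_lower (R : realType) (z psi : R[i]) :
  1 < modulus psi ->
  modulus psi - modulus (psi ^+ 2 - 2 * z * psi + 1) / (modulus psi - 1) <= joukowski_modulus z.
Proof.
move=> psi1; have [r [root r1 ->]] := joukowskiP z.
have r0 : r != 0 by rewrite -modulus_gt0; lra.
have d0 : 0 < modulus psi - 1 by lra.
have zE : 2 * z = r + r^-1.
  have : (r ^+ 2 - 2 * z * r + 1) / r = 0 by rewrite root mul0r.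
  by move=> h; apply/eqP; rewrite -subr_eq0 -oppr_eq0 -h; apply/eqP; field.
have -> : psi ^+ 2 - 2 * z * psi + 1 = (psi - r) * (psi - r^-1) by rewrite zE; field.
have rV : modulus r^-1 <= 1 by rewrite modulusV invf_le1//; lra.
have h1 : modulus psi - 1 <= modulus (psi - r^-1).
  by have := modulusD (psi - r^-1) r^-1; rewrite subrK; lra.
have h2 : modulus psi - modulus r <= modulus (psi - r).
  by have := modulusD (psi - r) r; rewrite subrK; lra.
have h3 : modulus (psi - r) <= modulus ((psi - r) * (psi - r^-1)) / (modulus psi - 1).
  by rewrite ler_pdivlMr// modulusM; apply: ler_wpM2l => //; exact: modulus_ge0.
lra.
Qed.

Lemma joukowski_cont2 (R : realType) (F : R[i] -> R[i]) (x y : R) (A a b : R[i]) :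
  taylor2 (fun k => F ((x +i* y) + k)) A a b ->
  cont2 (fun x y => ln (joukowski_modulus (F (x +i* y)))) x y.
Proof.
move=> hT; apply: (@cont2_comp _ (fun x y => joukowski_modulus (F (x +i* y)))); last first.
  by apply: continuous_ln; apply: lt_le_trans (joukowski_modulus_ge1 _).
have cF (c : R[i]) := modulus_cont2 c hT.
rewrite /joukowski_modulus /=.
apply: cont2M; last exact: cont2_cst.
apply: cont2D; first by apply: cont2D.
apply: (@cont2_comp _ _ Num.sqrt); last exact: sqrt_continuous.
apply: cont2B; last exact: cont2_cst.
by apply: cont2X; apply: cont2D.
Qed.

(* Near a point where [F] is off [-1, 1] the root [r] of largest modulus is
   replaced by [Psi], whose square root of [F ^+ 2 - 1] is truncated at second order. *)
Lemma joukowski_subharm (R : realType) (F : R[i] -> R[i]) (x y : R) (A a b : R[i]) :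
  taylor2 (fun k => F ((x +i* y) + k)) A a b ->
  subharm (fun x y => ln (joukowski_modulus (F (x +i* y)))) x y.
Proof.
move=> hT; have FA : F (x +i* y) = A by have := taylor2_0 hT; rewrite addr0.
have [r [root r1 rE]] := joukowskiP A.
(* If |r| = 1 the value of ln J is 0, its global minimum, and subharmonicity is trivial. *)
case: (ltP 1 (modulus r)) => r1'; last first.
  apply: subharm_min => x' y'; rewrite FA rE.
  have -> : modulus r = 1 by apply/eqP; rewrite eq_le r1 r1'.
  by rewrite ln1 ln_ge0// joukowski_modulus_ge1.
pose c := r - A.
have c2 : c ^+ 2 = A ^+ 2 - 1.
  by rewrite /c; apply/eqP; rewrite -subr_eq0 -root; apply/eqP; ring.
have c0 : c != 0.
  apply/eqP => c0; move: c2; rewrite c0 expr0n /= => /esym/eqP; rewrite subr_eq0 => /eqP A2.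
  have : modulus r ^+ 2 = 1.
    by rewrite -modulusX (_ : r = A) ?A2 ?modulus1//; apply/eqP; rewrite -subr_eq0 -/c c0.
  by move: r1'; set t := modulus r; clear => h e; nra.
(* Thus F^2 - 1 = c^2 (1 + tau) with tau = 0 at the base point, and [Psi] uses 1 + tau / 2 - tau^2 /
   8 for the square root of 1 + tau. *)
pose tau (z : R[i]) := (F z * F z + - (A ^+ 2)) * (c ^+ 2)^-1.
pose Psi (z : R[i]) := F z + c * (1 + (tau z * 2^-1 + tau z * tau z * (- (8^-1)))).
have [t1 [t2 hau]] : exists t1 t2, taylor2 (fun k => tau ((x +i* y) + k)) 0 t1 t2.
  have := taylor2M (taylor2D (taylor2M hT hT) (taylor2_cst (- A ^+ 2))) (taylor2_cst (c ^+ 2)^-1).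
  rewrite -expr2 subrr mul0r => h.
  by do 2 eexists; exact: h.
have [p1 [p2 hPsi]] : exists p1 p2, taylor2 (fun k => Psi ((x +i* y) + k)) r p1 p2.
  have := taylor2D hT (taylor2M (taylor2_cst c) (taylor2D (taylor2_cst 1)
    (taylor2D (taylor2M hau (taylor2_cst 2^-1))
      (taylor2M (taylor2M hau hau) (taylor2_cst (- 8^-1)))))).
  have Ac : A + c = r by rewrite /c addrC subrK.
  rewrite !mul0r !addr0 mulr1 Ac => h.
  by do 2 eexists; exact: h.
(* The truncated root squares to 1 + tau - tau^3 / 8 + tau^4 / 64, so the residual is cubic in tau,
   hence in the increment, and negligible against h^2. *)
have PsiE z : Psi z ^+ 2 - 2 * F z * Psi z + 1 =
    c ^+ 2 * (tau z ^+ 3 * (tau z / 64 - 1 / 8)).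
  have FF : F z ^+ 2 - 1 = c ^+ 2 * (1 + tau z).
    by rewrite /tau mulrDr mulr1 mulrCA mulfV ?expf_neq0// c2; ring.
  have -> : Psi z ^+ 2 - 2 * F z * Psi z + 1 = (Psi z - F z) ^+ 2 - (F z ^+ 2 - 1) by ring.
  by rewrite FF /Psi; field.
have hLn := ln_modulus_harm hPsi; have r0 : r != 0 by rewrite -modulus_gt0; lra.
have {}hLn := harm_sub (hLn r0).
have [L [d [L0 d0 hL]]] := taylor2_lipschitz hau.
have [L' [d' [L'0 d'0 hL']]] := taylor2_lipschitz hPsi.
pose dr := (modulus r - 1) / 2; have dr0 : 0 < dr by rewrite divr_gt0// subr_gt0.
pose N := modulus (c ^+ 2) * L ^+ 3 / dr.
have N0 : 0 <= N by rewrite divr_ge0 ?(ltW dr0)// mulr_ge0 ?modulus_ge0// exprn_ge0.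
(* [ln |Psi| - 2 N |k| ^+ 3] is a lower bound with the same value at [k = 0]. *)
have low : exists2 dl : R, 0 < dl & forall k, modulus k < dl ->
    ln (modulus (Psi (x +i* y + k))) - 2 * N * modulus k ^+ 3 <=
    ln (joukowski_modulus (F (x +i* y + k))).
  have L10 : 0 < L + 1 by rewrite ltr_wpDl.
  have L'10 : 0 < L' + 1 by rewrite ltr_wpDl.
  have N10 : 0 < N + 1 by rewrite ltr_wpDl.
  exists (Num.min (Num.min d d') (Num.min (Num.min 1 (1 / (L + 1))) (Num.min (dr / (L' + 1)) (1 / (2 * (N + 1)))))).
    have u1 : 0 < 1 / (L + 1) by exact: divr_gt0.
    have u2 : 0 < dr / (L' + 1) by exact: divr_gt0.
    have u3 : 0 < 1 / (2 * (N + 1)) by apply: divr_gt0 => //; exact: mulr_gt0.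
    by rewrite !lt_min d0 d'0 ltr01 u1 u2.
  move=> k; rewrite !lt_min => /andP[/andP[k1 k2] /andP[/andP[k3 k4] /andP[k5 k6]]].
  rewrite ltr_pdivlMr// in k4; rewrite ltr_pdivlMr// in k5.
  rewrite ltr_pdivlMr ?mulr_gt0// in k6.
  have kk := modulus_ge0 k.
  set w := x +i* y + k.
  have tw : modulus (tau w) <= L * modulus k by have := hL k k1; rewrite subr0.
  have tw1 : modulus (tau w) <= 1.
    by apply: le_trans tw _; move: k4 kk; clear; lra.
  have pw : modulus (Psi w - r) <= dr.
    by apply: le_trans (hL' k k2) _; move: k5 kk; clear; lra.
  have pw1 : 1 + dr <= modulus (Psi w).
    have := modulusB (Psi w) (Psi w - r); rewrite subKr.
    by move: pw; rewrite /dr; clear; lra.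
  have pw0 : 1 < modulus (Psi w) by lra.
  have := joukowski_modulus_lower (F w) pw0; rewrite PsiE => hlow.
  set q := modulus (c ^+ 2 * _) in hlow.
  have hq : q / (modulus (Psi w) - 1) <= N * modulus k ^+ 3.
    have q1 : q <= modulus (c ^+ 2) * (L ^+ 3 * modulus k ^+ 3).
      rewrite /q modulusM; apply: ler_wpM2l; first exact: modulus_ge0.
      rewrite modulusM modulusX -exprMn -[leRHS]mulr1; apply: ler_pM.
      - by rewrite exprn_ge0// modulus_ge0.
      - exact: modulus_ge0.
      - by apply: lerXn2r => //; rewrite nnegrE ?modulus_ge0// mulr_ge0.
      apply: le_trans (modulusB _ _) _.
      rewrite (modulusM (tau w)) (modulusM 1) !modulusV modulus1 mul1r.
      have nn n : modulus (n%:R : R[i]) = n%:R.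
        by rewrite (_ : n%:R = (n%:R : R)%:C) ?modulus_real ?normr_nat// rmorph_nat.
      by rewrite !nn; move: tw1; clear; lra.
    rewrite ler_pdivrMr; last by lra.
    apply: le_trans q1 _.
    have -> : modulus (c ^+ 2) * (L ^+ 3 * modulus k ^+ 3) = N * modulus k ^+ 3 * dr.
      by rewrite /N; field; exact: lt0r_neq0.
    by apply: ler_wpM2l; [rewrite mulr_ge0// exprn_ge0|lra].
  set s := N * modulus k ^+ 3 in hq.
  have s0 : 0 <= s by rewrite mulr_ge0// exprn_ge0.
  have s1 : s <= 1 / 2.
    have : N * modulus k ^+ 3 <= N * modulus k.
      by apply: ler_wpM2l => //; rewrite exprS ler_piMr// exprn_ile1// ltW.
    by rewrite -/s; move: k6 kk; clear; lra.
  set p := modulus (Psi w) in pw1 pw0 hlow hq *.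
  have p0 : 0 < p by lra.
  have sp : `|(p - s) / p - 1| <= s.
    have -> : (p - s) / p - 1 = - (s / p) by field; exact: lt0r_neq0.
    have sp0 : 0 <= s / p by apply: divr_ge0 => //; exact: ltW.
    rewrite normrN ger0_norm// ler_pdivrMr//.
    by apply: ler_peMr => //; exact: ltW.
  have := ln_near1 (le_trans sp s1).
  have ps0 : 0 < p - s by lra.
  rewrite ln_div ?posrE// ler_norml => /andP[h1 _].
  have h2 : ln (p - s) <= ln (joukowski_modulus (F w)).
    rewrite ler_ln ?posrE//; last by apply: lt_le_trans (joukowski_modulus_ge1 _).
    by apply: le_trans hlow; lra.
  by move: h1 h2 sp; rewrite -/s; set q1 := `|_|; rewrite -mulrA -/s; clear; lra.
have [dl dl0 hlow] := low.
move=> e e0; have e20 : 0 < e / 2 by rewrite divr_gt0.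
have [d1 d10 h1] := hLn _ e20.
have N10 : 0 < N + 1 by rewrite ltr_wpDl.
exists (Num.min (Num.min d1 dl) (e / (16 * (N + 1)))).
  by rewrite !lt_min d10 dl0 divr_gt0// mulr_gt0.
move=> h h0; rewrite !lt_min => /andP[/andP[hd1 hdl] he].
rewrite ltr_pdivlMr ?mulr_gt0// in he.
have := h1 h h0 hd1; rewrite /lap4.
rewrite !(complex_steps x y h).
have -> : Psi (x +i* y) = r by have := taylor2_0 hPsi; rewrite addr0.
rewrite FA rE.
have mh : modulus h%:C = h by rewrite modulus_real gtr0_norm.
have := hlow h%:C; have := hlow (- h%:C); have := hlow ('i * h%:C); have := hlow (- ('i * h%:C)).
rewrite !modulusN modulusM modulus_i mul1r mh.
move=> /(_ hdl) i1 /(_ hdl) i2 /(_ hdl) i3 /(_ hdl) i4.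
have h3 : 8 * N * h ^+ 3 <= e / 2 * h ^+ 2.
  rewrite (exprS h 2) mulrA; apply: ler_wpM2r; first exact: sqr_ge0.
  by move: he h0; clear; lra.
move: i1 i2 i3 i4 h3; clear; lra.
Qed.

Lemma half_expR_diff (R : realType) (t : R) : 0 <= t -> t <= 1 / 2 ->
  (expR t - (expR t)^-1) / 2 <= t + t ^+ 2.
Proof.
move=> t0 t1; have e0 := expR_gt0 t.
have h1 : 1 - t <= (expR t)^-1 by rewrite -expRN; exact: expR_ge1Dx.
have h2 : expR t <= 1 + t + 2 * t ^+ 2.
  have : expR t * (1 - t) <= 1.
    by have := ler_wpM2l (ltW e0) h1; rewrite mulfV ?gt_eqF.
  move=> h; have t2 : 0 < 1 - t by lra.
  rewrite -(ler_pM2r t2); apply: le_trans h _.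
  have : 0 <= t ^+ 2 * (1 - 2 * t) by apply: mulr_ge0; [exact: sqr_ge0|lra].
  by clear; lra.
lra.
Qed.

(* [ln (joukowski_modulus G)], for [G] the analytic continuation of the real part
   of a rotation of [F], is compared with [(sigma + 2 ln 4 / dl) * y] in a half square. *)
Lemma local_bernstein (R : realType) (F : R[i] -> R[i]) (dl sigma : R) (A a b : R[i]) :
  0 < dl -> 0 <= sigma ->
  (forall x y : R, `|x| <= dl -> `|y| <= dl ->
     exists B c d, taylor2 (fun k => F ((x +i* y) + k)) B c d) ->
  (forall x y : R, `|x| <= dl -> `|y| <= dl -> modulus (F (x +i* y)) <= expR (sigma * `|y|)) ->
  taylor2 F A a b -> modulus a <= sigma + 2 * ln 4 / dl.
Proof.
move=> dl0 s0 hT hF hF0.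
have ln40 : 0 <= ln (4 : R) by rewrite ln_ge0// ler1n.
have [->|a0] := eqVneq a 0.
  by rewrite modulus0 addr_ge0// divr_ge0 ?mulr_ge0// ltW.
have ma : 0 < modulus a by rewrite modulus_gt0.
(* The rotation makes the derivative equal to the positive number |a|, so that passing to the real
   part on the axis loses nothing. *)
pose lam : R[i] := (modulus a)^-1%:C * conjc a.
have lam1 : modulus lam = 1.
  by rewrite modulusM modulus_real modulus_conj gtr0_norm ?invr_gt0// mulVf ?gt_eqF.
have lama : lam * a = (modulus a)%:C.
  rewrite /lam -mulrA.
  have -> : conjc a * a = (modulus a ^+ 2)%:C.
    rewrite modulus_sqr; case: (a) => p q.
    by apply/eqP; rewrite eq_complex /=; apply/andP; split; apply/eqP; ring.
  by rewrite -rmorphM /= expr2 mulKf ?gt_eqF.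
clearbody lam.
(* Symmetrisation preserves the bound on F, as that bound depends only on |y|, and makes G real on
   the axis, where it takes values in [-1, 1]. *)
pose G (w : R[i]) := (lam * F w + conjc (lam * F (conjc w))) * 2^-1.
have GT x y : `|x| <= dl -> `|y| <= dl ->
    exists B c d, taylor2 (fun k => G ((x +i* y) + k)) B c d.
  move=> hx hy; have [B [c [d h1]]] := hT x y hx hy.
  have hy' : `|- y| <= dl by rewrite normrN.
  have [B' [c' [d' h2]]] := hT x (- y) hx hy'.
  do 3 eexists.
  have := taylor2M (taylor2D (taylor2M (taylor2_cst lam) h1)
    (taylor2_conj (taylor2M (taylor2_cst lam) h2))) (taylor2_cst 2^-1).
  rewrite (_ : (fun k => _) = (fun k => G ((x +i* y) + k))); first by move=> h; exact: h.
  apply/funext => k; rewrite /G; congr ((_ + conjc (_ * F _)) * _).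
  by rewrite conjD.
pose A' := lam * A; pose b' := lam * b.
have GT0 : taylor2 G ((A' + conjc A') * 2^-1) (modulus a)%:C ((b' + conjc b') * 2^-1).
  have h := taylor2M (taylor2_cst lam) hF0.
  have := taylor2M (taylor2D h (taylor2_conj h)) (taylor2_cst 2^-1).
  rewrite !mulr0 !mul0r !addr0 !add0r lama -/A' -/b'.
  have -> : conjc (modulus a)%:C = (modulus a)%:C by rewrite /real_complex_def /= oppr0.
  by rewrite (_ : ((modulus a)%:C + (modulus a)%:C) * 2^-1 = (modulus a)%:C)//; field.
have Greal (x : R) : complex.Im (G x%:C) = 0.
  rewrite /G.
  have -> : conjc x%:C = x%:C by rewrite /real_complex_def /= oppr0.
  case: (lam * F x%:C) => p q.
  have -> : (p +i* q + conjc (p +i* q)) * 2^-1 = p%:C.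
    have -> : p +i* q + conjc (p +i* q) = p%:C * 2.
      by apply/eqP; rewrite eq_complex /=; apply/andP; split; apply/eqP; ring.
    by rewrite mulfK.
  by [].
have m2 : modulus (2^-1 : R[i]) = 2^-1.
  rewrite modulusV; congr (_^-1).
  by rewrite (_ : 2 = (2 : R)%:C) ?modulus_real ?normr_nat// rmorph_nat.
have Gbd x y : `|x| <= dl -> `|y| <= dl -> modulus (G (x +i* y)) <= expR (sigma * `|y|).
  move=> hx hy; have hy' : `|- y| <= dl by rewrite normrN.
  have h1 := hF x y hx hy; have := hF x (- y) hx hy'; rewrite normrN => h2.
  rewrite modulusM m2 ler_pdivrMr//.
  apply: le_trans (modulusD _ _) _; rewrite modulus_conj !modulusM lam1 !mul1r.
  by rewrite mulr_natr mulr2n lerD.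
pose u x y := ln (joukowski_modulus (G (x +i* y))) - sigma * y.
have box x y : - dl <= x -> x <= dl -> 0 <= y -> y <= dl -> `|x| <= dl /\ `|y| <= dl.
  by move=> h1 h2 h3 h4; split; rewrite ler_norml ?h1//; apply/andP; split; lra.
have main (y : R) : 0 <= y -> y <= dl -> u 0 y <= 2 * ln 4 * y / dl.
  (* The bound ln 4 comes from J <= 2 |G| + 2 <= 4 exp (sigma y), the second inequality because exp
     (sigma y) >= 1. *)
  apply: (@linear_bound _ u 0 (- dl) dl dl (ln 4)) => //.
  - by rewrite oppr_le0 ltW.
  - exact: ltW.
  - move=> x z h1 h2 h3 h4; have [hx hz] := box _ _ h1 h2 h3 h4.
    have [B [c [d h]]] := GT x z hx hz.
    apply: cont2B; first exact: joukowski_cont2 h.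
    by apply: cont2M; [exact: cont2_cst|exact: cont2_snd].
  - move=> x z h1 h2 h3 h4; have [hx hz] := box _ _ (ltW h1) (ltW h2) (ltW h3) (ltW h4).
    have [B [c [d h]]] := GT x z hx hz.
    apply: subharmD; first exact: joukowski_subharm h.
    by apply: subharm_lap0 => t; rewrite /lap4; ring.
  - move=> x z h1 h2 h3 h4; have [hx hz] := box _ _ h1 h2 h3 h4.
    have := Gbd x z hx hz; rewrite (ger0_norm h3) => h.
    have E1 : 1 <= expR (sigma * z) by rewrite -expR0 ler_expR mulr_ge0.
    have : ln (joukowski_modulus (G (x +i* z))) <= ln (4 * expR (sigma * z)).
      have J0 := lt_le_trans ltr01 (joukowski_modulus_ge1 (G (x +i* z))).
      have e40 : 0 < 4 * expR (sigma * z) by apply: mulr_gt0 => //; exact: expR_gt0.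
      rewrite ler_ln ?posrE//.
      by apply: le_trans (joukowski_modulus_upper _) _; lra.
    rewrite lnM ?posrE ?expR_gt0// expRK /u; lra.
  - move=> x h1 h2; have hx : `|x| <= dl by rewrite ler_norml h1.
    have hz : `|0 : R| <= dl by rewrite normr0 ltW.
    have := Gbd x 0 hx hz; rewrite normr0 mulr0 expR0 => h.
    have e : G (x +i* 0) = (complex.Re (G (x +i* 0)))%:C.
      by have := Greal x; rewrite /real_complex_def; case: (G _) => p q /= ->.
    rewrite /u mulr0 subr0 e joukowski_modulus_segment ?ln1//.
    exact: le_trans (Re_le_modulus _) h.
  - by move=> z _ _; right; rewrite sub0r opprK.
  - by move=> z _ _; right; rewrite subr0.
set Lam := sigma + 2 * ln 4 / dl.
have Lam0 : 0 <= Lam by rewrite addr_ge0// divr_ge0 ?mulr_ge0// ltW.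
have [M [d [M0 d0 hM]]] := GT0.
set A1 := _ * 2^-1 in hM; set b1 := (b' + _) * 2^-1 in hM.
pose N := M + modulus b1 + Lam ^+ 2.
have N0 : 0 <= N by rewrite !addr_ge0 ?modulus_ge0 ?sqr_ge0.
(* On the imaginary axis Im G (iy) = |a| y + O(y^2), whereas |Im G| <= (J - 1 / J) / 2 <= sinh (Lam
   y) <= Lam y + (Lam y)^2. The three terms of N collect the quadratic errors. *)
have key (y : R) : 0 < y -> y <= dl -> y < d -> y <= 1 -> y * (Lam + 1) <= 1 / 2 ->
    modulus a <= Lam + N * y.
  move=> y0 ydl yd y1 yL.
  have Ly : 0 <= Lam * y by rewrite mulr_ge0// ltW.
  have Ly2 : Lam * y <= 1 / 2 by move: yL y0; clear; lra.
  have h1 : ln (joukowski_modulus (G (0 +i* y))) <= Lam * y.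
    by have := main y (ltW y0) ydl; rewrite /u /Lam; lra.
  have J1 := joukowski_modulus_ge1 (G (0 +i* y)).
  set J := joukowski_modulus _ in h1 J1.
  have J0 : 0 < J by lra.
  have h2 : J <= expR (Lam * y) by rewrite -[J]lnK ?posrE// ler_expR.
  have h3 : `|complex.Im (G (0 +i* y))| <= Lam * y + (Lam * y) ^+ 2.
    apply: le_trans (Im_joukowski _) _; rewrite -/J.
    apply: le_trans (half_expR_diff Ly Ly2).
    have : (expR (Lam * y))^-1 <= J^-1 by rewrite lef_pV2 ?posrE ?expR_gt0.
    lra.
  have my : modulus (0 +i* y) = y by rewrite /modulus /= expr0n add0r sqrtr_sqr gtr0_norm.
  have := hM (0 +i* y); rewrite my => /(_ yd) h4.
  have := le_trans (Im_le_modulus _) h4.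
  have A1r : complex.Im A1 = 0 by have := Greal 0; rewrite (_ : 0%:C = 0)// (taylor2_0 GT0).
  have b1m : `|complex.Im (b1 * (0 +i* y) ^+ 2)| <= modulus b1 * y ^+ 2.
    by apply: le_trans (Im_le_modulus _) _; rewrite modulusM modulusX my.
  rewrite ImD ImN (ImD (A1 + _)) (ImD A1) A1r Im_scale /=.
  move: h3 b1m; set g := complex.Im (G _); set w := complex.Im (b1 * _).
  rewrite !ler_norml => /andP[_ g1] /andP[w1 w2] /andP[g2 g3].
  have yy : M * y ^+ 3 <= M * y ^+ 2.
    by apply: ler_wpM2l => //; rewrite exprS ler_piMl// sqr_ge0.
  rewrite -(ler_pM2r y0) /N.
  by move: g1 w1 w2 g2 g3 yy; clear; lra.
apply/ler_addgt0Pr => e e0.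
have N10 : 0 < N + 1 by rewrite ltr_wpDl.
have L10 : 0 < Lam + 1 by rewrite ltr_wpDl.
pose y := Num.min (Num.min dl (d / 2)) (Num.min (Num.min 1 (1 / (2 * (Lam + 1)))) (e / (N + 1))).
have [u1 u2] : 0 < 1 / (2 * (Lam + 1)) /\ 0 < e / (N + 1).
  by split; apply: divr_gt0 => //; exact: mulr_gt0.
have y0 : 0 < y by rewrite !lt_min dl0 ltr01 u1 u2 divr_gt0.
have [y1 y2 y3 y4 y5] : [/\ y <= dl, y <= d / 2, y <= 1, y <= 1 / (2 * (Lam + 1)) & y <= e / (N + 1)].
  by split; rewrite /y !ge_min lexx ?orbT.
rewrite ler_pdivlMr ?mulr_gt0// in y4; rewrite ler_pdivlMr// in y5.
have yd : y < d by move: y2 d0; clear; lra.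
have yL : y * (Lam + 1) <= 1 / 2 by move: y4; clear; lra.
have := key y y0 y1 yd y3 yL.
by move: y5 y0; clear; lra.
Qed.

Lemma taylor2_first_order (R : realType) (f : R[i] -> R[i]) (A a b : R[i]) :
  taylor2 f A a b -> exists L d : R, [/\ 0 <= L, 0 < d & forall k, modulus k < d ->
    modulus (f k - A - a * k) <= L * modulus k ^+ 2].
Proof.
move=> [M [d [M0 d0 hf]]].
exists (M + modulus b), (Num.min d 1); split.
- by rewrite addr_ge0// modulus_ge0.
- by rewrite lt_min d0 ltr01.
move=> k; rewrite lt_min => /andP[/hf h /ltW k1].
rewrite (_ : f k - A - a * k = (f k - (A + a * k + b * k ^+ 2)) + b * k ^+ 2); last by ring.
apply: le_trans (modulusD _ _) _; rewrite (modulusM b) modulusX mulrDl; apply: lerD => //.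
apply: le_trans h _; apply: ler_wpM2l => //.
by rewrite exprS ler_piMl// sqr_ge0.
Qed.

(** * Normals and the main estimate *)

(** A unit normal may refer to another parametrization of K. Each gamma2 (t2 + s) lies on K, hence
    is gamma (s0 + sig) with a small real sig, and comparing first order expansions gives e2 s - e1
    sig = O(s^2). Dividing by e1 s and taking imaginary parts shows that e2 / e1 is real. The step s
    is positive, which needs t2 < b2. *)
Lemma tangent_parallel (R : realType) (K : set R[i]) (a b a2 b2 : R)
    (gamma gamma2 : R -> R[i]) (s0 t2 : R) :
  analytic_arc_param K a b gamma -> analytic_arc_param K a2 b2 gamma2 ->
  a <= s0 -> s0 <= b -> a2 <= t2 -> t2 < b2 -> gamma2 t2 = gamma s0 ->
  exists2 kap : R, kap != 0 & curve_derive gamma2 t2 = kap%:C * curve_derive gamma s0.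
Proof.
move=> hK hK2 as0 s0b at2 t2b gg.
have [Gam [X [hG hr [b1 hT]]]] := green_chart_exists hK as0 s0b.
have [X0 e10 _ hD _] := hG.
have [Gam2 [X2 [hG2 hr2 [b2' hT2]]]] := green_chart_exists hK2 at2 (ltW t2b).
have [X20 e20 _ _ _] := hG2.
set e1 := curve_derive gamma s0 in e10 hD hT *; set e2 := curve_derive gamma2 t2 in e20 hT2 *.
have m0 : 0 < modulus e1 by rewrite modulus_gt0.
have [_ _ _ _ KE] := hK; have [_ _ _ _ KE2] := hK2.
have G0 : Gam 0 = gamma s0 by have := hr 0; rewrite normr0 addr0 => ->.
have [d d0 hsep] := arc_separated hK as0 s0b X0.
have [L1 [d1 [L10 d10 h1]]] := taylor2_first_order hT.
have [L2 [d2 [L20 d20 h2]]] := taylor2_first_order hT2.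
have [L3 [d3 [L30 d30 h3]]] := taylor2_lipschitz hT2.
(* The chart expands distances by at least |e1| / 2 and gamma2 is Lipschitz with constant L3 near
   t2, whence |sig| <= c s. *)
pose c := 2 * L3 / modulus e1.
have c0 : 0 <= c by rewrite divr_ge0 ?mulr_ge0// ltW.
pose N := (L2 + L1 * c ^+ 2) / modulus e1.
have N0 : 0 <= N by rewrite divr_ge0 ?(ltW m0)// addr_ge0// mulr_ge0// sqr_ge0.
have im0 : complex.Im (e2 / e1) = 0.
  apply/eqP; rewrite -normr_le0; apply/ler_addgt0Pr => e e0; rewrite add0r.
  have L310 : 0 < L3 + 1 by rewrite ltr_wpDl.
  have c10 : 0 < c + 1 by rewrite ltr_wpDl.
  have N10 : 0 < N + 1 by rewrite ltr_wpDl.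
  pose s := Num.min (Num.min (Num.min X2 (b2 - t2)) (Num.min d2 d3))
    (Num.min (Num.min (d / (L3 + 1)) (d1 / (c + 1))) (e / (N + 1))) / 2.
  have ss0 : 0 < 2 * s.
    rewrite /s mulrC divfK// !lt_min X20 subr_gt0 t2b d20 d30.
    by rewrite (divr_gt0 d0)// (divr_gt0 d10)// (divr_gt0 e0).
  have sp : 0 < s by lra.
  have : 2 * s <= 2 * s by [].
  rewrite {2}/s [leRHS]mulrC divfK// !le_min.
  move=> /andP[/andP[/andP[q1 q2] /andP[q3 q4]] /andP[/andP[q5 q6] q7]].
  rewrite ler_pdivlMr// in q5; rewrite ler_pdivlMr// in q6; rewrite ler_pdivlMr// in q7.
  have ms : modulus s%:C = s by rewrite modulus_real gtr0_norm.
  have sX2 : `|s| < X2 by rewrite gtr0_norm//; lra.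
  have Ks : K (gamma2 (t2 + s)).
    by rewrite KE2; exists (t2 + s) => //=; rewrite in_itv /=; apply/andP; split; lra.
  move: Ks; rewrite -(hr2 s sX2) KE => -[s' /= + gs'].
  rewrite in_itv /= => /andP[s'1 s'2].
  have sd3 : modulus s%:C < d3 by rewrite ms; lra.
  have sd2 : modulus s%:C < d2 by rewrite ms; lra.
  have lip := h3 _ sd3; rewrite ms gg in lip.
  have sX : `|s' - s0| < X.
    apply: hsep => //; rewrite gs'; apply: le_lt_trans lip _.
    by move: q5 sp (mulr_ge0 L30 (ltW sp)); clear; lra.
  set sig := s' - s0 in sX.
  have Gsig : Gam sig%:C = Gam2 s%:C by rewrite hr// /sig (addrC s0) subrK gs'.
  have msig : modulus sig%:C < X by rewrite modulus_real.
  have m00 : modulus (0 : R[i]) < X by rewrite modulus0.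
  have sigs : `|sig| <= c * s.
    have := hD _ _ msig m00; rewrite Gsig G0 subr0 modulus_real => h.
    have := modulusB (Gam2 s%:C - gamma s0) (Gam2 s%:C - gamma s0 - e1 * sig%:C).
    rewrite subKr modulusM modulus_real => h'.
    have -> : c * s = 2 * (L3 * s) / modulus e1 by rewrite /c; ring.
    by rewrite ler_pdivlMr//; move: h h' lip; clear; lra.
  have sigd1 : modulus sig%:C < d1.
    rewrite modulus_real; apply: le_lt_trans sigs _.
    by move: q6 sp (mulr_ge0 c0 (ltW sp)); clear; lra.
  have k1 := h1 _ sigd1; have k2 := h2 _ sd2.
  rewrite Gsig modulus_real in k1; rewrite ms gg in k2.
  have k3 : modulus (e2 * s%:C - e1 * sig%:C) <= (L2 + L1 * c ^+ 2) * s ^+ 2.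
    have -> : e2 * s%:C - e1 * sig%:C = (Gam2 s%:C - gamma s0 - e1 * sig%:C) -
      (Gam2 s%:C - gamma s0 - e2 * s%:C) by ring.
    apply: le_trans (modulusB _ _) _; rewrite mulrDl addrC; apply: lerD => //.
    apply: le_trans k1 _; rewrite -mulrA; apply: ler_wpM2l => //.
    by rewrite -exprMn; apply: lerXn2r => //; rewrite nnegrE// mulr_ge0// ltW.
  have k4 : `|complex.Im (e2 / e1)| * s <= N * s * s.
    have -> : `|complex.Im (e2 / e1)| * s = `|complex.Im (e2 / e1 * s%:C - sig%:C)|.
      rewrite ImD ImN (mulrC (e2 / e1)) Im_scale (_ : complex.Im sig%:C = 0)//.
      by rewrite oppr0 addr0 normrM (gtr0_norm sp) mulrC.
    apply: le_trans (Im_le_modulus _) _.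
    have -> : e2 / e1 * s%:C - sig%:C = (e2 * s%:C - e1 * sig%:C) / e1 by field.
    rewrite modulusM modulusV ler_pdivrMr//; apply: le_trans k3 _.
    by rewrite /N; apply: le_of_eq; field; exact: lt0r_neq0.
  rewrite ler_pM2r// in k4; apply: le_trans k4 _.
  by move: q7 sp (mulr_ge0 N0 (ltW sp)); clear; lra.
have e2E : e2 = (complex.Re (e2 / e1))%:C * e1.
  have -> : (complex.Re (e2 / e1))%:C = e2 / e1.
    by move: im0; case: (e2 / e1) => p q /= ->.
  by rewrite divfK.
exists (complex.Re (e2 / e1)) => //.
by apply: contraNneq e20 => h; rewrite e2E h mul0r.
Qed.

(** By [tangent_parallel] the orthogonality holds for the given tangent e1 as well, so nu times the
    conjugate of e1 is purely imaginary of modulus |e1|. The point is no endpoint in any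
    parametrization, which supplies the strict inequality required there. *)
Lemma unit_normal_direction (R : realType) (K : set R[i]) (a b : R) (gamma : R -> R[i])
    (s0 : R) (nu : R[i]) :
  analytic_arc_param K a b gamma -> a <= s0 -> s0 <= b -> ~ arc_endpoint K (gamma s0) ->
  unit_normal K (gamma s0) nu ->
  exists2 sg : R, sg = 1 \/ sg = -1 &
    nu = (sg / modulus (curve_derive gamma s0))%:C * ('i * curve_derive gamma s0).
Proof.
move=> hK as0 s0b nend [nu1 [a2 [b2 [gamma2 [t2 [hK2 t2in zE nuE]]]]]].
move: (t2in); rewrite in_itv /= => /andP[at2 t2b].
have t2b' : t2 < b2.
  rewrite lt_neqAle t2b andbT; apply/eqP => tb; apply: nend.
  by exists a2, b2, gamma2; split=> //; right; rewrite -tb.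
have [kap kap0 e2E] := tangent_parallel hK hK2 as0 s0b at2 t2b' (esym zE).
have [_ _ dn _ _] := hK; have e10 : curve_derive gamma s0 != 0 by apply: dn; rewrite in_itv /= as0.
have {}nuE : complex.Re (nu * conjc (curve_derive gamma2 t2)) = 0 by exact: nuE.
set e1 := curve_derive gamma s0 in e2E e10 *.
have m0 : 0 < modulus e1 by rewrite modulus_gt0.
have re0 : complex.Re (nu * conjc e1) = 0.
  move: nuE; rewrite e2E conjM.
  have -> : conjc kap%:C = kap%:C by rewrite /real_complex_def /= oppr0.
  by rewrite mulrCA Re_scale => /eqP; rewrite mulf_eq0 (negPf kap0) /= => /eqP.
have ee : conjc e1 * e1 = (modulus e1 ^+ 2)%:C.
  rewrite modulus_sqr; case: (e1) => p q.
  by apply/eqP; rewrite eq_complex /=; apply/andP; split; apply/eqP; ring.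
pose q := complex.Im (nu * conjc e1).
have qE : nu * conjc e1 = 'i * q%:C.
  rewrite /q; move: re0; case: (nu * conjc e1) => p r /= ->.
  by apply/eqP; rewrite eq_complex /=; apply/andP; split; apply/eqP; ring.
have qm : `|q| = modulus e1.
  have := congr1 (@modulus R) qE.
  by rewrite !modulusM nu1 modulus_conj modulus_i !mul1r modulus_real.
exists (q / modulus e1).
  case: (leP 0 q) => q0.
    by left; rewrite -qm ger0_norm// divff// -normr_eq0 qm gt_eqF.
  by right; rewrite -qm ltr0_norm// invrN mulrN divff// lt_eqF.
have cj : conjc e1 != 0 by rewrite -modulus_gt0 modulus_conj.
apply: (mulIf cj); rewrite qE.
have -> : (q / modulus e1 / modulus e1)%:C * ('i * e1) * conjc e1 =
  (q / modulus e1 / modulus e1)%:C * (conjc e1 * e1) * 'i by ring.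
rewrite ee -rmorphM /= (_ : q / modulus e1 / modulus e1 * modulus e1 ^+ 2 = q); first by rewrite mulrC.
by field; exact: lt0r_neq0.
Qed.

Lemma supnorm_ge (R : realType) (K : set R[i]) (a b : R) (gamma : R -> R[i])
    (P : {poly R[i]}) (w : R[i]) :
  analytic_arc_param K a b gamma -> K w -> modulus P.[w] <= supnorm K (fun z => P.[z]).
Proof.
move=> hK Kw; have [L hL] := arc_bounded hK.
apply: sup_upper_bound; last by exists w.
split; first by exists (modulus P.[w]), w.
exists (\sum_(0 <= k < size P) modulus P`_k * (`|L| + 1) ^+ k) => _ [z Kz <-].
rewrite horner_coef -(big_mkord xpredT (fun i => P`_i * z ^+ i)).
apply: le_trans (modulus_sum _ _) _; apply: ler_sum => k _.
rewrite modulusM modulusX; apply: ler_wpM2l; first exact: modulus_ge0.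
apply: lerXn2r; rewrite ?nnegrE ?modulus_ge0 ?addr_ge0//.
by apply: le_trans (hL z Kz) _; have := ler_norm L; lra.
Qed.

(* The half square of side [Y / sqrt n] balances the error terms
   [n * C * dl] and [2 * ln 4 / dl]. *)
Lemma bernstein_chart (R : realType) (K : set R[i]) (a b : R) (gamma : R -> R[i])
    (g : R[i] -> R) (Gam : R[i] -> R[i]) (z0 e1 c : R[i]) (X m C Y : R)
    (n : nat) (P : {poly R[i]}) :
  analytic_arc_param K a b gamma -> is_green_infty K g -> green_chart K Gam e1 X ->
  taylor2 Gam z0 e1 c -> 0 <= m -> 0 <= C -> 0 < Y -> Y <= X / 3 ->
  (forall sg x y : R, sg = 1 \/ sg = -1 -> `|x| <= Y -> 0 <= y -> y <= Y ->
    pullback g Gam sg x y <= m * y + C * (`|x| + y) * y) ->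
  (0 < n)%N -> (size P <= n.+1)%N ->
  modulus P^`().[z0] * modulus e1 <=
    supnorm K (fun z => P.[z]) * (n%:R * m + (2 * C * Y + 2 * ln 4 / Y) * Num.sqrt n%:R).
Proof.
move=> hK hg hG hc m0 C0 Y0 YX hm n0 sP.
have [X0 e10 hT hD hI] := hG; have [ab _ _ _ KE] := hK.
set N := supnorm K _.
have hN w : K w -> modulus P.[w] <= N by move=> Kw; exact: supnorm_ge hK Kw.
have N0 : 0 <= N.
  apply: le_trans (modulus_ge0 P.[gamma a]) (hN _ _).
  by rewrite KE; exists a => //=; rewrite in_itv /= lexx ltW.
have nR : 1 <= n%:R :> R by rewrite ler1n.
set sq := Num.sqrt n%:R.
have sq1 : 1 <= sq by rewrite -sqrtr1 ler_wsqrtr.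
have sq0 : 0 < sq by lra.
have sq2 : sq ^+ 2 = n%:R by rewrite sqr_sqrtr//; lra.
pose dl := Y / sq.
have dl0 : 0 < dl by rewrite divr_gt0.
have dlY : dl <= Y by rewrite ler_pdivrMr// ler_peMr// ltW.
pose sigma := n%:R * (m + 2 * C * dl).
have mC0 : 0 <= m + 2 * C * dl by apply: addr_ge0 => //; apply: mulr_ge0; [exact: mulr_ge0|exact: ltW].
have sigma0 : 0 <= sigma by exact: mulr_ge0.
set Q := n%:R * m + _.
have QE : sigma + 2 * ln 4 / dl = Q.
  rewrite /Q /sigma /dl -sq2; field; rewrite !gt_eqF//.
have gb x y : `|x| <= dl -> `|y| <= dl -> g (Gam (x +i* y)) <= (m + 2 * C * dl) * `|y|.
  move=> hx hy.
  have side (sg t : R) : sg = 1 \/ sg = -1 -> 0 <= t -> t <= dl ->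
      pullback g Gam sg x t <= (m + 2 * C * dl) * t.
    move=> hsg t0 tdl; apply: le_trans (hm sg x t hsg (le_trans hx dlY) t0 (le_trans tdl dlY)) _.
    rewrite mulrDl lerD2l; apply: ler_wpM2r => //.
    by rewrite (mulrC 2) -mulrA; apply: ler_wpM2l => //; lra.
  case: (leP 0 y) => y0.
    have := side 1 y; rewrite /pullback mul1r (ger0_norm y0); apply=> //; first by left.
    by move: hy; rewrite ger0_norm.
  have := side (-1) (- y); rewrite /pullback mulN1r opprK (ltr0_norm y0); apply.
  - by right.
  - by rewrite oppr_ge0 ltW.
  - by move: hy; rewrite ltr0_norm.
(* Normalising by M > N keeps the divisor positive even if the norm N is zero; afterwards M
   decreases to N. *)
have main (M : R) : N < M -> modulus P^`().[z0] * modulus e1 <= M * Q.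
  move=> NM; have M0 : 0 < M by lra.
  pose F (w : R[i]) := (M^-1)%:C * P.[Gam w].
  have mM : modulus (M^-1)%:C = M^-1 by rewrite modulus_real gtr0_norm ?invr_gt0.
  have [c' hc'] := taylor2_horner P hc.
  have F0 := taylor2M (taylor2_cst (M^-1)%:C) hc'.
  have FT x y : `|x| <= dl -> `|y| <= dl ->
      exists B c d, taylor2 (fun k => F ((x +i* y) + k)) B c d.
    move=> hx hy.
    have wX : modulus (x +i* y) < X.
      have := @small_modulus R x y 1 X; rewrite mul1r normr1; apply=> //.
        by apply: le_trans hx (le_trans dlY YX).
      by apply: le_trans hy (le_trans dlY YX).
    have [a1 [b1 h1]] := hT _ wX; have [c1 h2] := taylor2_horner P h1.
    by do 3 eexists; exact: (taylor2M (taylor2_cst (M^-1)%:C) h2).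
  have Fb x y : `|x| <= dl -> `|y| <= dl -> modulus (F (x +i* y)) <= expR (sigma * `|y|).
    move=> hx hy; rewrite /F modulusM mM mulrC ler_pdivrMr//.
    have PK w : K w -> modulus P.[w] <= M by move=> /hN h; exact: le_trans h (ltW NM).
    apply: le_trans (bernstein_walsh (Gam (x +i* y)) hK hg n0 sP M0 PK) _.
    rewrite mulrC; apply: ler_wpM2r; first exact: ltW.
    rewrite ler_expR /sigma -mulrA; apply: ler_wpM2l => //; exact: gb.
  have := local_bernstein dl0 sigma0 FT Fb F0.
  rewrite QE mul0r addr0 modulusM mM modulusM => h.
  by rewrite -ler_pdivrMl.
have Q0 : 0 <= Q.
  rewrite -QE; apply: addr_ge0 => //; rewrite divr_ge0 ?(ltW dl0)// mulr_ge0// ln_ge0// ler1n//.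
apply/ler_addgt0Pr => e e0.
have Q10 : 0 < Q + 1 by rewrite ltr_wpDl.
have eQ : 0 < e / (Q + 1) by rewrite divr_gt0.
have NM : N < N + e / (Q + 1) by rewrite ltrDl.
apply: le_trans (main _ NM) _; rewrite mulrDl lerD2l.
by rewrite mulrAC ler_pdivrMr//; apply: ler_wpM2l; [exact: ltW|rewrite lerDl].
Qed.

Theorem theorem1 (R : realType) (K : set R[i]) (z0 : R[i])
    (hK : analytic_jordan_arc K) (hz0K : K z0) (hz0 : ~ arc_endpoint K z0) :
  exists eps : R^nat,
    eps @ \oo --> (0 : R) /\
    forall (g : R[i] -> R) (n1 n2 : R[i]),
      is_green_infty K g ->
      unit_normal K z0 n1 -> n2 = - n1 ->
      forall (n : nat) (P : {poly R[i]}), size P = n.+1 ->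
        modulus (P^`()).[z0] <=
          (1 + eps n) * n%:R * supnorm K (fun z => P.[z]) *
          Num.max (normal_derivative g z0 n1) (normal_derivative g z0 n2).
Proof.
have [a [b [gamma hKp]]] := hK.
have [ab _ dn _ KE] := hKp.
have [s0 s0in z0E] : exists2 s0, s0 \in `[a, b] & gamma s0 = z0.
  by move: hz0K; rewrite KE => -[s0 ? ?]; exists s0.
move: (s0in); rewrite in_itv /= => /andP[as0 s0b].
have as0' : a < s0.
  rewrite lt_neqAle as0 andbT; apply/eqP => h; apply: hz0.
  by exists a, b, gamma; split=> //; left; rewrite h.
have s0b' : s0 < b.
  rewrite lt_neqAle s0b andbT; apply/eqP => h; apply: hz0.
  by exists a, b, gamma; split=> //; right; rewrite -h.
(* One Green's function is fixed here so that [eps] can be built from it; if there were none, the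
   claim would be vacuous and the zero sequence would do. *)
have [[g hg]|nog] := pselect (exists g, is_green_infty K g); last first.
  exists (fun=> 0); split; first exact: cvg_cst.
  by move=> g n1 n2 hg; case: nog; exists g.
have [Gam [X [hG hr [c hc]]]] := green_chart_exists hKp as0 s0b.
set e1 := curve_derive gamma s0 in hG hc *.
have [X0 e10 hT hD hI] := hG.
have em : 0 < modulus e1 by rewrite modulus_gt0.
have p1 : (1 : R) = 1 \/ (1 : R) = -1 by left.
have p2 : (-1 : R) = 1 \/ (-1 : R) = -1 by right.
have [al [C1 [Y1 [C10 Y10 Y1X hal]]]] := side_slope_exists hKp hg hG hr as0' s0b' p1.
have [be [C2 [Y2 [C20 Y20 Y2X hbe]]]] := side_slope_exists hKp hg hG hr as0' s0b' p2.
pose m := Num.max al be.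
(* Positivity is what allows the additive error of [bernstein_chart] to be written relative to n m.
   If both slopes were nonpositive, Hopf's lemma would make both pull-backs vanish in the half
   boxes. *)
have m0 : 0 < m.
  have [[al0|be0]|h] := pselect (0 < al \/ 0 < be).
  - by rewrite lt_max al0.
  - by rewrite lt_max be0 orbT.
  exfalso; apply: (not_zero_near hKp hg as0 s0b).
  have G0 : Gam 0 = gamma s0 by have := hr 0; rewrite normr0 addr0 => ->.
  rewrite -G0; apply: (chart_zero_near hKp hg hG) => sg x y hsg hx y0 y3.
  apply/eqP; rewrite eq_le (green_ge0 _ hKp hg) andbT leNgt; apply/negP => up.
  apply: h; case: hsg up => -> up.
    by left; exact: side_slope_gt0 hKp hg hG p1 C10 Y10 hal hx y0 y3 up.
  by right; exact: side_slope_gt0 hKp hg hG p2 C20 Y20 hbe hx y0 y3 up.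
pose C := Num.max C1 C2; pose Y := Num.min Y1 Y2.
have C0 : 0 <= C by rewrite le_max C10.
have Y0 : 0 < Y by rewrite lt_min Y10.
have YX : Y <= X / 3 by rewrite ge_min Y1X.
have hm (sg x y : R) : sg = 1 \/ sg = -1 -> `|x| <= Y -> 0 <= y -> y <= Y ->
    pullback g Gam sg x y <= m * y + C * (`|x| + y) * y.
  move=> hsg; rewrite /Y !le_min => /andP[x1 x2] y0 /andP[y1 y2].
  have xy0 : 0 <= (`|x| + y) * y by rewrite mulr_ge0// addr_ge0.
  case: hsg => ->.
    have := hal x y x1 y0 y1; rewrite ler_norml lerBlDl => /andP[_ h]; apply: le_trans h _.
    apply: lerD; first by apply: ler_wpM2r => //; rewrite le_max lexx.
    by rewrite -!mulrA; apply: ler_wpM2r => //; rewrite le_max lexx.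
  have := hbe x y x2 y0 y2; rewrite ler_norml lerBlDl => /andP[_ h]; apply: le_trans h _.
  apply: lerD; first by apply: ler_wpM2r => //; rewrite le_max lexx orbT.
  by rewrite -!mulrA; apply: ler_wpM2r => //; rewrite le_max lexx orbT.
(* The error in [bernstein_chart] is m D sqrt n, and relative to the main term n m it is D / sqrt
   n. *)
pose D := (2 * C * Y + 2 * ln 4 / Y) / m.
exists (fun n => D / Num.sqrt n%:R); split.
  have D0 : 0 <= D.
    apply: divr_ge0; last exact: ltW.
    apply: addr_ge0; first by rewrite !mulr_ge0// ltW.
    by rewrite divr_ge0 ?(ltW Y0)// mulr_ge0// ln_ge0// ler1n.
  apply/cvgrPdist_le => e e0.
  exists (Num.truncn ((D / e) ^+ 2)).+1 => // n /= hn.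
  have hn' : (D / e) ^+ 2 < n%:R.
    by apply: lt_le_trans (truncnS_gt _) _; rewrite ler_nat.
  have n0 : 0 < n%:R :> R by apply: le_lt_trans hn'; exact: sqr_ge0.
  have sn : 0 < Num.sqrt n%:R :> R by rewrite sqrtr_gt0.
  rewrite sub0r normrN (ger0_norm (divr_ge0 D0 (ltW sn))) ler_pdivrMr// (mulrC e) -ler_pdivrMr//.
  have De : 0 <= D / e by rewrite divr_ge0// ltW.
  by rewrite -[leLHS](ger0_norm De) -sqrtr_sqr ler_wsqrtr// ltW.
move=> g' n1 n2 hg' hn1 hn2 n P sP.
have -> : g' = g by exact: green_unique hKp hg' hg.
(* In degree 0 the derivative vanishes and the right-hand side is 0 because of its factor n. *)
case: n sP => [|n] sP.
  have -> : P^`() = 0 by apply/eqP; rewrite -size_poly_eq0 -leqn0; apply: leq_trans (size_poly _ _) _; rewrite sP.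
  by rewrite horner0 modulus0 mulr0 !mul0r.
rewrite -z0E in hn1 hz0.
have [sg hsg n1E] := unit_normal_direction hKp as0 s0b hz0 hn1.
have nd1 := normal_derivative_side hG hc p1 C10 Y10 hal.
have nd2 := normal_derivative_side hG hc p2 C20 Y20 hbe.
have -> : Num.max (normal_derivative g z0 n1) (normal_derivative g z0 n2) = m / modulus e1.
  have mE : Num.max (al / modulus e1) (be / modulus e1) = m / modulus e1.
    by rewrite /m maxr_pMl// invr_ge0 ltW.
  have neg (t : R) : - ((t / modulus e1)%:C * ('i * e1)) = ((- t) / modulus e1)%:C * ('i * e1).
    by rewrite -mulNr -rmorphN /= mulNr.
  rewrite hn2 n1E -z0E -/e1 neg.
  (* The sign only decides which of the two normals points to which side, and the maximum is
     symmetric. *)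
  by case: hsg => ->; rewrite ?opprK nd1 nd2 // maxC.
have sq0 : 0 < Num.sqrt n.+1%:R :> R by rewrite sqrtr_gt0.
have := bernstein_chart hKp hg hG hc (ltW m0) C0 Y0 YX hm (ltn0Sn n) (eq_leq sP).
rewrite z0E -(ler_pdivlMr _ _ em) => h; apply: le_trans h _.
apply: le_of_eq.
rewrite /D; set N := supnorm _ _.
have sq2 : Num.sqrt n.+1%:R ^+ 2 = n.+1%:R :> R by rewrite sqr_sqrtr.
move: sq2 sq0; move: (Num.sqrt _) => sq sq2 sq0; rewrite -sq2.
by field; rewrite !gt_eqF.
Qed.
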